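(* Let $\varphi\in C^0([0,T];\mathbb{R}^d)$ be strongly $\rho$-irregular, $\rho>0$. Then for any $\psi\in C^\infty([0,T];\mathbb{R}^d)$, $\varphi+\psi$ is $\tilde\rho$-irregular for any $\tilde\rho<\rho$. Moreover, for any $\delta\in[0,1)$, almost every $\varphi\in C^\delta([0,T];\mathbb{R}^d)$ is strongly $\rho$-irregular for any $\rho<(2\delta)^{-1}$.
   Context: Convention: $(2\delta)^{-1}=+\infty$ for $\delta=0$. $C^\delta([0,T];\mathbb{R}^d)$ is the Banach space of $\delta$-Hölder paths for $\delta\in(0,1)$, and of continuous paths with supremum norm for $\delta=0$. For $\gamma\in[0,1]$, $\rho>0$, a path $w$ is $(\gamma,\rho)$-irregular if there is $C$ with $\big|\int_s^te^{i\xi\cdot w_r}\,dr\big|\le C|\xi|^{-\rho}|t-s|^\gamma$ for all $\xi\in\mathbb{R}^d\setminus\{0\}$, $s,t\in[0,T]$; it is $\rho$-irregular if this holds for some $\gamma>1/2$. Strong irregularity: let $F(\xi)=|\xi|^\rho/\sqrt{\log|\xi|}$ and $\psi_0(x)=\sqrt{x|\log x|}$. A path $w\in C^0([0,T];\mathbb{R}^d)$ is strongly $\rho$-irregular if for every $n\in\mathbb{N}$, writing $g^\eta_r=\sum_{k=1}^n\eta_kr^k$ for $\eta\in\mathbb{R}^n$, $$\sup_{\xi,\eta,s\ne t}\frac{\big|\int_s^te^{i\xi\cdot w_r+ig^\eta_r}\,dr\big|\,F(\xi)}{\sqrt{\log(2+|\eta|)}\,\psi_0(|t-s|)}<\infty,$$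 where the supremum is over $\eta\in\mathbb{R}^n$, over $\xi\in\mathbb{R}^d$ sufficiently large (say $|\xi|\ge2$) and over $s\ne t$ in $[0,T]$ sufficiently close (say $|t-s|\le1/2$). Prevalence: let $E$ be a Banach space. A Borel set $A\subset E$ is shy if there is a Borel measure $\mu$ on $E$ such that $0<\mu(K)<\infty$ for some compact $K\subset E$ and $\mu(v+A)=0$ for all $v\in E$. A subset of $E$ is shy if contained in a shy Borel set; the complement of a shy set is prevalent. ''Almost every $\varphi\in E$ satisfies a property'' means that the set of $\varphi\in E$ satisfying it is prevalent. *)

(* Defs.v *)
From HB Require Import structures.
From mathcomp Require Import all_boot all_order all_algebra.
From mathcomp Require Import all_classical all_reals all_analysis.
From mathcomp Require Import complex ring lra.

Set Implicit Arguments.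
Unset Strict Implicit.
Unset Printing Implicit Defensive.

Import Order.TTheory GRing.Theory Num.Theory.
Import numFieldNormedType.Exports.

Local Open Scope classical_set_scope.
Local Open Scope ring_scope.
Local Open Scope complex_scope.

Section holder_space.
Context {R : realType}.
Variables (T delta : R) (d : nat).
Implicit Types f : R -> 'rV[R]_d.

(* A path on [0, T] is represented by its extension by zero to R, so that
   equality of functions is equality of paths.  The Hölder condition is only
   imposed for 0 < delta; for delta = 0 what is left is C^0([0, T]; R^d). *)
Definition holder_paths : set (R -> 'rV[R]_d) :=
  [set f | [/\ forall t, t \notin `[0, T] -> f t = 0,
               {within `[0, T], continuous f} &
               0 < delta -> exists M : R, forall s t,
                 s \in `[0, T] -> t \in `[0, T] ->
                 `|f t - f s| <= M * `|t - s| `^ delta]].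

Definition holder_pred : {pred R -> 'rV[R]_d} :=
  [pred f | `[< holder_paths f >]].

Record holder_path := HolderPath {
  path_fun :> R -> 'rV[R]_d ;
  path_funP : path_fun \in holder_pred }.

HB.instance Definition _ := [isSub for path_fun].
HB.instance Definition _ := [Choice of holder_path by <:].

Lemma holder_predP f : reflect (holder_paths f) (f \in holder_pred).
Proof. by rewrite inE; exact: asboolP. Qed.

Lemma holder_submod_closed : submod_closed holder_pred.
Proof.
split.
- apply/holder_predP; split=> //.
    by move=> x; exact: cvg_cst.
  by move=> _; exists 0 => s t _ _; rewrite mul0r subrr normr0.
- move=> a f g /holder_predP[f0 fc fH] /holder_predP[g0 gc gH].
  apply/holder_predP; split.
  + by move=> t tT; rewrite !fctE f0// g0// scaler0 addr0.
  + move=> x; apply: cvgD; [apply: cvgZr; exact: fc|exact: gc].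
  + move=> dp; have [M HM] := fH dp; have [N HN] := gH dp.
    exists (`|a| * M + N) => s t sT tT.
    rewrite !fctE opprD addrACA mulrDl -scalerBr.
    rewrite (le_trans (ler_normD _ _))// lerD ?HN// normrZ -mulrA.
    by rewrite ler_wpM2l ?HM.
Qed.

HB.instance Definition _ := GRing.isSubmodClosed.Build R (R -> 'rV[R]_d)
  holder_pred holder_submod_closed.
HB.instance Definition _ := [SubChoice_isSubLmodule of holder_path by <:].

(* The norm of R^d used here is the sup norm of 'rV[R]_d; the Euclidean norm
   would give an equivalent norm on paths. *)
Definition path_sup_norm f : R := sup [set `|f t| | t in `[0, T]].

Definition holder_seminorm f : R :=
  sup [set `|f p.2 - f p.1| / `|p.2 - p.1| `^ delta | p in
       [set p : R * R | [/\ p.1 \in `[0, T], p.2 \in `[0, T] & p.1 != p.2]]].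

Definition holder_norm (f : holder_path) : R :=
  path_sup_norm f + (if 0 < delta then holder_seminorm f else 0).

Lemma sup_le_ge0 (A : set R) (a : R) : 0 <= a -> ubound A a -> sup A <= a.
Proof.
move=> a0 Aa; have [->|/set0P A0] := eqVneq A set0; first by rewrite sup0.
exact: ge_sup.
Qed.

Lemma sup_ge0_lb (A : set R) : (forall x, A x -> 0 <= x) -> 0 <= sup A.
Proof.
move=> A0; have [[[x Ax] ub]|nA] := pselect (has_sup A); last by rewrite sup_out.
exact: le_trans (A0 _ Ax) (ub_le_sup ub Ax).
Qed.

Lemma holder_pathP (f : holder_path) : holder_paths f.
Proof. exact/holder_predP/path_funP. Qed.

Lemma powR_dist_gt0 (s t : R) : s != t -> 0 < `|t - s| `^ delta.
Proof. by move=> st; rewrite powR_gt0// normr_gt0 subr_eq0 eq_sym. Qed.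

Lemma holder_norm_le (f : holder_path) (a b : R) : 0 <= a -> 0 <= b ->
  (forall t, t \in `[0, T] -> `|f t| <= a) ->
  (0 < delta -> forall s t, s \in `[0, T] -> t \in `[0, T] ->
     `|f t - f s| <= b * `|t - s| `^ delta) ->
  holder_norm f <= a + b.
Proof.
move=> a0 b0 fa fb; apply: lerD.
  by apply: sup_le_ge0 => // _ [t tT <-]; exact: fa.
case: ifPn => // dp; apply: sup_le_ge0 => // _ [[s t] /= [sT tT st] <-].
by rewrite ler_pdivrMr ?powR_dist_gt0//; exact: fb.
Qed.

Lemma path_sup_norm_ub (f : holder_path) t : `|f t| <= path_sup_norm f.
Proof.
have [f0 fc _] := holder_pathP f.
have : compact (f @` `[0, T]).
  by apply: continuous_compact => //; exact: segment_compact.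
move=> /compact_bounded /pinfty_ex_gt0 [M M0 fM].
have ub : has_ubound [set `|f t| | t in `[0, T]].
  by exists M => _ [u uT <-]; apply: fM; exists u.
have [tT|tT] := boolP (t \in `[0, T]).
  by apply: ub_le_sup => //; exists t.
by rewrite f0// normr0; apply: sup_ge0_lb => _ [u _ <-].
Qed.

Lemma holder_seminorm_ge0 (f : holder_path) : 0 <= holder_seminorm f.
Proof.
apply: sup_ge0_lb => _ [[s t] _ <-] /=.
by rewrite divr_ge0// powR_ge0.
Qed.

Lemma holder_seminorm_ub (f : holder_path) s t : 0 < delta ->
  s \in `[0, T] -> t \in `[0, T] ->
  `|f t - f s| <= holder_seminorm f * `|t - s| `^ delta.
Proof.
move=> dp sT tT; have [_ _ /(_ dp) [M fM]] := holder_pathP f.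
have [->|st] := eqVneq s t.
  by rewrite subrr normr0 mulr_ge0 ?powR_ge0// holder_seminorm_ge0.
rewrite -ler_pdivrMr ?powR_dist_gt0//; apply: ub_le_sup.
  exists M => _ [[u v] /= [uT vT uv] <-].
  by rewrite ler_pdivrMr ?powR_dist_gt0//; exact: fM.
by exists (s, t).
Qed.

Lemma path_sup_norm_ge0 (f : holder_path) : 0 <= path_sup_norm f.
Proof. by rewrite (le_trans _ (path_sup_norm_ub f 0)). Qed.

Lemma holder_norm_sup (f : holder_path) t : `|f t| <= holder_norm f.
Proof.
rewrite (le_trans (path_sup_norm_ub f t))// lerDl.
by case: ifP => // _; exact: holder_seminorm_ge0.
Qed.

Lemma holder_norm_holder (f : holder_path) s t : 0 < delta ->
  s \in `[0, T] -> t \in `[0, T] ->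
  `|f t - f s| <= holder_norm f * `|t - s| `^ delta.
Proof.
move=> dp sT tT; rewrite (le_trans (holder_seminorm_ub _ _ _ _))//.
by rewrite ler_wpM2r ?powR_ge0// /holder_norm dp lerDr path_sup_norm_ge0.
Qed.

Lemma holder_normD (f g : holder_path) : holder_norm (f + g) <= holder_norm f + holder_norm g.
Proof.
rewrite /holder_norm addrACA; set a := (if _ then holder_seminorm f else _).
set b := (if _ then holder_seminorm g else _).
have a0 : 0 <= a by rewrite /a; case: ifP => // _; exact: holder_seminorm_ge0.
have b0 : 0 <= b by rewrite /b; case: ifP => // _; exact: holder_seminorm_ge0.
apply: holder_norm_le.
- by rewrite addr_ge0// path_sup_norm_ge0.
- by rewrite addr_ge0.
- by move=> t _; rewrite (le_trans (ler_normD _ _))// lerD// path_sup_norm_ub.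
- move=> dp s t sT tT; rewrite opprD addrACA mulrDl.
  rewrite (le_trans (ler_normD _ _))// /a /b dp.
  by rewrite lerD// holder_seminorm_ub.
Qed.

Lemma holder_normZ_le (l : R) (f : holder_path) : holder_norm (l *: f) <= `|l| * holder_norm f.
Proof.
rewrite /holder_norm mulrDr; set a := (if _ then holder_seminorm f else _).
have a0 : 0 <= a by rewrite /a; case: ifP => // _; exact: holder_seminorm_ge0.
apply: holder_norm_le.
- by rewrite mulr_ge0// path_sup_norm_ge0.
- by rewrite mulr_ge0.
- by move=> t _; rewrite normrZ ler_wpM2l// path_sup_norm_ub.
- move=> dp s t sT tT; rewrite -scalerBr normrZ -mulrA ler_wpM2l// /a dp.
  exact: holder_seminorm_ub.
Qed.

Lemma holder_normZ (l : R) (f : holder_path) : holder_norm (l *: f) = `|l| * holder_norm f.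
Proof.
apply/eqP; rewrite eq_le holder_normZ_le /=.
have [->|l0] := eqVneq l 0.
  rewrite normr0 mul0r (le_trans _ (holder_norm_sup _ 0))//.
rewrite -ler_pdivlMl ?normr_gt0// -normfV.
by rewrite -[X in holder_norm X <= _](scalerK l0) holder_normZ_le.
Qed.

Lemma holder_norm_eq0 (f : holder_path) : holder_norm f = 0 -> f = 0.
Proof.
move=> f0; apply/val_inj/funext => t; apply/eqP.
by rewrite -normr_le0 -f0 holder_norm_sup.
Qed.

HB.instance Definition _ := Lmodule_isNormed.Build R holder_path
  holder_normD holder_normZ holder_norm_eq0.

Lemma holder_complete (F : set_system holder_path) :
  ProperFilter F -> cauchy F -> cvg F.
Proof.
move=> FF Fc.
have dist_sup (g h : holder_path) t : `|g t - h t| <= `|g - h|.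
  exact: holder_norm_sup (g - h) t.
have near_dist (e : R) : 0 < e ->
    F [set g | F [set h : holder_path | `|g - h| <= e]].
  move=> e0; have [|] := (cauchyP F).1 Fc (e / 2); first exact: divr_gt0.
  move=> g0 Fg0; apply: filterS (Fg0) => g g0g; apply: filterS Fg0 => h g0h.
  rewrite /= [leRHS]splitr -(subrKA g0) (le_trans (ler_normD _ _))// lerD//.
    by rewrite distrC ltW.
  exact: ltW.
have evc t : cvg ((fun h : holder_path => h t) @ F).
  apply: cauchy_cvg; apply/cauchyP => e e0.
  have e20 : 0 < e / 2 by rewrite divr_gt0.
  have [g gF] := filter_ex (near_dist _ e20); exists (g t).
  change (F [set h : holder_path | ball (g t) e (h t)]).
  apply: filterS gF => h gh; rewrite -ball_normE /=.
  rewrite (le_lt_trans (dist_sup g h t))// (le_lt_trans gh)//.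
  by rewrite ltr_pdivrMr// ltr_pMr// ltr1n.
pose f t : 'rV[R]_d := lim ((fun h : holder_path => h t) @ F).
have ev_near t (e : R) : 0 < e -> F [set h : holder_path | `|f t - h t| < e].
  by move=> e0; have /cvgrPdist_lt/(_ e e0) := evc t.
have gf_sup (g : holder_path) (e : R) t :
    F [set h : holder_path | `|g - h| <= e] -> `|g t - f t| <= e.
  move=> gF; apply/ler_addgt0Pr => a a0.
  have [h [/= gh fh]] := filter_ex (filterI gF (ev_near t a a0)).
  rewrite -(subrKA (h t)) (le_trans (ler_normD _ _))// lerD//.
    exact: le_trans (dist_sup g h t) gh.
  by rewrite distrC ltW.
have gf_holder (g : holder_path) (e : R) s t : 0 < delta ->
    s \in `[0, T] -> t \in `[0, T] ->
    F [set h : holder_path | `|g - h| <= e] ->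
    `|(g t - f t) - (g s - f s)| <= e * `|t - s| `^ delta.
  move=> dp sT tT gF; apply/ler_addgt0Pr => a a0.
  have a20 : 0 < a / 2 by rewrite divr_gt0.
  have [h [/= gh [fht fhs]]] :=
    filter_ex (filterI gF (filterI (ev_near t _ a20) (ev_near s _ a20))).
  have -> : (g t - f t) - (g s - f s) =
      ((g t - h t) - (g s - h s)) + ((h t - f t) - (h s - f s)).
    by rewrite [RHS]addrACA subrKA -opprD subrKA.
  rewrite (le_trans (ler_normD _ _))// lerD//.
    rewrite (le_trans (holder_norm_holder (g - h) dp sT tT))//.
    by rewrite ler_wpM2r ?powR_ge0.
  rewrite [leRHS]splitr (le_trans (ler_normB _ _))//.
  by rewrite lerD// distrC ltW.
have [g1 g1F] := filter_ex (near_dist 1 ltr01).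
have fP : holder_paths f.
  split.
  - move=> t tT; apply/eqP; rewrite -normr_le0; apply/ler_addgt0Pr => e e0.
    have [g gF] := filter_ex (near_dist e e0).
    have [g0 _ _] := holder_pathP g.
    by have := gf_sup g e t gF; rewrite g0// sub0r normrN add0r.
  - move=> x; apply/cvgrPdist_le => e e0.
    have e30 : 0 < e / 3 by rewrite divr_gt0.
    have [g gF] := filter_ex (near_dist _ e30).
    have [_ gc _] := holder_pathP g.
    have /cvgrPdist_le/(_ _ e30) := gc x.
    apply: filterS => y gxy.
    have -> : e = e / 3 + e / 3 + e / 3 by field.
    rewrite -(subrKA (g y)) (le_trans (ler_normD _ _))// lerD ?gf_sup//.
    rewrite -(subrKA (g x)) (le_trans (ler_normD _ _))// lerD//.
    by rewrite distrC gf_sup.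
  - move=> dp; have [_ _ /(_ dp)[M g1M]] := holder_pathP g1.
    exists (M + 1) => s t sT tT.
    have -> : f t - f s = (g1 t - g1 s) - ((g1 t - f t) - (g1 s - f s)).
      by rewrite [in RHS]opprB [RHS]addrA subrKA opprB [RHS]addrC subrKA.
    rewrite mulrDl (le_trans (ler_normB _ _))// lerD ?g1M//.
    exact: gf_holder.
pose fh := HolderPath (introT (holder_predP f) fP).
apply/cvg_ex; exists fh; apply/cvgrPdist_le => /= e e0.
have e20 : 0 < e / 2 by rewrite divr_gt0.
apply: filterS (near_dist _ e20) => g gF.
rewrite distrC [leRHS]splitr; apply: holder_norm_le; rewrite ?ltW//.
- by move=> t _; exact: gf_sup.
- by move=> dp s t sT tT; exact: gf_holder.
Qed.

HB.instance Definition _ :=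
  Uniform_isComplete.Build holder_path holder_complete.

End holder_space.

Section prevalence.
Context {R : realType} {E : completeNormedModType R}.

Definition borel_set (A : set E) : Prop := <<s @open E >> A.

Definition borel_shy (A : set E) : Prop :=
  borel_set A /\
  exists mu : {measure set (g_sigma_algebraType (@open E)) -> \bar R},
    (exists K : set E, compact K /\ (0 < mu K < +oo)%E) /\
    forall v : E, mu [set v + a | a in A] = 0%E.

Definition shy (A : set E) : Prop := exists2 B, borel_shy B & A `<=` B.

Definition prevalent (A : set E) : Prop := shy (~` A).

Definition almost_every (P : E -> Prop) : Prop := prevalent [set x | P x].

End prevalence.
Arguments almost_every {R} E P.

Section irregularity.
Context {R : realType}.

Definition dot d (x y : 'rV[R]_d) : R := \sum_(i < d) x 0 i * y 0 i.

Definition enorm d (x : 'rV[R]_d) : R := Num.sqrt (dot x x).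

(* Oriented integral over [s, t], for s and t in any order. *)
Definition oint (g : R -> R) (s t : R) : R :=
  if s <= t then \int[lebesgue_measure]_(r in `[s, t]) g r
  else - \int[lebesgue_measure]_(r in `[t, s]) g r.

Definition cint (h : R -> R[i]) (s t : R) : R[i] :=
  oint (fun r => complex.Re (h r)) s t +i* oint (fun r => complex.Im (h r)) s t.

Definition expi (x : R) : R[i] := cos x +i* sin x.

Definition cmod (z : R[i]) : R := ComplexField.Normc.normc z.

Definition irregular d (T gamma rho : R) (w : R -> 'rV[R]_d) : Prop :=
  exists C : R, forall (xi : 'rV[R]_d) (s t : R),
    xi != 0 -> s \in `[0, T] -> t \in `[0, T] ->
    cmod (cint (fun r => expi (dot xi (w r))) s t) <=
      C * enorm xi `^ (- rho) * `|t - s| `^ gamma.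

Definition rho_irregular d (T rho : R) (w : R -> 'rV[R]_d) : Prop :=
  exists2 gamma : R, 1 / 2 < gamma <= 1 & irregular T gamma rho w.

(* g^eta_r = eta_1 r + ... + eta_n r^n *)
Definition gpoly n (eta : 'rV[R]_n) (r : R) : R :=
  \sum_(k < n) eta 0 k * r ^+ k.+1.

Definition Fweight d (rho : R) (xi : 'rV[R]_d) : R :=
  enorm xi `^ rho / Num.sqrt (ln (enorm xi)).

Definition psi0 (x : R) : R := Num.sqrt (x * `|ln x|).

Definition strong_quotient d n (rho : R) (w : R -> 'rV[R]_d)
    (xi : 'rV[R]_d) (eta : 'rV[R]_n) (s t : R) : R :=
  cmod (cint (fun r => expi (dot xi (w r) + gpoly eta r)) s t) * Fweight rho xi
  / (Num.sqrt (ln (2 + enorm eta)) * psi0 `|t - s|).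

Definition strong_quotients d n (T rho : R) (w : R -> 'rV[R]_d) : set R :=
  [set z | exists (xi : 'rV[R]_d) (eta : 'rV[R]_n) (s t : R),
     [/\ 2 <= enorm xi, s \in `[0, T] /\ t \in `[0, T],
         s != t, `|t - s| <= 1 / 2 &
         z = strong_quotient rho w xi eta s t]].

Definition strongly_irregular d (T rho : R) (w : R -> 'rV[R]_d) : Prop :=
  forall n : nat,
    (ereal_sup [set z%:E | z in strong_quotients n T rho w] < +oo)%E.

(* C^infinity([0, T]; R^d): D k is the k-th derivative, the derivatives at the
   endpoints being one-sided. *)
Definition smooth_path d (T : R) (psi : R -> 'rV[R]_d) : Prop :=
  exists D : nat -> R -> 'rV[R]_d,
    (forall t, t \in `[0, T] -> D 0%N t = psi t) /\
    forall k t, t \in `[0, T] ->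
      (s - t)^-1 *: (D k s - D k t) @[s --> within `[0, T] t^'] --> D k.+1 t.

End irregularity.

(* Main.v *)
From HB Require Import structures.
Require Import Defs.
From mathcomp Require Import all_boot all_order all_algebra.
From mathcomp Require Import all_classical all_reals all_analysis.
From mathcomp Require Import complex ring lra zify.

Set Implicit Arguments.
Unset Strict Implicit.
Unset Printing Implicit Defensive.

Import Order.TTheory GRing.Theory Num.Theory.
Import numFieldNormedType.Exports.

Local Open Scope classical_set_scope.
Local Open Scope ring_scope.

(** The threshold comes from balancing two effects. A level of amplitude about 2^-k on 2^n cells has
    Hölder size about 2^(delta n - k), while square-root cancellation over its cells gains 2^(-n/2).
    Saturating the first constraint turns the gain at |xi| of order 2^k into nearly |xi|^(-1/(2
    delta)). Cancellation between cells is visible only if the mean over one cell is below 2^(-n/2).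
    A single sign contributes just a fixed factor of modulus less than 1, so about k^2 signs are
    spent on each bump. That factor is exact only where the bump is constant; continuity then makes
    its flanks spill over the two neighbouring cells, which forces the splitting by parity. The path
    f enters every estimate only as a frozen phase, which is why translates cost nothing. Fixing the
    numerical bound and the exponent makes the decay condition closed, and countably many of these
    closed sets suffice, which gives the Borel set demanded by shyness. In the perturbation result
    the obstacle is that the modulus psi0 is slightly worse than a square root: part of the gap
    between the two exponents has to be traded for a time exponent above 1/2. *)

(** For the perturbation result: on a piece of length |xi|^-kappa the smooth path
    psi is replaced by its Taylor polynomial; the phase of phi + psi becomes the
    phase of phi plus a polynomial of size O(|xi|), which strong irregularity
    controls at the cost of a logarithm.  Summing over the pieces loses only
    |xi|^(2 kappa), and interpolating with the trivial bound |t - s| yields an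
    exponent gamma > 1/2.

    For prevalence: the transverse measure is the law of a random series of bumps with
    independent random signs, W = sum_k W_k.  The level k is a sum of trapezoids
    of width T 2^-(n k), each carrying 2 k^2 signs per coordinate of amplitude
    pi / (4 2^k).  The sequence n k is as large as W in C^delta allows, so that
    2^(n k / 2) exceeds 2^(rho k) for every rho < 1 / (2 delta).  Fix the other
    levels.  For |xi| of order 2^k the integral over one cell of
    exp (i xi . (f + W) + i g) has modulus at most the length of the cell, has
    average at most 2^-(k^2) times that length, and the cells of equal parity are
    independent.  An exponential moment (Hoeffding) bound, a union bound over a
    grid of frequencies, coefficients and cells, and Borel-Cantelli give the
    result for f + W simultaneously for every deterministic path f.  The signs
    are the binary digits of a uniform variable, so that the whole probabilistic
    part reduces to averages over finitely many signs. *)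

(** * Integrals of continuous functions on an interval *)

Section integrals.
Context {R : realType}.
Implicit Types (f g : R -> R) (a b c M : R).
Local Notation mu := (@lebesgue_measure R).

Lemma within_sub (V : topologicalType) (f : R -> V) a b (u v : R) : a <= u -> v <= b ->
  {within `[a, b], continuous f} -> {within `[u, v], continuous f}.
Proof.
move=> au vb; apply: continuous_subspaceW => x /=.
by rewrite !in_itv/= => /andP[ux xv]; rewrite (le_trans au ux) (le_trans xv vb).
Qed.

Lemma integrable_within f a b : {within `[a, b], continuous f} ->
  mu.-integrable `[a, b] (EFin \o f).
Proof. by move=> fc; apply: continuous_compact_integrable => //; exact: segment_compact. Qed.

Lemma Rintegral_split f a b c : a <= b -> b <= c ->
  {within `[a, c], continuous f} ->
  \int[mu]_(x in `[a, c]) f x =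
  \int[mu]_(x in `[a, b]) f x + \int[mu]_(x in `[b, c]) f x.
Proof.
move=> ab bc fc.
have := @Rintegral_itvB R f (BLeft a) (BRight c) b (integrable_within fc).
rewrite !bnd_simp => /(_ ab bc) E.
rewrite -(@Rintegral_itv_obnd_cbnd _ b) ?E//; last first.
  apply: integrableS (integrable_within (within_sub ab (lexx c) fc)) => //.
  by apply: subset_itvr; rewrite bnd_simp.
by rewrite -E addrC subrK.
Qed.

Lemma Rintegral_itv_cst a b c : a <= b -> \int[mu]_(x in `[a, b]) c = c * (b - a).
Proof.
move=> ab; rewrite Rintegral_cst//; congr (c * _).
have /(congr1 fine) E := @lebesgue_measure_itv R `[a, b].
apply: (etrans E) => /=; rewrite lte_fin.
by case: ltgtP ab => //= ->; rewrite subrr.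
Qed.

Lemma normr_Rintegral_le f a b M : a <= b -> {within `[a, b], continuous f} ->
  (forall x, x \in `[a, b] -> `|f x| <= M) ->
  `|\int[mu]_(x in `[a, b]) f x| <= M * (b - a).
Proof.
move=> ab fc fM.
have fi := integrable_within fc.
apply: (le_trans (le_normr_Rintegral _ fi)) => //.
rewrite -Rintegral_itv_cst//; apply: le_Rintegral => //.
- exact: integrable_norm.
- by apply: integrable_within => x; exact: cvg_cst.
Qed.

Lemma Rintegral_withinD f g a b : {within `[a, b], continuous f} ->
  {within `[a, b], continuous g} ->
  \int[mu]_(x in `[a, b]) (f x + g x) =
  \int[mu]_(x in `[a, b]) f x + \int[mu]_(x in `[a, b]) g x.
Proof. by move=> fc gc; rewrite RintegralD//; exact: integrable_within. Qed.

Lemma Rintegral_withinB f g a b : {within `[a, b], continuous f} ->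
  {within `[a, b], continuous g} ->
  \int[mu]_(x in `[a, b]) (f x - g x) =
  \int[mu]_(x in `[a, b]) f x - \int[mu]_(x in `[a, b]) g x.
Proof. by move=> fc gc; rewrite RintegralB//; exact: integrable_within. Qed.

Lemma Rintegral_withinZ c f a b : {within `[a, b], continuous f} ->
  \int[mu]_(x in `[a, b]) (c * f x) = c * \int[mu]_(x in `[a, b]) f x.
Proof. by move=> fc; rewrite RintegralZl//; exact: integrable_within. Qed.

Lemma eq_Rintegral_itv f g a b : (forall x, x \in `[a, b] -> f x = g x) ->
  \int[mu]_(x in `[a, b]) f x = \int[mu]_(x in `[a, b]) g x.
Proof. by move=> fg; apply: eq_Rintegral => x; rewrite inE; exact: fg. Qed.

Lemma within_comp (h : R -> R) f a b : continuous h ->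
  {within `[a, b], continuous f} -> {within `[a, b], continuous (h \o f)}.
Proof. by move=> hc fc x; exact: (cvg_comp _ _ (fc x) (hc (f x))). Qed.

Lemma within_cos f a b : {within `[a, b], continuous f} ->
  {within `[a, b], continuous (fun x => cos (f x))}.
Proof. by apply: within_comp; exact: continuous_cos. Qed.

Lemma within_sin f a b : {within `[a, b], continuous f} ->
  {within `[a, b], continuous (fun x => sin (f x))}.
Proof. by apply: within_comp; exact: continuous_sin. Qed.

Lemma within_add f g a b : {within `[a, b], continuous f} ->
  {within `[a, b], continuous g} ->
  {within `[a, b], continuous (fun x => f x + g x)}.
Proof. by move=> fc gc x; apply: cvgD; [exact: fc|exact: gc]. Qed.

Lemma within_sum (I : Type) (s : seq I) (F : I -> R -> R) a b :
  (forall i, {within `[a, b], continuous (F i)}) ->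
  {within `[a, b], continuous (fun x => \sum_(i <- s) F i x)}.
Proof.
move=> Fc; elim: s => [|i s IH].
  rewrite (_ : (fun x => _) = fun=> 0); last by apply/funext => x; rewrite big_nil.
  by move=> x; exact: cvg_cst.
rewrite (_ : (fun x => _) = fun x => F i x + \sum_(i <- s) F i x); last first.
  by apply/funext => x; rewrite big_cons.
exact: within_add.
Qed.

Lemma within_cst c a b : {within `[a, b], continuous (fun _ : R => c)}.
Proof. by move=> x; exact: cvg_cst. Qed.

Lemma within_cmul c f a b : {within `[a, b], continuous f} ->
  {within `[a, b], continuous (fun x => c * f x)}.
Proof. by apply: within_comp => x; exact: mulrl_continuous. Qed.

Lemma cos_lip (x y : R) : `|cos x - cos y| <= `|x - y|.
Proof.
wlog xy : x y / x <= y.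
  by move=> H; case/orP: (le_total x y) => /H //; rewrite distrC (distrC y).
have [|c _ E] := @MVT_segment R cos (fun x => - sin x) x y xy.
  by apply/continuous_subspaceT; exact: continuous_cos.
rewrite distrC E normrM (distrC x) ler_piMl// normrN.
by rewrite ler_norml sin_geN1 sin_le1.
Qed.

(** All estimates are one-sided bounds on this real quantity. Adding quarter turns to the phase
    recovers the real and imaginary parts of the complex integral and their opposites; see
    [cmod_cint_le]. *)
Definition cosint (th : R -> R) a b := \int[mu]_(r in `[a, b]) cos (th r).

Lemma cosint_le th a b : a <= b -> {within `[a, b], continuous th} ->
  `|cosint th a b| <= b - a.
Proof.
move=> ab thc; rewrite -[b - a]mul1r normr_Rintegral_le//; first exact: within_cos.
by move=> x _; rewrite ler_norml cos_geN1 cos_le1.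
Qed.

Lemma cosint_split th a b c : a <= b -> b <= c ->
  {within `[a, c], continuous th} -> cosint th a c = cosint th a b + cosint th b c.
Proof. by move=> ab bc thc; rewrite /cosint (Rintegral_split ab bc)//; exact: within_cos. Qed.

Lemma cosint_lip th th' a b M : a <= b -> {within `[a, b], continuous th} ->
  {within `[a, b], continuous th'} ->
  (forall x, x \in `[a, b] -> `|th x - th' x| <= M) ->
  `|cosint th a b - cosint th' a b| <= M * (b - a).
Proof.
move=> ab thc thc' H; rewrite /cosint -Rintegral_withinB; [|exact: within_cos..].
apply: normr_Rintegral_le => // [|x xab].
  apply: within_add; first exact: within_cos.
  by apply: (@within_comp -%R); [exact: opp_continuous|exact: within_cos].
by rewrite (le_trans (cos_lip _ _))// H.
Qed.

Lemma eq_cosint th th' a b : (forall x, x \in `[a, b] -> th x = th' x) ->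
  cosint th a b = cosint th' a b.
Proof. by move=> E; apply: eq_Rintegral_itv => x /E ->. Qed.

(** The effect of one random sign: when it shifts the phase by a constant, averaging over it
    multiplies the integral by cos c, whatever the rest of the phase is. *)
Lemma cosint_avg th c a b : {within `[a, b], continuous th} ->
  cosint (fun r => th r + c) a b + cosint (fun r => th r - c) a b =
  2 * cos c * cosint th a b.
Proof.
move=> thc; rewrite /cosint -Rintegral_withinD.
- rewrite -Rintegral_withinZ; last exact: within_cos.
  by apply: eq_Rintegral_itv => x _; rewrite cosD cosB; ring.
- by apply: within_cos; apply: within_add => //; exact: within_cst.
- by apply: within_cos; apply: within_add => //; exact: within_cst.
Qed.

Lemma cosint_shift th c a b : {within `[a, b], continuous th} ->
  cosint (fun r => th r + c) a b =
  cos c * cosint th a b - sin c * \int[mu]_(r in `[a, b]) sin (th r).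
Proof.
move=> thc; rewrite /cosint.
rewrite -Rintegral_withinZ; last exact: within_cos.
rewrite -Rintegral_withinZ; last exact: within_sin.
rewrite -Rintegral_withinB; [|exact/within_cmul/within_cos|exact/within_cmul/within_sin].
by apply: eq_Rintegral_itv => x _; rewrite cosD; ring.
Qed.

End integrals.

(** * Averages over random signs *)

Section sign_averages.
Context {R : realType}.

(** [None] is a switched-off sign, with coefficient 0. It is the reference value when a single sign
    is varied, and the tail of a truncated sequence. *)
Definition signs := nat -> option bool.

Definition coef (o : option bool) : R :=
  match o with Some true => 1 | Some false => -1 | None => 0 end.

Definition upd (c : signs) (p : nat) (v : option bool) : signs :=
  fun q => if q == p then v else c q.

Implicit Types (F G Y : signs -> R) (c : signs) (p q : nat) (s : seq nat).

Definition avg1 p F c : R := (F (upd c p (Some true)) + F (upd c p (Some false))) / 2.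

(** A conditional expectation: the signs listed in [s] are averaged and the others stay as
    variables. Keeping a function of the whole sequence lets expectations over different blocks be
    composed. *)
Definition avg s F : signs -> R := foldr avg1 F s.

Lemma coef_le1 o : `|coef o| <= 1.
Proof. by case: o => [[]|] /=; rewrite ?normrN ?normr1 ?normr0. Qed.

Lemma upd_upd c p v w : upd (upd c p v) p w = upd c p w.
Proof. by apply/funext => q; rewrite /upd; case: eqP. Qed.

Lemma updC c p q v w : p != q -> upd (upd c p v) q w = upd (upd c q w) p v.
Proof.
move=> pq; apply/funext => r; rewrite /upd.
by case: (eqVneq r q) => // ->; rewrite eq_sym (negbTE pq).
Qed.

Lemma avg1_idem p F : avg1 p (avg1 p F) = avg1 p F.
Proof. by apply/funext => c; rewrite /avg1 !upd_upd; lra. Qed.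

Lemma avg1C p q F : avg1 p (avg1 q F) = avg1 q (avg1 p F).
Proof.
have [->//|pq] := eqVneq p q.
by apply/funext => c; rewrite /avg1 !(updC _ _ _ pq); lra.
Qed.

Lemma avg_avg1 p s F : avg s (avg1 p F) = avg1 p (avg s F).
Proof. by elim: s => //= q s ->; rewrite avg1C. Qed.

Lemma avg_cons p s F : avg (p :: s) F = avg s (avg1 p F).
Proof. by rewrite avg_avg1. Qed.

Lemma avg_absorb1 p s F : p \in s -> avg s (avg1 p F) = avg s F.
Proof.
elim: s => // q s IH; rewrite inE => /predU1P[->|ps] /=; last by rewrite IH.
by rewrite avg_avg1 avg1_idem.
Qed.

Lemma avg_cat s s' F : avg (s ++ s') F = avg s (avg s' F).
Proof. by rewrite /avg foldr_cat. Qed.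

(** The tower property: an average over all the first digits may begin with the blocks that
    matter. *)
Lemma avg_absorb s s' F : {subset s' <= s} -> avg s (avg s' F) = avg s F.
Proof.
elim: s' => //= p s' IH ss'; rewrite avg_absorb1 ?ss' ?mem_head// IH// => q qs'.
by rewrite ss'// inE qs' orbT.
Qed.

Lemma avg_le s F G c : (forall c, F c <= G c) -> avg s F c <= avg s G c.
Proof.
move=> FG; elim: s c => //= p s IH c.
by rewrite /avg1 ler_pM2r ?invr_gt0// lerD.
Qed.

Lemma avg_cst s (a : R) c : avg s (fun=> a) c = a.
Proof. by elim: s c => //= p s IH c; rewrite /avg1 !IH; lra. Qed.

Lemma avgD s F G c : avg s (fun c => F c + G c) c = avg s F c + avg s G c.
Proof. by elim: s c => //= p s IH c; rewrite /avg1 !IH; lra. Qed.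

Lemma avg_sum s (I : Type) (r : seq I) (P : pred I) (F : I -> signs -> R) c :
  avg s (fun c => \sum_(i <- r | P i) F i c) c = \sum_(i <- r | P i) avg s (F i) c.
Proof.
elim: r => [|i r IH].
  rewrite big_nil (_ : (fun _ => _) = fun=> 0) ?avg_cst//.
  by apply/funext => ?; rewrite big_nil.
rewrite big_cons -IH; case: ifPn => Pi.
  by rewrite -avgD; congr (avg s _ c); apply/funext => ?; rewrite big_cons Pi.
by congr (avg s _ c); apply/funext => ?; rewrite big_cons (negbTE Pi).
Qed.

Lemma avg_indep s Y G c : (forall p v c, p \in s -> Y (upd c p v) = Y c) ->
  avg s (fun c => Y c * G c) c = Y c * avg s G c.
Proof.
elim: s c => //= p s IH c HY; rewrite /avg1 !IH.
- by rewrite !HY ?mem_head//; ring.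
- by move=> q v c' qs; rewrite HY// inE qs orbT.
- by move=> q v c' qs; rewrite HY// inE qs orbT.
Qed.

Lemma avgZ s (a : R) F c : avg s (fun c => a * F c) c = a * avg s F c.
Proof. by rewrite (avg_indep (Y := fun=> a)). Qed.

(** From exp (-x) >= 1 - x follows exp x <= 1 / (1 - x), and (1 - x) (1 + x + 2 x^2) = 1 + x^2 (1 -
    2 x) >= 1 in this range. *)
Lemma expR_le_quad (x : R) : `|x| <= 1 / 2 -> expR x <= 1 + x + 2 * x ^+ 2.
Proof.
rewrite ler_norml => /andP[x1 x2].
have e0 := expR_gt0 (- x); have h := expR_ge1Dx (- x).
have x0 : 0 < 1 + - x by lra.
apply: (@le_trans _ _ (1 + - x)^-1); first by rewrite -[expR x]invrK -expRN lef_pV2 ?posrE.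
rewrite -[leLHS]mul1r ler_pdivrMr//; nra.
Qed.

(* The blocks of digits [b j] play the role of independent random variables:
   [X j'] does not see the digits of [b j]. *)
Lemma avg_prod_exp (js : seq nat) (b : nat -> seq nat) (X : nat -> signs -> R)
    (th t m : R) c :
  0 <= th -> th * t <= 1 / 2 -> uniq js ->
  (forall j c, j \in js -> `|X j c| <= t) ->
  (forall j c, j \in js -> avg (b j) (X j) c <= m) ->
  (forall j j' p v c, j \in js -> j' \in js -> j != j' -> p \in b j ->
     X j' (upd c p v) = X j' c) ->
  avg (flatten [seq b j | j <- js]) (fun c => \prod_(j <- js) expR (th * X j c)) c
    <= expR (th * m + 2 * (th * t) ^+ 2) ^+ size js.
Proof.
move=> th0 tht; elim: js c => [|j js IH] c; first by rewrite /= big_nil.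
rewrite cons_uniq => /andP[jjs ujs] Xt Xm Xi /=.
rewrite avg_cat (_ : (fun c => \prod_(j <- j :: js) _) =
  fun c => expR (th * X j c) * \prod_(j <- js) expR (th * X j c)); last first.
  by apply/funext => c'; rewrite big_cons.
have jj : j \in j :: js by rewrite mem_head.
have sub i : i \in js -> i \in j :: js by rewrite inE orbC => ->.
rewrite (_ : avg (flatten _) _ = fun c => expR (th * X j c) *
   avg (flatten [seq b j | j <- js]) (fun c => \prod_(j <- js) expR (th * X j c)) c); last first.
  apply/funext => c'; rewrite avg_indep// => v c'' c''0 /flattenP[_ /mapP[i ijs ->] pi].
  have ij : i != j by apply: contraNneq jjs => <-.
  by rewrite (Xi i j v c'' c''0 (sub _ ijs) jj ij pi).
set B := expR (_ + _).
apply: (@le_trans _ _ (avg (b j) (fun c => B ^+ size js * expR (th * X j c)) c)).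
  apply: avg_le => c'; rewrite [leRHS]mulrC ler_wpM2l ?expR_ge0// IH//.
  - by move=> i c'' /sub; exact: Xt.
  - by move=> i c'' /sub; exact: Xm.
  - by move=> i i' p v c'' /sub ii /sub ii' ne pi; exact: (Xi i i' p).
rewrite avgZ exprSr ler_wpM2l ?exprn_ge0 ?expR_ge0//.
(* The quadratic bound reduces the exponential moment of one block to its mean; 1 + x <= exp x then
   restores the exponential form. *)
apply: (@le_trans _ _ (avg (b j) (fun c => 1 + th * X j c + 2 * (th * t) ^+ 2) c)).
  apply: avg_le => c'; apply: (le_trans (expR_le_quad _)).
    rewrite normrM (ger0_norm th0) (le_trans _ tht)// ler_wpM2l//.
    exact: Xt.
  rewrite lerD2l ler_pM2l// -[leLHS]real_normK ?num_real//.
  rewrite lerXn2r ?nnegrE ?normr_ge0//.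
    by rewrite mulr_ge0// (le_trans _ (Xt j c' jj)).
  by rewrite normrM (ger0_norm th0) ler_wpM2l// Xt.
rewrite avgD avgD !avg_cst avgZ.
apply: le_trans (expR_ge1Dx _); rewrite -addrA lerD2l lerD2r ler_wpM2l//.
exact: Xm.
Qed.

End sign_averages.

(** * Binary digits of a uniform variable *)

Section binary_digits.
Context {R : realType}.
Implicit Types (x : R) (M i : nat).

Definition dig x : signs := fun m => Some (odd (Num.truncn (2 ^+ m.+1 * x))).

Definition cutoff M (c : signs) : signs := fun m => if (m < M)%N then c m else None.

(** The truncated digit sequence common to all points of the i-th dyadic interval of length 2^-M. *)
Definition digN M i : signs :=
  fun m => if (m < M)%N then Some (odd (i %/ 2 ^ (M - m.+1))) else None.

(** With N a power of 2, this reads every one of the first M digits off the single integer part of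
    2^M x. *)
Lemma truncn_mulV x (N : nat) : 0 <= x -> (0 < N)%N ->
  Num.truncn x = (Num.truncn (N%:R * x) %/ N)%N.
Proof.
move=> x0 N0; have NR : 0 < N%:R :> R by rewrite ltr0n.
have Nx0 : 0 <= N%:R * x by rewrite mulr_ge0// ltW.
have /andP[l u] := truncn_itv Nx0; set t := Num.truncn (N%:R * x) in l u *.
apply/eqP; rewrite truncn_eq//; apply/andP; split.
  rewrite -(ler_pM2l NR) -natrM (le_trans _ l)// ler_nat mulnC.
  exact: leq_divM.
rewrite -(ltr_pM2l NR) -natrM (lt_le_trans u)// ler_nat mulnC.
by rewrite -ltn_divLR//.
Qed.

Lemma cutoff_dig M x : 0 <= x -> cutoff M (dig x) = digN M (Num.truncn (2 ^+ M * x)).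
Proof.
move=> x0; apply/funext => m; rewrite /cutoff /digN; case: ifPn => // mM.
rewrite /dig (@truncn_mulV _ (2 ^ (M - m.+1))) ?expn_gt0 ?mulr_ge0 ?exprn_ge0//.
by rewrite natrX mulrA -exprD subnK.
Qed.

Lemma digNS M i (b : bool) : digN M.+1 (b + i.*2) = upd (digN M i) M (Some b).
Proof.
apply/funext => m; rewrite /digN /upd ltnS; case: (ltngtP m M) => // [mM|->].
  rewrite subSn// expnS divnMA; congr (Some (odd (_ %/ _))).
  by rewrite divn2 half_bit_double.
by rewrite subnn expn0 divn1 oddD odd_double addbF oddb.
Qed.

(** The link between Lebesgue measure and [avg]: by [digNS] the two halves of a dyadic interval
    differ only in the new last digit, so pairing them averages over that digit. *)
Lemma sum_digN M (F : signs -> R) :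
  \sum_(i < 2 ^ M) F (digN M i) = 2 ^+ M * avg (iota 0 M) F (fun=> None).
Proof.
elim: M F => [|M IH] F.
  by rewrite expn0 big_ord1 expr0 mul1r; congr F; apply/funext => m.
have spl (n : nat) (f : nat -> R) :
    \sum_(i < n.*2) f i = \sum_(i < n) (f i.*2 + f i.*2.+1).
  by elim: n => [|n IHn]; rewrite ?big_ord0// doubleS !big_ord_recr/= IHn addrA.
rewrite expnS mul2n (spl _ (fun i => F (digN M.+1 i))).
transitivity (\sum_(i < 2 ^ M) 2 * avg1 M F (digN M i)).
  apply: eq_bigr => i _.
  have := digNS M i false; have := digNS M i true; rewrite add0n add1n => -> ->.
  by rewrite /avg1; lra.
have -> : iota 0 M.+1 = iota 0 M ++ [:: M] by rewrite -addn1 iotaD.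
by rewrite -big_distrr/= IH mulrA -exprS avg_cat.
Qed.

Local Notation TR := (measurableTypeR R).

Definition dyadic M i : set TR := `[i%:R / 2 ^+ M, i.+1%:R / 2 ^+ M[.

Lemma dyadicP M i x : 0 <= x -> dyadic M i x <-> Num.truncn (2 ^+ M * x) = i.
Proof.
move=> x0; have M0 : 0 < 2 ^+ M :> R by rewrite exprn_gt0.
rewrite /dyadic/= in_itv/= ler_pdivrMr// ltr_pdivlMr// mulrC.
rewrite -truncn_eq ?mulr_ge0 ?exprn_ge0//.
by split => [/eqP|->].
Qed.

Lemma dig_set_dyadic M (P : signs -> Prop) :
  [set x : TR | (0 <= x < 1) /\ P (cutoff M (dig x))] =
  \big[setU/set0]_(i < 2 ^ M | `[< P (digN M i) >]) dyadic M i.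
Proof.
have M0 : 0 < 2 ^+ M :> R by rewrite exprn_gt0.
rewrite -bigcup_seq_cond; apply/seteqP; split => x /=.
  move=> [/andP[x0 x1]]; rewrite cutoff_dig// => Px.
  have xM : (Num.truncn (2 ^+ M * x) < 2 ^ M)%N.
    rewrite truncn_lt_nat ?mulr_ge0 ?exprn_ge0//.
    by rewrite natrX gtr_pMr.
  exists (Ordinal xM) => /=; first by rewrite mem_index_enum; exact/asboolP.
  exact/dyadicP.
move=> [i /= /andP[_ /asboolP Pi]] xi.
have /andP[i0 i1] : i%:R / 2 ^+ M <= x < i.+1%:R / 2 ^+ M by [].
have x0 : 0 <= x by rewrite (le_trans _ i0)// divr_ge0 ?exprn_ge0.
split; last by rewrite cutoff_dig//; move/dyadicP : xi => ->.
rewrite x0 (lt_le_trans i1)// ler_pdivrMr// mul1r -natrX ler_nat//.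
Qed.

Lemma measurable_dig M (P : signs -> Prop) :
  measurable [set x : TR | (0 <= x < 1) /\ P (cutoff M (dig x))].
Proof.
rewrite dig_set_dyadic; apply: bigsetU_measurable => i _.
exact: measurable_itv.
Qed.

(** Markov's inequality for the first M digits: on each dyadic interval the indicator of 1 <= Z is
    at most Z. *)
Lemma lebesgue_dig_le M (Z : signs -> R) : (forall c, 0 <= Z c) ->
  (lebesgue_measure [set x : TR | ((0 : R) <= x < 1)%R /\ (1 <= Z (cutoff M (dig x)))%R]
     <= (avg (iota 0 M) Z (fun=> None))%:E)%E.
Proof.
move=> Z0; have M0 : 0 < 2 ^+ M :> R by rewrite exprn_gt0.
rewrite (dig_set_dyadic M (fun c => 1 <= Z c)).
pose A (i : nat) := if `[< 1 <= Z (digN M i) >] then dyadic M i else set0.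
rewrite big_mkcond/= -(@big_mkord _ set0 setU (2 ^ M) predT A).
rewrite big_mkord; apply: (le_trans (Boole_inequality _ _)).
  by move=> i _; rewrite /A; case: ifP => _ //; exact: measurable_itv.
apply: (@le_trans _ _ (\sum_(i < 2 ^ M) (Z (digN M i) / 2 ^+ M)%:E)%E).
  apply: lee_sum => i _; rewrite /A; case: ifPn => [/asboolP Zi|_]; last first.
    by rewrite measure0 lee_fin divr_ge0// ltW.
  have E : lebesgue_measure (dyadic M i) = ((i.+1%:R / 2 ^+ M) - (i%:R / 2 ^+ M))%:E.
    apply: (etrans (lebesgue_measure_itv _)) => /=.
    by rewrite lte_fin ltr_pM2r ?invr_gt0// ltr_nat ltnSn.
  have {}E : (lebesgue_measure (dyadic M i) <=
              ((i.+1%:R / 2 ^+ M) - (i%:R / 2 ^+ M))%:E)%E by rewrite E.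
  apply: (le_trans E).
  by rewrite lee_fin -mulrBl ler_pM2r ?invr_gt0// -natrB// subSnn.
rewrite sumEFin lee_fin -mulr_suml sum_digN mulrC mulKf// gt_eqF.
Qed.

End binary_digits.

(** * The resolution of the levels *)

Section levels.
Context {R : realType}.
Implicit Types (a C delta rho : R) (k n p : nat).

(** Take the p-th power of s (k + 1) <= exp (s (k + 1)). The rate s = ln a / (p + 1) keeps the right
    side below a^(k + 1), and is defined for p = 0 as well. *)
Lemma poly_le_exp p a : 1 < a -> exists2 C, 0 < C & forall k, k.+1%:R ^+ p <= C * a ^+ k.
Proof.
move=> a1; have a0 : 0 < a by lra.
have l0 : 0 < ln a by rewrite ln_gt0.
pose s := ln a / p.+1%:R; have s0 : 0 < s by rewrite divr_gt0.
exists (s^-1 ^+ p * a) => [|k]; first by rewrite mulr_gt0// exprn_gt0// invr_gt0.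
rewrite -mulrA -exprS.
apply: (@le_trans _ _ ((s^-1 * expR (s * k.+1%:R)) ^+ p)).
  rewrite lerXn2r ?nnegrE//; first by rewrite mulr_ge0 ?expR_ge0// invr_ge0 ltW.
  rewrite ler_pdivlMl// (le_trans _ (expR_ge1Dx _))//; lra.
rewrite exprMn ler_wpM2l ?exprn_ge0 ?invr_ge0 ?(ltW s0)//.
rewrite -expRM_natr -[X in X ^+ _](@lnK _ a) ?posrE// -expRM_natr ler_expR.
rewrite mulrAC ler_wpM2r// /s mulrAC ler_pdivrMr// ler_pM2l//.
by rewrite ler_nat.
Qed.

Lemma poly_le_exp_near p a C : 1 < a ->
  exists k0, forall k, (k0 <= k)%N -> C * k.+1%:R ^+ p <= a ^+ k.
Proof.
move=> a1; have [D D0 HD] := poly_le_exp p.+1 a1.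
exists (Num.truncn (D * `|C|)).+1 => k kk.
have DC : D * `|C| <= k.+1%:R.
  rewrite (le_trans (ltW (truncnS_gt _)))// ler_nat (leq_trans kk)//.
rewrite -(ler_pM2l D0) (le_trans _ (HD k))// exprS mulrA ler_wpM2r ?exprn_ge0//.
by rewrite (le_trans _ DC)// ler_pM2l// ler_norm.
Qed.

Lemma ltr_powR a (x y : R) : 1 < a -> x < y -> a `^ x < a `^ y.
Proof.
move=> a1 xy; have a0 : 0 < a by lra.
by rewrite /powR gt_eqF// ltr_expR ltr_pM2r// ln_gt0.
Qed.

Lemma powRXn a (x : R) n : 0 <= a -> (a `^ x) ^+ n = (a ^+ n) `^ x.
Proof. by move=> a0; rewrite -powR_mulrn ?powR_ge0// powRAC powR_mulrn. Qed.

(** The largest n compatible with the Hölder constraint is taken. If 2^(n + 1) were too small,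
    raising it to the power delta would show that n + 1 satisfies the constraint too, because 4^(rho
    delta) < 2. *)
Lemma level_seq delta : 0 <= delta <= 1 -> exists (n : nat -> nat) (C : R),
  [/\ 0 < C, forall k, (n k <= k ^ 2)%N,
    forall k, k.+1%:R ^+ 4 * (2 `^ delta) ^+ n k <= C * 2 ^+ k &
    forall rho, 0 <= rho -> 2 * rho * delta < 1 ->
      exists k0, forall k, (k0 <= k)%N ->
        (4 `^ rho) ^+ k * k.+1%:R ^+ 4 <= 2 * 2 ^+ n k].
Proof.
move=> /andP[d0 d1].
have [|C C0 HC] := @poly_le_exp 4 2; first lra.
pose q : R := 2 `^ delta.
(* The cap k^2 keeps the maximum finite when delta = 0, where q = 1. It also limits the number of
   cells to what 2 k^2 signs per bump can handle. *)
pose P k n := (n <= k ^ 2)%N && (k.+1%:R ^+ 4 * q ^+ n <= C * 2 ^+ k).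
have exP k : exists n, P k n by exists 0%N; rewrite /P expr0 mulr1 HC.
have ubP k n : P k n -> (n <= k ^ 2)%N by case/andP.
exists (fun k => ex_maxn (exP k) (@ubP k)), C; split => //.
- by move=> k; case: ex_maxnP => n /andP[].
- by move=> k; case: ex_maxnP => n /andP[].
move=> rho r0 rd; set r : R := 4 `^ rho.
have r1 : 1 <= r by rewrite -(powRr0 4) ler_powR//; lra.
have rge0 : 0 <= r by rewrite powR_ge0.
pose rd' := r `^ delta.
have rd'1 : 0 < rd' by rewrite powR_gt0//; lra.
have rd'2 : rd' < 2.
  rewrite /rd' /r -powRrM (_ : 4 = 2 `^ 2%:R); last by rewrite powR_mulrn//; lra.
  rewrite -powRrM -[ltRHS]powRr1//; apply: ltr_powR; lra.
(* The exponent 8 is 4 from the constraint [P] plus 4 from bounding (k + 1)^(4 delta) by (k +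
   1)^4. *)
have [|k1 Hk1] := @poly_le_exp_near 8 (2 / rd') C^-1; first by rewrite ltr_pdivlMr//; lra.
have [|k2 Hk2] := @poly_le_exp_near 4 2 1; first lra.
pose m := (Num.truncn r).+1.
exists (maxn k1 (maxn k2 m.+1)) => k; rewrite !geq_max => /and3P[kk1 kk2 km].
case: ex_maxnP => n /andP[nk Hn] nmax.
(* If the cap is reached, 2^(k^2) outgrows the left side by itself; otherwise maximality says that n
   + 1 violates the Hölder constraint. *)
have [nkk|nkk] := eqVneq n (k ^ 2)%N.
  have rm : r <= 2 ^+ m.
    rewrite (le_trans (ltW (truncnS_gt _)))// -/m -natrX ler_nat ltnW// ltn_expl//.
  have kk : (m * k + k <= k ^ 2)%N by rewrite -mulSnr expnS expn1 leq_mul2r km orbT.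
  apply: (@le_trans _ _ (2 ^+ (m * k + k))); last first.
    by rewrite -exprS ler_eXn2l ?ltr1n// nkk (leq_trans kk).
  rewrite exprD exprM ler_pM ?exprn_ge0//.
    by rewrite lerXn2r ?nnegrE ?exprn_ge0.
  by rewrite -[leLHS]mul1r Hk2.
have {nk nkk} nk : (n.+1 <= k ^ 2)%N by rewrite ltn_neqAle nkk.
rewrite leNgt -exprS; apply/negP => H.
have nP : ~~ P k n.+1 by apply/negP => /nmax; rewrite ltnn.
move: nP; rewrite /P nk/= -ltNge => nP.
have q1 : q ^+ n.+1 <= rd' ^+ k * k.+1%:R ^+ 4.
  have -> : q ^+ n.+1 = (2 ^+ n.+1) `^ delta.
    by rewrite powRXn.
  apply: (@le_trans _ _ ((r ^+ k * k.+1%:R ^+ 4) `^ delta)).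
    apply: ge0_ler_powR => //; rewrite ?nnegrE ?exprn_ge0//; last exact: ltW.
    by rewrite mulr_ge0 ?exprn_ge0.
  rewrite powRM ?exprn_ge0//.
  have -> : rd' ^+ k = (r ^+ k) `^ delta.
    by rewrite powRXn.
  rewrite ler_wpM2l ?powR_ge0// -[leRHS]powRr1 ?exprn_ge0//.
  by rewrite ler_powR// -natrX ler1n expn_gt0.
have := Hk1 k kk1; rewrite expr_div_n ler_pdivrMl// mulrA ler_pdivlMr ?exprn_gt0// => h.
have : C * 2 ^+ k < C * 2 ^+ k; last by rewrite ltxx.
rewrite (lt_le_trans nP)// (le_trans _ h)//.
rewrite [leRHS](_ : _ = k.+1%:R ^+ 4 * (rd' ^+ k * k.+1%:R ^+ 4)); last by ring.
by rewrite ler_wpM2l// exprn_ge0.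
Qed.

End levels.

(** * Trapezoids and Lipschitz paths *)

Section bumps.
Context {R : realType}.
Implicit Types (x y : R) (j J : nat).

Definition clamp x : R := Num.min 1 (Num.max 0 x).

Lemma clampE x : clamp x = if x <= 0 then 0 else if x <= 1 then x else 1.
Proof.
rewrite /clamp maxEle minEle.
case: (lerP x 0) => x0; case: (lerP 0 x) => x0'; case: (lerP x 1) => x1;
  case: ifP => //; lra.
Qed.

Lemma clamp_homo x y : x <= y -> clamp x <= clamp y.
Proof.
move=> xy; rewrite !clampE.
by case: (lerP x 0) => ?; case: (lerP x 1) => ?; case: (lerP y 0) => ?;
  case: (lerP y 1) => ?; lra.
Qed.

(** Unit ramps laid end to end form one long ramp. This is why the bounds on sums of trapezoids do
    not depend on J. *)
Lemma clamp_sum J x :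
  \sum_(j < J) clamp (x - j%:R) = Num.min J%:R (Num.max 0 x).
Proof.
elim: J => [|J IH].
  by rewrite big_ord0 minEle maxEle; case: (lerP 0 x) => // ?; rewrite ?lexx//; case: ifP; lra.
rewrite big_ord_recr/= IH clampE -[in RHS]natr1 !minEle !maxEle.
have J0 : 0 <= J%:R :> R by [].
by case: (lerP 0 x) => ?; case: (lerP (x - J%:R) 0) => ?; case: (lerP (x - J%:R) 1) => ?;
  do ?(case: ifP => ?); lra.
Qed.

Lemma clamp_sum_lip J x y : y <= x ->
  \sum_(j < J) clamp (x - j%:R) - \sum_(j < J) clamp (y - j%:R) <= x - y.
Proof.
move=> yx; rewrite !clamp_sum !minEle !maxEle.
have J0 : 0 <= J%:R :> R by [].
by case: (lerP 0 x) => ?; case: (lerP 0 y) => ?;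
  do ?(case: ifP => ?); lra.
Qed.

(* The trapezoid equal to 1 on [j, j + 1] and supported in [j - 1, j + 2]. *)
Definition trapezoid j x : R := clamp (x + 1 - j%:R) - clamp (x - 1 - j%:R).

Lemma trapezoid_ge0 j x : 0 <= trapezoid j x.
Proof. by rewrite subr_ge0 clamp_homo//; lra. Qed.

Lemma trapezoid_eq1 j x : j%:R <= x <= j.+1%:R -> trapezoid j x = 1.
Proof.
rewrite -natr1 => /andP[? ?]; rewrite /trapezoid !clampE.
by do ?(case: ifP => ?); lra.
Qed.

Lemma trapezoid_eq0 j x : x <= j%:R - 1 \/ j%:R + 2 <= x -> trapezoid j x = 0.
Proof. by move=> [?|?]; rewrite /trapezoid !clampE; do ?(case: ifP => ?); lra. Qed.

Lemma sum_trapezoid_le J x : \sum_(j < J) trapezoid j x <= 2.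
Proof.
by rewrite sumrB (le_trans (clamp_sum_lip _ _))//; lra.
Qed.

(** A trapezoid is a difference of two nondecreasing ramps, so after the triangle inequality all
    terms have a sign and [clamp_sum_lip] applies to each family. *)
Lemma sum_trapezoid_lip J x y : \sum_(j < J) `|trapezoid j x - trapezoid j y| <= 2 * `|x - y|.
Proof.
wlog yx : x y / y <= x.
  move=> H; case/orP: (le_total x y) => /H //.
  by rewrite (distrC y); under eq_bigr do rewrite distrC.
pose D x j := clamp (x - j%:R).
apply: (@le_trans _ _ (\sum_(j < J) ((D (x + 1) j - D (y + 1) j) + (D (x - 1) j - D (y - 1) j)))).
  apply: ler_sum => j _; rewrite /trapezoid -/(D _ _) -/(D _ _).
  rewrite (_ : _ - _ = (D (x + 1) j - D (y + 1) j) - (D (x - 1) j - D (y - 1) j)).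
    rewrite (le_trans (ler_normB _ _))//.
    by rewrite !ger0_norm// subr_ge0 clamp_homo//; lra.
  by rewrite /D; ring.
rewrite big_split/= !sumrB (@ger0_norm _ (x - y)) ?subr_ge0//.
have := @clamp_sum_lip J (x + 1) (y + 1); have := @clamp_sum_lip J (x - 1) (y - 1).
rewrite /D; lra.
Qed.

End bumps.

Section row_norm.
Context {R : realType} {d : nat}.

Lemma row_norm_le (x : 'rV[R]_d) (M : R) : 0 <= M ->
  (forall i, `|x 0 i| <= M) -> `|x| <= M.
Proof.
move=> M0 H; rewrite {1}/Num.norm /= mx_normrE; apply: bigmax_le => // -[a i] _ /=.
by rewrite (ord1 a).
Qed.

Lemma coord_norm_le (x : 'rV[R]_d) i : `|x 0 i| <= `|x|.
Proof.
rewrite {2}/Num.norm /= mx_normrE.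
by apply/bigmax_geP; right; exists (0, i).
Qed.

End row_norm.

Section lipschitz_paths.
Context {R : realType} (T delta : R) (d : nat).
Hypotheses (T0 : 0 < T) (delta01 : 0 <= delta <= 1).

Lemma within_lip (f : R -> 'rV[R]_d) (L : R) : 0 <= L ->
  (forall s t, s \in `[0, T] -> t \in `[0, T] -> `|f t - f s| <= L * `|t - s|) ->
  {within `[0, T], continuous f}.
Proof.
move=> L0 Lf; apply/continuous_within_itvP => //.
have near_of (s : R) (F : set_system R) : Filter F -> F `=>` nbhs s ->
    (\forall t \near F, t \in `[0, T]) -> s \in `[0, T] -> f t @[t --> F] --> f s.
  move=> FF Fs FT sT; apply/cvgrPdist_le => e e0.
  have L1 : 0 < L + 1 by lra.
  have h : \forall t \near F, `|s - t| <= e / (L + 1).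
    by apply: Fs; apply/nbhs_normP; exists (e / (L + 1)); rewrite /= ?divr_gt0// => z /ltW.
  near=> t.
  have tT : t \in `[0, T] by near: t.
  have st : `|s - t| <= e / (L + 1) by near: t.
  rewrite (le_trans (Lf _ _ tT sT))//.
  move: st; rewrite ler_pdivlMr// => /(le_trans _); apply.
  by rewrite mulrC ler_wpM2l//; lra.
Unshelve. all: end_near.
split.
- move=> s sT; apply: near_of.
  + exact: cvg_id.
  + near=> t; have : t \in `]0, T[ by near: t; exact: near_in_itvoo.
    by rewrite !in_itv/= => /andP[/ltW -> /ltW ->].
  + by move: sT; rewrite !in_itv/= => /andP[/ltW -> /ltW ->].
- apply: near_of.
  + exact: cvg_within.
  + near=> t; rewrite in_itv/=; apply/andP; split; near: t.
    * exact: nbhs_right_ge.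
    * exact: nbhs_right_le.
  + by rewrite in_itv/= lexx ltW.
- apply: near_of.
  + exact: cvg_within.
  + near=> t; rewrite in_itv/=; apply/andP; split; near: t.
    * exact: nbhs_left_ge.
    * exact: nbhs_left_le.
  + by rewrite in_itv/= lexx ltW.
Unshelve. all: end_near.
Qed.

Lemma lip_holder_paths (f : R -> 'rV[R]_d) (L : R) : 0 <= L ->
  (forall t, t \notin `[0, T] -> f t = 0) ->
  (forall s t, s \in `[0, T] -> t \in `[0, T] -> `|f t - f s| <= L * `|t - s|) ->
  holder_paths T delta f.
Proof.
move=> L0 f0 Lf; split => //; first exact: within_lip Lf.
have /andP[d0 d1] := delta01.
move=> _; exists (L * T `^ (1 - delta)) => s t sT tT.
have [->|st] := eqVneq t s.
  by rewrite subrr normr0 !mulr_ge0 ?powR_ge0.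
have ts : 0 < `|t - s| by rewrite normr_gt0 subr_eq0.
rewrite (le_trans (Lf _ _ sT tT))// -mulrA ler_wpM2l//.
rewrite -{1}(powRr1 (ltW ts)) -{1}(subrK delta 1) powRD; last first.
  by rewrite (gt_eqF ts) implybT.
rewrite ler_wpM2r ?powR_ge0// ge0_ler_powR ?nnegrE ?(ltW T0) ?subr_ge0//.
move: sT tT; rewrite !in_itv/= => /andP[? ?] /andP[? ?].
by rewrite ler_norml; lra.
Qed.

End lipschitz_paths.

(** * The random path *)

Section random_path.
Context {R : realType} (T delta : R) (d : nat).
Hypotheses (T0 : 0 < T) (delta01 : 0 <= delta <= 1).
Variables (n : nat -> nat) (C : R).
Hypothesis C0 : 0 < C.
Hypothesis nC : forall k, k.+1%:R ^+ 4 * (2 `^ delta) ^+ n k <= C * 2 ^+ k.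
Implicit Types (c : signs) (k j m i p : nat) (s t : R).

(** The position of the m-th sign of coordinate i of bump j at level k. Injectivity makes the blocks
    of different bumps disjoint, hence independent. *)
Definition pk k j m i : nat := pickle (k, j, m, i).

Lemma pk_inj k j m i k' j' m' i' : pk k j m i = pk k' j' m' i' ->
  [/\ k = k', j = j', m = m' & i = i'].
Proof. by move/(pcan_inj (@pickleK _)) => [-> -> -> ->]. Qed.

(* Locked so that rewriting with [mulr_ge0] does not unfold it. *)
Definition amp k : R := locked (pi / 4 / 2 ^+ k).

Lemma ampE k : amp k = pi / 4 / 2 ^+ k.
Proof. by rewrite /amp -lock. Qed.

Lemma amp_ge0 k : 0 <= amp k.
Proof. by rewrite ampE !divr_ge0 ?pi_ge0. Qed.

(** Each sign will contribute a factor at most 2^(-1/2) in modulus, so this many give 2^-(k^2),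
    below 2^-(n k) whenever n k <= k^2. *)
Definition ndig k : nat := (k ^ 2).*2.

Definition scale k : R := 2 ^+ n k / T.

Lemma scale_ge0 k : 0 <= scale k.
Proof. by rewrite divr_ge0 ?exprn_ge0// ltW. Qed.

Definition bump_coef c k j i : R := \sum_(m < ndig k) coef (c (pk k j m i)).

Definition level_fun c k t : 'rV[R]_d :=
  if t \in `[0, T] then
    \row_(i < d) \sum_(j < 2 ^ n k) bump_coef c k j i * (amp k * trapezoid j (t * scale k))
  else 0.

Lemma bump_coef_le c k j i : `|bump_coef c k j i| <= (ndig k)%:R.
Proof.
rewrite (le_trans (ler_norm_sum _ _ _))//.
apply: (@le_trans _ _ (\sum_(m < ndig k) 1)).
  by apply: ler_sum => m _; exact: coef_le1.
by rewrite sumr_const card_ord.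
Qed.

Lemma level_fun_le c k t : `|level_fun c k t| <= 2 * (ndig k)%:R * amp k.
Proof.
have h0 : 0 <= 2 * (ndig k)%:R * amp k by rewrite !(amp_ge0, scale_ge0, mulr_ge0).
rewrite /level_fun; case: ifP => _; last by rewrite normr0.
apply: row_norm_le => // i; rewrite mxE (le_trans (ler_norm_sum _ _ _))//.
apply: (@le_trans _ _ (\sum_(j < 2 ^ n k) (ndig k)%:R * amp k * trapezoid j (t * scale k))).
  apply: ler_sum => j _; rewrite normrM -mulrA ler_pM ?bump_coef_le//.
  by rewrite ger0_norm// mulr_ge0 ?amp_ge0 ?trapezoid_ge0.
rewrite -mulr_sumr -(mulrA 2) mulrC ler_wpM2r ?mulr_ge0 ?amp_ge0//.
exact: sum_trapezoid_le.
Qed.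

Lemma level_fun_lip c k s t : s \in `[0, T] -> t \in `[0, T] ->
  `|level_fun c k t - level_fun c k s| <=
     2 * (ndig k)%:R * amp k * (scale k * `|t - s|).
Proof.
move=> sT tT; have sc0 := scale_ge0 k.
have h0 : 0 <= 2 * (ndig k)%:R * amp k * (scale k * `|t - s|).
  by rewrite !(amp_ge0, scale_ge0, mulr_ge0).
rewrite /level_fun sT tT; apply: row_norm_le => // i; rewrite !mxE -sumrB.
rewrite (le_trans (ler_norm_sum _ _ _))//.
apply: (@le_trans _ _ (\sum_(j < 2 ^ n k)
   (ndig k)%:R * amp k * `|trapezoid j (t * scale k) - trapezoid j (s * scale k)|)).
  apply: ler_sum => j _; rewrite -mulrBr normrM -mulrA ler_pM ?bump_coef_le//.
    by rewrite -mulrBr normrM ger0_norm// amp_ge0.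
rewrite -mulr_sumr [leRHS](_ : _ = (ndig k)%:R * amp k * (2 * (scale k * `|t - s|))); last ring.
rewrite ler_wpM2l ?mulr_ge0 ?amp_ge0// (le_trans (sum_trapezoid_lip _ _ _))//.
by rewrite -mulrBl normrM (ger0_norm sc0) (mulrC `|_|).
Qed.

Lemma level_fun_path c k : level_fun c k \in @holder_pred R T delta d.
Proof.
apply/holder_predP; apply: (@lip_holder_paths _ _ _ _ T0 delta01 _
  (2 * (ndig k)%:R * amp k * scale k)).
- by rewrite !(amp_ge0, scale_ge0, mulr_ge0).
- by move=> t /negbTE tT; rewrite /level_fun tT.
- by move=> s t sT tT; rewrite -mulrA level_fun_lip.
Qed.

Definition level c k : holder_path T delta d := HolderPath (level_fun_path c k).

Lemma level_funE c k t (i : 'I_d) : t \in `[0, T] -> level_fun c k t 0 i =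
  \sum_(j < 2 ^ n k) bump_coef c k j i * (amp k * trapezoid j (t * scale k)).
Proof. by move=> tT; rewrite /level_fun tT mxE. Qed.

Lemma eq_level c c' k :
  (forall j m i, (j < 2 ^ n k)%N -> (m < ndig k)%N -> (i < d)%N ->
     c (pk k j m i) = c' (pk k j m i)) -> level c k = level c' k.
Proof.
move=> cc'; apply/val_inj/funext => t /=; rewrite /level_fun; case: ifP => // _.
apply/rowP => i; rewrite !mxE; apply: eq_bigr => j _; congr (_ * _).
by apply: eq_bigr => m _; rewrite cc'.
Qed.

Let D : R := (2 + 4 * T^-1 `^ delta) * pi * C.

Let D0 : 0 <= D.
Proof. by rewrite /D !mulr_ge0 ?pi_ge0 ?addr_ge0 ?mulr_ge0 ?powR_ge0// ltW. Qed.

(** The fourth power in [nC] absorbs the 2 k^2 signs and leaves a bound of order k^-2. It is written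
    as a difference so that partial sums and tails telescope. *)
Lemma level_norm c k : `|level c k| <= D * (k.+1%:R^-1 - k.+2%:R^-1).
Proof.
have /andP[d0 d1] := delta01.
set q := (2 `^ delta) ^+ n k; set Na := (ndig k)%:R * amp k.
have Na0 : 0 <= Na by rewrite mulr_ge0// amp_ge0.
have q1 : 1 <= q by rewrite exprn_ege1// -{1}(powRr0 2) ler_powR//; lra.
have Ti0 : 0 <= T^-1 by rewrite invr_ge0 ltW.
have sc : scale k `^ delta = q * T^-1 `^ delta.
  rewrite /scale powRM ?exprn_ge0//; congr (_ * _).
  by rewrite /q powRXn.
have sc0 := scale_ge0 k.
apply: (@le_trans _ _ (2 * Na + 4 * Na * scale k `^ delta)).
  apply: holder_norm_le.
  - by rewrite mulr_ge0.
  - by rewrite !(Na0, powR_ge0, mulr_ge0).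
  - by move=> t _; rewrite mulrA level_fun_le.
  move=> dp s t sT tT; rewrite -mulrA -powRM//; set y := scale k * `|t - s|.
  have y0 : 0 <= y by rewrite mulr_ge0.
  (* Below the width of a cell the Lipschitz bound is used with y <= y^delta; above it, the sup
     bound with 1 <= y^delta. *)
  have [y1|y1] := lerP y 1.
    rewrite (le_trans (level_fun_lip _ _ sT tT))// -(mulrA 2) -/Na -/y.
    apply: (@le_trans _ _ (2 * Na * y `^ delta)).
      rewrite ler_wpM2l ?(mulr_ge0 _ Na0)//.
      have [y00|yn0] := eqVneq y 0; first by rewrite [leLHS]y00 powR_ge0.
      by rewrite ger1_powR// lt_def yn0 y0.
    by rewrite ler_wpM2r ?powR_ge0// ler_wpM2r//; lra.
  rewrite (le_trans (ler_normB _ _))//.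
  have h u := level_fun_le c k u; rewrite -(mulrA 2) -/Na in h.
  rewrite (le_trans (lerD (h t) (h s)))//.
  have : 1 <= y `^ delta by rewrite -(powRr0 y) ler_powR// ltW.
  by move=> /(ler_wpM2l Na0); rewrite mulr1 -mulrA; lra.
rewrite sc; set E := T^-1 `^ delta; have E0 : 0 <= E by rewrite powR_ge0.
apply: (@le_trans _ _ ((2 + 4 * E) * (Na * q))).
  rewrite [leRHS]mulrDl lerD//; first by rewrite ler_wpM2l// ler_peMr.
  by rewrite le_eqVlt; apply/orP; left; apply/eqP; ring.
rewrite /D -/E -!(mulrA (2 + 4 * E)) ler_wpM2l ?addr_ge0 ?mulr_ge0// -(mulrA pi).
have k1 : 0 < k.+1%:R :> R by [].
have k2 : 0 < k.+2%:R :> R by [].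
have -> : k.+1%:R^-1 - k.+2%:R^-1 = (k.+1%:R * k.+2%:R)^-1 :> R.
  by field; rewrite !gt_eqF.
have p2 : 0 < 2 ^+ k :> R by rewrite exprn_gt0.
have := nC k; rewrite -/q => h.
have hq : q <= C * 2 ^+ k / k.+1%:R ^+ 4 by rewrite ler_pdivlMr ?exprn_gt0// mulrC.
apply: (le_trans (ler_wpM2l Na0 hq)); rewrite /Na ampE /ndig.
have -> : (k ^ 2).*2%:R * (pi / 4 / 2 ^+ k) * (C * 2 ^+ k / k.+1%:R ^+ 4) =
    pi * (C * ((k ^ 2)%:R / (2 * k.+1%:R ^+ 4))) :> R.
  rewrite -mul2n natrM; field; rewrite !gt_eqF//.
rewrite ler_wpM2l ?pi_ge0// ler_pM2l// ler_pdivrMr ?mulr_gt0 ?exprn_gt0//.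
rewrite mulrC ler_pdivlMr ?mulr_gt0// natrX -[k.+2%:R]natr1 -[k.+1%:R]natr1.
have : 0 <= k%:R :> R by [].
set x : R := k%:R; move=> x0.
(* What remains is x^2 (x + 1) (x + 2) <= 2 (x + 1)^4, up to the arrangement of the factors. *)
rewrite -subr_ge0 (_ : _ - _ = x ^+ 4 + 5 * x ^+ 3 + 10 * x ^+ 2 + 8 * x + 2); last ring.
by rewrite !addr_ge0 ?mulr_ge0 ?exprn_ge0.
Qed.

Lemma level_cvg c : cvgn (series (level c)).
Proof.
apply: normed_cvg; apply: nondecreasing_is_cvgn.
  by apply: nondecreasing_series => k _ _; exact: normr_ge0.
exists D => _ [N _ <-]; rewrite /series/=.
apply: (@le_trans _ _ (\sum_(0 <= k < N) D * (k.+1%:R^-1 - k.+2%:R^-1))).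
  by apply: ler_sum => k _; exact: level_norm.
rewrite -mulr_sumr.
rewrite ler_piMr//.
have -> : forall N, \sum_(0 <= i < N) (i.+1%:R^-1 - i.+2%:R^-1) = 1 - N.+1%:R^-1 :> R.
  elim=> [|M IH]; first by rewrite big_nil invr1 subrr.
  by rewrite big_nat_recr//= IH; ring.
by rewrite gerBl.
Qed.

Definition rpath c : holder_path T delta d := limn (series (level c)).

Lemma norm_lim_le (V : normedModType R) (u : V ^nat) (l : V) (e : R) :
  u @ \oo --> l -> (forall N, `|u N| <= e) -> `|l| <= e.
Proof.
move=> ul ue; apply/ler_addgt0Pr => a a0.
have /cvgrPdist_le/(_ a a0) ul' := ul.
have [N /= lN] := filter_ex ul'.
by rewrite -(subrK (u N) l) addrC (le_trans (ler_normD _ _))// lerD.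
Qed.

Lemma rpathB_cvg c c' :
  (fun N => series (level c) N - series (level c') N) @ \oo --> rpath c - rpath c'.
Proof. by apply: cvgB; exact: level_cvg. Qed.

(** Finitely many digits determine the first levels, and the other levels have a uniformly small
    sum. This modulus of continuity later gives the compactness of the range, the measurability of
    the sampling map and the cost of truncating the digits. *)
Lemma rpath_unif (e : R) : 0 < e ->
  exists M, forall c c', (forall p, (p < M)%N -> c p = c' p) -> `|rpath c - rpath c'| <= e.
Proof.
move=> e0; pose K := (Num.truncn (2 * D / e)).+1.
exists (\max_(k < K) \max_(j < 2 ^ n k) \max_(m < ndig k) \max_(i < d) pk k j m i).+1.
move=> c c' cc'.
have lev k : (k < K)%N -> level c k = level c' k.
  move=> kK; apply: eq_level => j m i jk mk id; rewrite cc'// ltnS.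
  apply: leq_trans (leq_bigmax (Ordinal kK)) => /=.
  apply: leq_trans (leq_bigmax (Ordinal jk)) => /=.
  apply: leq_trans (leq_bigmax (Ordinal mk)) => /=.
  exact: leq_trans (leq_bigmax (Ordinal id)).
apply: (norm_lim_le (@rpathB_cvg c c')) => N.
have tail M : `|\sum_(0 <= k < K + M) (level c k - level c' k)| <=
    2 * D * (K.+1%:R^-1 - (K + M).+1%:R^-1).
  elim: M => [|M IH].
    rewrite addn0 subrr mulr0 big_nat big1 ?normr0// => k /andP[_ kK].
    by rewrite lev// subrr.
  rewrite addnS big_nat_recr//= (le_trans (ler_normD _ _))//.
  set x := (K + M).+1%:R^-1 in IH *; set y := (K + M).+2%:R^-1.
  have -> : 2 * D * (K.+1%:R^-1 - y) = 2 * D * (K.+1%:R^-1 - x) + (D * (x - y) + D * (x - y)).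
    by ring.
  by rewrite lerD// (le_trans (ler_normB _ _))// lerD// level_norm.
rewrite /series/= -sumrB.
have DK : 2 * D * K.+1%:R^-1 <= e.
  rewrite ler_pdivrMr// -ler_pdivrMl// [leLHS]mulrC (le_trans (ltW (truncnS_gt _)))//.
  by rewrite ler_nat.
have [NK|KN] := leqP N K.
  rewrite big_nat big1 ?normr0 ?ltW// => k /andP[_ kN].
  by rewrite lev ?subrr// (leq_trans kN).
rewrite -(subnKC (ltnW KN)) (le_trans (tail _))// (le_trans _ DK)//.
by rewrite ler_wpM2l ?(mulr_ge0 _ D0)// gerBl invr_ge0.
Qed.

Definition block k j i : seq nat := [seq pk k j m i | m <- iota 0 (ndig k)].

Lemma block_uniq k j i : uniq (block k j i).
Proof. by rewrite map_inj_uniq ?iota_uniq// => m m' /pk_inj[]. Qed.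

(** One digit acts on one coordinate, through one bump. This is all that the tail estimate needs to
    know about the random path. *)
Lemma rpath_upd k j (i i' : 'I_d) p c v t : p \in block k j i -> (j < 2 ^ n k)%N ->
  t \in `[0, T] ->
  rpath (upd c p v) t 0 i' = rpath (upd c p None) t 0 i' +
    (i' == i)%:R * (coef v * (amp k * trapezoid j (t * scale k))).
Proof.
move=> /mapP[m]; rewrite mem_iota add0n => /andP[_ mk] -> {p} jk tT.
have [p pE] : exists p, p = pk k j m i by exists (pk k j m i).
rewrite -pE.
have E : rpath (upd c p v) - rpath (upd c p None) =
    level (upd c p v) k - level (upd c p None) k.
  have /cvg_lim <- := @rpathB_cvg (upd c p v) (upd c p None); last exact: norm_hausdorff.
  apply/cvg_lim; first exact: norm_hausdorff.
  (* Past index k the partial sums of the difference are constant: only the term of level k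
     survives. *)
  apply: cvg_near_cst; exists k.+1 => // N /= kN.
  rewrite /series/= -sumrB big_mkord (bigD1 (Ordinal kN))//= big1 ?addr0// => k' kk'.
  apply/eqP; rewrite subr_eq0; apply/eqP/eq_level => j' m' a _ _ _.
  rewrite /upd pE; case: eqP => // /pk_inj[kk _ _ _].
  by case/eqP: kk'; exact/val_inj.
have -> : rpath (upd c p v) = rpath (upd c p None) +
    (level (upd c p v) k - level (upd c p None) k) by rewrite -E addrC subrK.
rewrite mxE; congr (_ + _).
transitivity (level_fun (upd c p v) k t 0 i' - level_fun (upd c p None) k t 0 i').
  by rewrite !mxE.
rewrite !level_funE// -sumrB (bigD1 (Ordinal jk))//= big1 ?addr0; last first.
  move=> j' jj'; rewrite -mulrBl; apply/eqP; rewrite mulf_eq0; apply/orP; left.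
  rewrite subr_eq0; apply/eqP/eq_bigr => m' _; rewrite /upd pE; case: eqP => // /pk_inj[_ jj _ _].
  by case/eqP: jj'; exact/val_inj.
rewrite -mulrBl mulrA; congr (_ * _).
rewrite /bump_coef -sumrB (bigD1 (Ordinal mk))//= big1 ?addr0; last first.
  move=> m' mm'; rewrite /upd pE; case: eqP => [/pk_inj[_ _ mm _]|_]; last by rewrite subrr.
  by case/eqP: mm'; exact/val_inj.
rewrite /upd pE; have [->|ii'] := eqVneq i' i; first by rewrite eqxx subr0 mul1r.
rewrite mul0r; case: eqP => [/pk_inj[_ _ _ ii]|_]; last by rewrite subrr.
by case/eqP: ii'; exact/val_inj.
Qed.

End random_path.

(** * Exponential moments and the tail estimate *)

Section tail_estimate.
Context {R : realType}.

(** The point 2 x - pi lies in [-pi/2, 0], where the cosine is nonnegative, and its cosine is 1 - 2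
    cos^2 x. *)
Lemma sqr_cos_le (x : R) : pi / 4 <= x <= pi / 2 -> cos x ^+ 2 <= 1 / 2.
Proof.
move=> /andP[x1 x2]; have p0 := pi_gt0 R.
have : 0 <= cos (x *+ 2 - pi) by apply: cos_ge0_pihalf; apply/andP; split; lra.
by rewrite cosB cospi sinpi cos_mulr2n; lra.
Qed.

Variables (T : R) (d J N : nat) (a : R) (W : signs -> R -> 'rV[R]_d)
  (block : nat -> 'I_d -> seq nat).
Hypothesis T0 : 0 < T.
Hypothesis J0 : (0 < J)%N.
Hypothesis Wc : forall c i, {within `[0, T], continuous (fun r => W c r 0 i)}.
Hypothesis block_uniq : forall j i, uniq (block j i).
Hypothesis block_size : forall j i, size (block j i) = N.
Hypothesis W_upd : forall j i i' p c v t, p \in block j i -> (j < J)%N ->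
  t \in `[0, T] ->
  W (upd c p v) t 0 i' = W (upd c p None) t 0 i' +
    (i' == i)%:R * (coef v * (a * trapezoid j (t * (J%:R / T)))).
Variables (h : R -> R) (xi : 'rV[R]_d) (i : 'I_d).
Hypothesis hc : {within `[0, T], continuous h}.

Let tau := T / J%:R.

Let tau0 : 0 < tau. Proof. by rewrite divr_gt0// ltr0n. Qed.

Let tauJ : J%:R * tau = T.
Proof. by rewrite /tau mulrC divfK// pnatr_eq0 -lt0n. Qed.

Let phase c r := h r + dot xi (W c r).

Let X j c := cosint (phase c) (j%:R * tau) (j.+1%:R * tau).

Let le_tau (m n : nat) : (m <= n)%N -> m%:R * tau <= n%:R * tau.
Proof. by move=> mn; rewrite ler_pM2r// ler_nat. Qed.

Let leT (m : nat) : (m <= J)%N -> m%:R * tau <= T.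
Proof. by move=> mJ; rewrite -tauJ le_tau. Qed.

Let ge0tau (m : nat) : 0 <= m%:R * tau.
Proof. by rewrite mulr_ge0// ltW. Qed.

Let phase_cont c (m n : nat) : (n <= J)%N ->
  {within `[m%:R * tau, n%:R * tau], continuous (phase c)}.
Proof.
move=> nJ; apply: (@within_sub _ _ _ 0 T) => //; first exact: leT.
apply: within_add => //; rewrite /dot; apply: within_sum => i'.
exact: within_cmul.
Qed.

Let X_le j c : (j < J)%N -> `|X j c| <= tau.
Proof.
move=> jJ; rewrite (le_trans (cosint_le _ _)) ?le_tau//; first exact: phase_cont.
by rewrite -mulrBl -natrB// subSnn mul1r.
Qed.

Let dot_upd j p c v t : p \in block j i -> (j < J)%N -> t \in `[0, T] ->
  dot xi (W (upd c p v) t) = dot xi (W (upd c p None) t) +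
    coef v * (xi 0 i * a * trapezoid j (t * (J%:R / T))).
Proof.
move=> pb jJ tT; rewrite /dot.
under eq_bigr do rewrite (W_upd _ _ _ pb jJ tT) mulrDr.
rewrite big_split/=; congr (_ + _); rewrite (bigD1 i)//= big1 ?addr0.
  by rewrite eqxx mul1r; ring.
by move=> i' /negbTE ->; rewrite mul0r mulr0.
Qed.

Let time_in j t : (j < J)%N -> t \in `[j%:R * tau, j.+1%:R * tau] ->
  t \in `[0, T] /\ j%:R <= t * (J%:R / T) <= j.+1%:R.
Proof.
move=> jJ; rewrite !in_itv/= => /andP[t1 t2]; split.
  by rewrite (le_trans _ t1)//= (le_trans t2)// leT.
have -> : J%:R / T = tau^-1 by rewrite /tau invf_div.
by rewrite ler_pdivlMr// t1 ler_pdivrMr.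
Qed.

(** On its own cell the bump equals 1, so a sign of its block shifts the phase by the constant xi_i
    a and [cosint_avg] applies exactly. *)
Let X_step j p c : p \in block j i -> (j < J)%N ->
  avg1 p (X j) c = cos (xi 0 i * a) * X j (upd c p None).
Proof.
move=> pb jJ; rewrite /avg1.
have E v : X j (upd c p v) =
    cosint (fun r => phase (upd c p None) r + coef v * (xi 0 i * a))
      (j%:R * tau) (j.+1%:R * tau).
  apply: eq_cosint => t /(time_in jJ)[tT tj].
  by rewrite /phase (dot_upd _ _ pb jJ tT) trapezoid_eq1// mulr1 addrA.
rewrite !(E (Some _)) /=; have := @cosint_avg _ (phase (upd c p None)) (xi 0 i * a) _ _
  (@phase_cont (upd c p None) j j.+1 jJ).
by rewrite /X mul1r mulN1r => ->; field.
Qed.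

Let mask (z : seq nat) (c : signs) : signs := fun q => if q \in z then None else c q.

(** Every averaged sign leaves a cosine and a switched-off position. The mask [z] records these
    positions, so that the induction remains within one family of functions. *)
Let avg_mask j (s z : seq nat) c : {subset s <= block j i} -> uniq s ->
  (forall q, q \in s -> q \notin z) -> (j < J)%N ->
  `|avg s (fun c => X j (mask z c)) c| <= `|cos (xi 0 i * a)| ^+ size s * tau.
Proof.
elim: s z c => [|p s IH] z c sb; first by move=> _ _ jJ; rewrite mul1r X_le.
rewrite cons_uniq => /andP[ps us] sz jJ; rewrite avg_cons.
have pz : p \notin z by rewrite sz// mem_head.
rewrite (_ : avg1 p _ = fun c => cos (xi 0 i * a) * X j (mask (p :: z) c)); last first.
  apply/funext => c'.
  have mu v : mask z (upd c' p v) = upd (mask z c') p v.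
    apply/funext => q; rewrite /mask /upd; case: eqVneq => // ->.
    by rewrite (negbTE pz).
  have -> : mask (p :: z) c' = upd (mask z c') p None.
    by apply/funext => q; rewrite /mask /upd inE; case: eqVneq.
  by rewrite -X_step ?sb ?mem_head// /avg1 !mu.
rewrite avgZ normrM exprS -mulrA ler_wpM2l// IH//.
- by move=> q qs; rewrite sb// inE qs orbT.
- move=> q qs; rewrite inE negb_or sz ?inE ?qs ?orbT// andbT.
  by apply: contraNneq ps => <-.
Qed.

Let avg_block j c : (j < J)%N ->
  avg (block j i) (X j) c <= `|cos (xi 0 i * a)| ^+ N * tau.
Proof.
move=> jJ; rewrite (le_trans (ler_norm _))// -(block_size j i).
have := @avg_mask j (block j i) [::] c (fun=> id) (block_uniq j i) (fun q _ => erefl) jJ.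
by congr (`|avg _ _ _| <= _); apply/funext => c'; congr (X j).
Qed.

(** Distinct cells of equal parity are at least two apart, and the bump j vanishes outside
    [j - 1, j + 2]. *)
Let X_indep j j' p v c : (j < J)%N -> (j' < J)%N -> odd j = odd j' -> j != j' ->
  p \in block j i -> X j' (upd c p v) = X j' c.
Proof.
move=> jJ jJ' jj' njj' pb.
have E w : X j' (upd c p w) = X j' (upd c p None).
  apply: eq_cosint => t /(time_in jJ')[tT /andP[t1 t2]].
  rewrite /phase (dot_upd _ _ pb jJ tT) trapezoid_eq0 ?mulr0 ?addr0//.
  have /orP[jlt|jlt] : (j.+2 <= j')%N || (j'.+2 <= j)%N.
    case: (ltngtP j j') njj' => // lt _; apply/orP; [left|right];
      by rewrite ltn_neqAle lt andbT; apply/eqP => jE; move: jj'; rewrite -jE/=; case: odd.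
  - right; apply: le_trans t1; by rewrite -natrD ler_nat addn2.
  - left; apply: (le_trans t2); by rewrite lerBrDr natr1 ler_nat.
rewrite E -(E (c p)); congr (X j').
by apply/funext => q; rewrite /upd; case: eqVneq => // ->.
Qed.

Variables (A B M : nat) (lam : R).
Hypotheses (AB : (A < B)%N) (BJ : (B <= J)%N).
Hypothesis blockM : forall j p, (j < J)%N -> p \in block j i -> (p < M)%N.
Hypothesis lam0 : 0 <= lam.
Hypothesis small : Num.sqrt J%:R * `|cos (xi 0 i * a)| ^+ N <= 1.

Let L : R := (B - A)%:R.
Let sL := Num.sqrt L.
Let sL0 : 0 < sL. Proof. by rewrite sqrtr_gt0 ltr0n subn_gt0. Qed.
Let sLL : sL ^+ 2 = L. Proof. by rewrite sqr_sqrtr. Qed.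

Let js (e : bool) := [seq j <- index_iota A B | odd j == e].

Let jsJ e j : j \in js e -> (j < J)%N.
Proof.
by rewrite mem_filter mem_index_iota => /and3P[_ _ jB]; rewrite (leq_trans jB).
Qed.

Let size_js e : (size (js e))%:R <= L.
Proof. by rewrite ler_nat size_filter (leq_trans (count_size _ _))// size_iota. Qed.

Let S e c := \sum_(j <- js e) X j c.

(** The minimiser of the exponent - th lam tau sL + 2 (th tau)^2 L; its minimal value is - lam^2 /
    8. *)
Let th := lam / (4 * tau * sL).

(** The restriction on [lam] means th tau <= 1/2, the range of the quadratic bound. The extra lam /
    4 in the exponent pays for the nonzero means of the cells. *)
Let tail_parity e : lam <= 2 * sL ->
  avg (iota 0 M) (fun c => expR (th * (S e c - lam * tau * sL))) (fun=> None)
    <= expR (- (lam ^+ 2) / 8 + lam / 4).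
Proof.
move=> lamL; have := small; set Q := `|cos _| ^+ N => smallQ.
have th0 : 0 <= th by rewrite divr_ge0// !mulr_ge0// ltW.
have thtau : th * tau = lam / (4 * sL).
  by rewrite /th; field; rewrite !gt_eqF.
have Q0 : 0 <= Q by rewrite exprn_ge0.
have expo c : expR (th * (S e c - lam * tau * sL)) =
    expR (- (th * (lam * tau * sL))) * \prod_(j <- js e) expR (th * X j c).
  rewrite mulrBr addrC expRD; congr (_ * _); rewrite /S big_distrr/= -expR_sum//.
rewrite (_ : (fun c => _) = fun c => expR (- (th * (lam * tau * sL))) *
  \prod_(j <- js e) expR (th * X j c)); last exact/funext.
rewrite avgZ.
have tht : th * tau <= 1 / 2.
  by rewrite thtau ler_pdivrMr ?mulr_gt0//; lra.
set G := fun c => \prod_(j <- js e) _.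
pose blk := flatten [seq block j i | j <- js e].
have -> : avg (iota 0 M) G = avg (iota 0 M) (avg blk G).
  rewrite avg_absorb// => p /flattenP[_ /mapP[j jje ->] pb].
  by rewrite mem_iota/= add0n (blockM (jsJ jje) pb).
have Hb c : avg blk G c <= expR (th * (Q * tau) + 2 * (th * tau) ^+ 2) ^+ size (js e).
  apply: avg_prod_exp => //.
  - by rewrite filter_uniq// iota_uniq.
  - by move=> j c' /jsJ; exact: X_le.
  - by move=> j c' /jsJ; exact: avg_block.
  - move=> j j' p v c' jj jj' njj pb; apply: (@X_indep j) => //; rewrite ?(jsJ jj) ?(jsJ jj')//.
    by move: jj jj'; rewrite !mem_filter => /andP[/eqP -> _] /andP[/eqP -> _].
apply: (@le_trans _ _ (expR (- (th * (lam * tau * sL))) *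
    expR (th * (Q * tau) + 2 * (th * tau) ^+ 2) ^+ size (js e))).
  rewrite ler_wpM2l ?expR_ge0//.
  by rewrite (le_trans (avg_le _ _ Hb))// avg_cst.
rewrite -expRM_natr -expRD ler_expR.
have E1 : th * (Q * tau) + 2 * (th * tau) ^+ 2 = lam / (4 * sL) * Q + 2 * (lam / (4 * sL)) ^+ 2.
  by rewrite -thtau; ring.
apply: (@le_trans _ _ (- (th * (lam * tau * sL)) +
    (th * (Q * tau) + 2 * (th * tau) ^+ 2) * L)).
  rewrite lerD2l ler_wpM2l// addr_ge0//.
    by rewrite (mulr_ge0 th0)// (mulr_ge0 Q0)// ltW.
  by rewrite (@mulr_ge0 _ 2)// sqr_ge0.
rewrite E1 -sLL.
have -> : th * (lam * tau * sL) = lam ^+ 2 / 4.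
  by rewrite /th; field; rewrite !gt_eqF.
have -> : (lam / (4 * sL) * Q + 2 * (lam / (4 * sL)) ^+ 2) * sL ^+ 2 =
    lam / 4 * (sL * Q) + lam ^+ 2 / 8.
  by field; rewrite gt_eqF.
(* The means of at most L cells add up to L Q tau, hence to at most sL tau, the natural size of the
   fluctuations; this is the purpose of [small]. *)
have sLQ : sL * Q <= 1.
  rewrite (le_trans _ smallQ)// ler_wpM2r// ler_wsqrtr// ler_nat.
  by rewrite (leq_trans (leq_subr _ _)).
have : lam / 4 * (sL * Q) <= lam / 4 by rewrite ler_piMr// divr_ge0.
lra.
Qed.

Let S_split c : cosint (phase c) (A%:R * tau) (B%:R * tau) = S true c + S false c.
Proof.
have -> : S true c + S false c = \sum_(A <= j < B) X j c.
  rewrite /S /js !big_filter [RHS](bigID (fun j => odd j == true))/=; congr (_ + _).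
  by apply: eq_bigl => j; case: odd.
move: BJ; rewrite -(subnKC (ltnW AB)); elim: (B - A)%N => [|n IH].
  by rewrite addn0 big_geq// /cosint set_itv1 Rintegral_set1.
rewrite addnS => nJ; rewrite big_nat_recr ?leq_addr//= -IH ?(ltnW nJ)//.
rewrite (@cosint_split _ _ _ ((A + n)%:R * tau))//.
- by rewrite le_tau// leq_addr.
- by rewrite le_tau.
- exact: phase_cont.
Qed.

(** An exceptional event is encoded by a nonnegative Z that is at least 1 on it and has a small
    average. Unions then become sums, and [lebesgue_dig_le] converts the average into a measure. *)
Lemma cosint_tail : exists Z : signs -> R, [/\ forall c, 0 <= Z c,
  forall c, Z c < 1 -> cosint (phase c) (A%:R * tau) (B%:R * tau) <=
    2 * (lam * tau * sL) &
  avg (iota 0 M) Z (fun=> None) <= 2 * expR (- (lam ^+ 2) / 8 + lam / 4)].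
Proof.
(* For larger [lam] the trivial bound L tau = sL^2 tau is already below the target, and Z = 0
   works. *)
have [lamL|lamL] := lerP lam (2 * sL); last first.
  exists (fun=> 0); split => // [c _|]; last by rewrite avg_cst mulr_ge0// expR_ge0.
  rewrite (le_trans (ler_norm _))// (le_trans (cosint_le _ _))//.
  - by rewrite le_tau// ltnW.
  - exact: phase_cont.
  - rewrite -mulrBl -natrB ?(ltnW AB)// -/L -sLL expr2.
    rewrite [leRHS](_ : _ = 2 * sL * lam * tau); last by ring.
    rewrite ler_pM2r//; have := sL0; nra.
exists (fun c => expR (th * (S true c - lam * tau * sL)) +
                 expR (th * (S false c - lam * tau * sL))); split => [c|c|].
- by rewrite addr_ge0// expR_ge0.
- move=> Z1; rewrite S_split mulrDl mul1r.
  have th0 : 0 <= th by rewrite divr_ge0// !mulr_ge0// ltW.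
  have le e : expR (th * (S e c - lam * tau * sL)) < 1 -> S e c <= lam * tau * sL.
    move=> lt1; rewrite leNgt; apply/negP => gt.
    move: lt1; rewrite ltNge => /negP; apply.
    rewrite -expR0 ler_expR mulr_ge0// subr_ge0 ltW//.
  rewrite lerD// le// (le_lt_trans _ Z1)//; first by rewrite lerDl expR_ge0.
  by rewrite lerDr expR_ge0.
- by rewrite avgD mulrDl !mul1r lerD// tail_parity.
Qed.

End tail_estimate.

(** * Union bound and counting of grid points *)

Section union_bound.
Context {R : realType}.

Lemma avg_union (I : finType) (Q : I -> signs -> Prop) (M : nat) (eps : R) :
  (forall g, exists Z : signs -> R, [/\ forall c, 0 <= Z c,
     forall c, Z c < 1 -> Q g c & avg (iota 0 M) Z (fun=> None) <= eps]) ->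
  exists Z : signs -> R, [/\ forall c, 0 <= Z c,
     forall c, Z c < 1 -> forall g, Q g c &
     avg (iota 0 M) Z (fun=> None) <= #|I|%:R * eps].
Proof.
move=> /choice[Z HZ]; exists (fun c => \sum_(g : I) Z g c); split => [c|c Z1 g|].
- by apply: sumr_ge0 => g _; case: (HZ g).
- case: (HZ g) => _ + _; apply; rewrite (le_lt_trans _ Z1)// (bigD1 g)//= lerDl.
  by apply: sumr_ge0 => g' _; case: (HZ g').
- rewrite avg_sum mulr_natl -sumr_const; apply: ler_sum => g _.
  by case: (HZ g).
Qed.

Lemma expR_ge2 (p : nat) : 2 ^+ p <= expR p%:R :> R.
Proof.
rewrite -[X in expR X]mulr1 expRM_natl lerXn2r ?nnegrE ?expR_ge0//.
by rewrite (le_trans _ (expR_ge1Dx _))//; lra.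
Qed.

(** Its square (k + 1)^4 (m + 1) dominates the logarithm of the number of grid points, of order (k +
    1)^2 (m + 1). The factor in m later becomes the square root of log (2 + |eta|), and the factor
    in k is absorbed by the choice of levels. *)
Definition lambda (k m : nat) : R := k.+1%:R ^+ 2 * Num.sqrt m.+1%:R.

Lemma lambda_ge0 k m : 0 <= lambda k m.
Proof. by rewrite mulr_ge0 ?exprn_ge0 ?sqrtr_ge0. Qed.

(** The factors count frequencies, coefficients and pairs of endpoints; 8 stands for the four phases
    times the constant 2 of the tail bound. *)
Lemma count_le (d q n k m : nat) : (n <= k ^ 2)%N ->
  ((2 ^ (k.+1 + n)).*2.+1 ^ d * (2 ^ (m + n)).*2.+1 ^ q * ((2 ^ n).+1 * (2 ^ n).+1) * 8 <=
   2 ^ ((3 * d + 2 * q + 5) * (k.+1 ^ 2 * m.+1)))%N.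
Proof.
move=> nk; set s := (k.+1 ^ 2 * m.+1)%N.
have k2 : (k.+1 ^ 2 = k ^ 2 + k.*2 + 1)%N by rewrite -addn1 sqrnD muln1 exp1n -mul2n; lia.
have ks : (k.+1 ^ 2 <= s)%N by rewrite leq_pmulr.
have ms : (m <= s)%N by rewrite /s k2; nia.
have s1 : (1 <= s)%N by rewrite muln_gt0 expn_gt0.
have dbl a b : (a < b)%N -> ((2 ^ a).*2.+1 <= 2 ^ b.+1)%N.
  move=> ab; rewrite -mul2n -expnS (@leq_trans (2 ^ a.+2))//; last by rewrite leq_exp2l.
  by rewrite (expnS 2 a.+1); have := expn_gt0 2 a.+1; lia.
have sc a b : (a < b)%N -> ((2 ^ a).+1 <= 2 ^ b)%N by move=> ab; rewrite ltn_exp2l.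
have h1 : ((2 ^ (k.+1 + n)).*2.+1 <= 2 ^ (3 * s))%N.
  apply: leq_trans (dbl _ (k.+2 + n)%N _) _; first by rewrite ltn_add2r.
  by rewrite leq_exp2l//; lia.
have h2 : ((2 ^ (m + n)).*2.+1 <= 2 ^ (2 * s))%N.
  apply: leq_trans (dbl _ (m.+1 + n)%N _) _; first by rewrite ltn_add2r.
  by rewrite leq_exp2l// /s k2; nia.
have h3 : ((2 ^ n).+1 <= 2 ^ s)%N.
  by apply: sc; rewrite (leq_ltn_trans nk)// (leq_trans _ ks)// k2; lia.
have -> : (2 ^ ((3 * d + 2 * q + 5) * s) =
    (2 ^ (3 * s)) ^ d * (2 ^ (2 * s)) ^ q * (2 ^ s * 2 ^ s) * 2 ^ (3 * s))%N.
  by rewrite -!expnM -!expnD; congr (2 ^ _)%N; lia.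
rewrite !leq_mul//.
- by case: (d) => // d'; rewrite leq_exp2r.
- by case: (q) => // q'; rewrite leq_exp2r.
- by rewrite (@leq_trans (2 ^ 3))// leq_exp2l//; lia.
Qed.

(** For lambda >= 4 the exponent is at most - lambda^2 / 16. The threshold on k makes this beat the
    count with one factor 2^-s to spare, s = (k + 1)^2 (m + 1), and that factor is summable in both
    k and m. *)
Lemma tail_sum_le (d q n k m : nat) : (n <= k ^ 2)%N ->
  (16 * (3 * d + 2 * q + 6) <= k.+1 ^ 2)%N ->
  ((2 ^ (k.+1 + n)).*2.+1 ^ d * (2 ^ (m + n)).*2.+1 ^ q * ((2 ^ n).+1 * (2 ^ n).+1) * 4)%:R *
    (2 * expR (- (lambda k m ^+ 2) / 8 + lambda k m / 4)) <= 2^-1 ^+ (k + m).+1 :> R.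
Proof.
move=> nk kbig; set A := (3 * d + 2 * q + 5)%N; set s := (k.+1 ^ 2 * m.+1)%N.
rewrite mulrA -natrM -mulnA (_ : (4 * 2 = 8)%N)//.
have lam4 : 4 <= lambda k m.
  rewrite /lambda (@le_trans _ _ (k.+1%:R ^+ 2))//.
    by rewrite -natrX ler_nat; lia.
  by rewrite ler_peMr// ?exprn_ge0// -{1}sqrtr1 ler_sqrt// ler1n.
have lam2 : lambda k m ^+ 2 = (k.+1 ^ 2 * s)%:R.
  rewrite /lambda exprMn sqr_sqrtr// -exprM natrM /s natrM !natrX mulrA -exprD//.
have e1 : expR (- (lambda k m ^+ 2) / 8 + lambda k m / 4) <= expR (- (A.+1 * s)%:R).
  rewrite ler_expR; apply: (@le_trans _ _ (- (lambda k m ^+ 2) / 16)).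
    by nra.
  rewrite mulNr lerN2 ler_pdivlMr// lam2 -natrM ler_nat.
  by rewrite mulnAC leq_mul2r; apply/orP; right; move: kbig; rewrite /A; lia.
have := count_le d q m nk; rewrite -(ler_nat R) => cnt.
apply: (le_trans (ler_pM (ler0n _ _) (expR_ge0 _) cnt e1)).
rewrite expRN natrX.
apply: (@le_trans _ _ (2 ^+ (A * s) * (2 ^+ (A.+1 * s))^-1)).
  by rewrite ler_wpM2l ?exprn_ge0// lef_pV2 ?posrE ?expR_gt0 ?exprn_gt0// expR_ge2.
rewrite mulSn addnC exprD invfM mulrA divff ?expf_neq0// mul1r exprVn.
rewrite lef_pV2 ?posrE ?exprn_gt0// ler_eXn2l ?ltr1n// /s.
nia.
Qed.

End union_bound.

(** * Union bound over a grid *)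

Section good_events.
Context {R : realType}.
Implicit Types (T : R) (d q k m : nat).

Definition gridpt (p D : nat) (z : 'I_p -> int) : 'rV[R]_p :=
  \row_i ((z i)%:~R / 2 ^+ D).

Definition mesh T (n : nat -> nat) k : R := T / (2 ^ n k)%:R.

(* Bounds at the points of a grid of mesh 2^-(n k): the frequencies xi have sup
   norm of order 2^k, the coefficients eta have sup norm at most 2^m, and the
   phase al * pi / 2 produces the real and imaginary parts and their opposites. *)
Definition good T d (n : nat -> nat) (w : R -> 'rV[R]_d) q k m : Prop :=
  forall (z : 'I_d -> int) (y : 'I_q -> int) (A B al : nat),
    (forall i, (`|z i| <= 2 ^ (k.+1 + n k))%N) ->
    (exists i, (2 ^ (k + n k) <= `|z i|)%N) ->
    (forall i, (`|y i| <= 2 ^ (m + n k))%N) ->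
    (A < B)%N -> (B <= 2 ^ n k)%N -> (al < 4)%N ->
    cosint (fun r => gpoly (gridpt (n k) y) r + al%:R * (pi / 2) +
                     dot (gridpt (n k) z) (w r)) (A%:R * mesh T n k) (B%:R * mesh T n k) <=
    2 * (lambda k m * mesh T n k * Num.sqrt (B - A)%:R) + (2 ^+ n k)^-1 * ((B - A)%:R * mesh T n k).

Lemma gpoly_cont q (eta : 'rV[R]_q) (a b : R) :
  {within `[a, b], continuous (gpoly eta)}.
Proof.
apply: within_sum => i; apply: within_cmul; apply: continuous_subspaceT.
exact: exprn_continuous.
Qed.

Lemma coord_cont d (f : R -> 'rV[R]_d) (i : 'I_d) (a b : R) :
  {within `[a, b], continuous f} -> {within `[a, b], continuous (fun r => f r 0 i)}.
Proof.
move=> fc x; apply/cvgrPdist_le => e e0.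
have /cvgrPdist_le/(_ e e0) := fc x; apply: filterS => y.
by apply: le_trans; rewrite -[_ - _](_ : (f x - f y) 0 i = _) ?coord_norm_le ?mxE.
Qed.

Lemma dot_cont d (f : R -> 'rV[R]_d) xi (a b : R) :
  {within `[a, b], continuous f} -> {within `[a, b], continuous (fun r => dot xi (f r))}.
Proof. by move=> fc; apply: within_sum => i; apply: within_cmul; exact: coord_cont. Qed.

Lemma holder_path_cont T delta d (f : holder_path T delta d) :
  {within `[0, T], continuous f}.
Proof. by case: (holder_pathP f). Qed.

Lemma dot_le d (xi v : 'rV[R]_d) (M : R) : (forall i, `|xi 0 i| <= M) ->
  `|dot xi v| <= d%:R * (M * `|v|).
Proof.
move=> xiM; rewrite (le_trans (ler_norm_sum _ _ _))//.
rewrite mulr_natl -[X in _ *+ X]card_ord -sumr_const; apply: ler_sum => i _.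
by rewrite normrM ler_pM// coord_norm_le.
Qed.

Lemma dotDr d (xi u v : 'rV[R]_d) : dot xi (u + v) = dot xi u + dot xi v.
Proof. by rewrite /dot -big_split/=; apply: eq_bigr => i _; rewrite mxE mulrDr. Qed.

Lemma dotBr d (xi u v : 'rV[R]_d) : dot xi (u - v) = dot xi u - dot xi v.
Proof. by rewrite /dot -sumrB; apply: eq_bigr => i _; rewrite !mxE mulrBr. Qed.

Lemma dotBl d (xi xi' u : 'rV[R]_d) : dot (xi - xi') u = dot xi u - dot xi' u.
Proof. by rewrite /dot -sumrB; apply: eq_bigr => i _; rewrite !mxE mulrBl. Qed.

Lemma gridpt_norm (p D e : nat) (z : 'I_p -> int) i :
  (`|z i| <= 2 ^ (e + D))%N -> `|gridpt D z 0 i| <= 2 ^+ e.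
Proof.
move=> zi; rewrite mxE normrM normfV (ger0_norm (exprn_ge0 _ _))//.
rewrite ler_pdivrMr ?exprn_gt0// -exprD -intr_norm -natrX.
by rewrite -abszE -pmulrn ler_nat.
Qed.

Lemma gridpt_norm_ge (p D e : nat) (z : 'I_p -> int) i :
  (2 ^ (e + D) <= `|z i|)%N -> 2 ^+ e <= `|gridpt D z 0 i|.
Proof.
move=> zi; rewrite mxE normrM normfV (ger0_norm (exprn_ge0 _ _))//.
rewrite ler_pdivlMr ?exprn_gt0// -exprD -intr_norm -natrX.
by rewrite -abszE -pmulrn ler_nat.
Qed.

Definition int_of {G : nat} (u : 'I_(G.*2.+1)) : int := (u : nat)%:Z - G%:Z.

Lemma int_of_le G (u : 'I_(G.*2.+1)) : (`|int_of u| <= G)%N.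
Proof. by rewrite /int_of; have := ltn_ord u; lia. Qed.

Lemma int_ofP (G : nat) (z : int) : (`|z| <= G)%N -> exists u : 'I_(G.*2.+1), int_of u = z.
Proof.
move=> zG; have h : (`|(z + G%:Z)%R| < G.*2.+1)%N by lia.
by exists (Ordinal h); rewrite /int_of /=; lia.
Qed.

Lemma ints_ofP (p G : nat) (z : 'I_p -> int) : (forall i, (`|z i| <= G)%N) ->
  exists u : {ffun 'I_p -> 'I_(G.*2.+1)}, z = int_of \o u.
Proof.
move=> zG; have /choice[u Hu] := fun i => int_ofP (zG i).
by exists (finfun u); apply/funext => i /=; rewrite ffunE Hu.
Qed.

Variables (T delta : R) (d : nat).
Hypotheses (T0 : 0 < T) (delta01 : 0 <= delta <= 1).
Variables (n : nat -> nat) (C : R).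
Hypothesis C0 : 0 < C.
Hypothesis nC : forall k, k.+1%:R ^+ 4 * (2 `^ delta) ^+ n k <= C * 2 ^+ k.
Hypothesis nk : forall k, (n k <= k ^ 2)%N.
Variable f : holder_path T delta d.

Let W c : holder_path T delta d := f + rpath d T0 delta01 n c.

(** The tail bound is applied to the path with digits truncated at M, where averages are available;
    undoing the truncation costs the last term in [good]. *)
Lemma good_event q : exists k0, forall k m, (k0 <= k)%N ->
  exists E : set (measurableTypeR R), [/\ measurable E,
    (lebesgue_measure E <= (2^-1 ^+ (k + m).+1)%:E)%E &
    forall x : R, 0 <= x < 1 -> ~ E x -> good T n (W (dig x)) q k m].
Proof.
exists (16 * (3 * d + 2 * q + 6))%N => k m kbig.
have k2big : (16 * (3 * d + 2 * q + 6) <= k.+1 ^ 2)%N by nia.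
pose J := (2 ^ n k)%N; pose tau := T / J%:R.
have J0 : (0 < J)%N by rewrite expn_gt0.
(* A change of the path by e changes the phase by at most 2^-(n k), since the d coordinates of the
   frequency are at most 2^(k + 1); [d.+1] keeps the denominator positive. *)
pose e : R := (2 ^+ n k * (d.+1%:R * 2 ^+ k.+1))^-1.
have e0 : 0 < e by rewrite invr_gt0 !mulr_gt0 ?exprn_gt0.
have [M0 HM0] := rpath_unif d T0 delta01 C0 nC e0.
pose M := maxn M0 (\max_(j < J) \max_(l < ndig k) \max_(i < d) pk k j l i).+1.
have blockM j (i : 'I_d) p : (j < J)%N -> p \in block k j i -> (p < M)%N.
  move=> jJ /mapP[l]; rewrite mem_iota add0n => /andP[_ lk] ->.
  rewrite leq_max ltnS; apply/orP; right.
  apply: leq_trans (leq_bigmax (Ordinal jJ)) => /=.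
  by apply: leq_trans (leq_bigmax (Ordinal lk)) => /=; exact: leq_bigmax.
pose I : finType := (({ffun 'I_d -> 'I_((2 ^ (k.+1 + n k)).*2.+1)} *
  {ffun 'I_q -> 'I_((2 ^ (m + n k)).*2.+1)}) * ('I_(2 ^ n k).+1 * 'I_(2 ^ n k).+1) * 'I_4)%type.
pose th (g : I) c r := gpoly (gridpt (n k) (int_of \o g.1.1.2)) r + g.2%:R * (pi / 2) +
   dot (gridpt (n k) (int_of \o g.1.1.1)) (W c r).
pose Q (g : I) c := (exists i, (2 ^ (k + n k) <= `|(int_of \o g.1.1.1) i|)%N) ->
  (g.1.2.1 < g.1.2.2)%N ->
  cosint (th g c) (g.1.2.1%:R * tau) (g.1.2.2%:R * tau) <=
    2 * (lambda k m * tau * Num.sqrt (g.1.2.2 - g.1.2.1)%:R).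
pose eps : R := 2 * expR (- (lambda k m ^+ 2) / 8 + lambda k m / 4).
have [g|Z [Z0 HZ avgZ]] := @avg_union R I Q M eps.
  (* The index set is a full product. At the points excluded in [good] the property is vacuous and Z
     = 0 serves. *)
  have [[i iz]|nz] := pselect (exists i, (2 ^ (k + n k) <= `|(int_of \o g.1.1.1) i|)%N); last first.
    exists (fun=> 0); split => // [c _ /nz //|].
    by rewrite avg_cst mulr_ge0// expR_ge0.
  have [AB|nAB] := boolP (g.1.2.1 < g.1.2.2)%N; last first.
    exists (fun=> 0); split => // [c _ _ AB|]; first by rewrite AB in nAB.
    by rewrite avg_cst mulr_ge0// expR_ge0.
  set xi := gridpt (n k) (int_of \o g.1.1.1).
  (* The amplitude is calibrated here: a coordinate between 2^k and 2^(k + 1) gives a phase shift in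
     the range where cos^2 <= 1/2. *)
  have xia : pi / 4 <= `|xi 0 i| * amp k <= pi / 2.
    have p0 := pi_gt0 R; have p2 : 0 < 2 ^+ k :> R by rewrite exprn_gt0.
    have x1 := gridpt_norm_ge iz; rewrite -/xi in x1.
    have x2 : `|xi 0 i| <= 2 ^+ k.+1.
      by apply: gridpt_norm; exact: int_of_le.
    rewrite ampE mulrA; apply/andP; split.
      by rewrite ler_pdivlMr// mulrC ler_wpM2r// divr_ge0// ltW.
    by rewrite ler_pdivrMr//; move: x2; rewrite exprS; nra.
  have small : Num.sqrt J%:R * `|cos (xi 0 i * amp k)| ^+ ndig k <= 1.
    have -> : `|cos (xi 0 i * amp k)| = `|cos (`|xi 0 i| * amp k)|.
      by rewrite -[in LHS]cos_norm normrM (ger0_norm (amp_ge0 k)).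
    rewrite /ndig -mul2n exprM real_normK ?num_real//.
    apply: (@le_trans _ _ (2 ^+ (k ^ 2) * (1 / 2) ^+ (k ^ 2))); last first.
      by rewrite -exprMn (_ : 2 * (1 / 2) = 1) ?expr1n//; lra.
    rewrite ler_pM ?(sqrtr_ge0, sqr_ge0, exprn_ge0)//; last first.
      by rewrite lerXn2r ?nnegrE ?sqr_ge0// ?sqr_cos_le//; lra.
    apply: (@le_trans _ _ J%:R).
      rewrite -[leRHS]sqr_sqrtr// expr2 ler_peMr// -{1}sqrtr1 ler_sqrt// ler1n//.
    by rewrite -natrX ler_nat leq_exp2l.
  have Wc c i' : {within `[0, T], continuous (fun r => W c r 0 i')}.
    by apply: coord_cont; exact: holder_path_cont.
  have hc : {within `[0, T], continuous (fun r =>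
      gpoly (gridpt (n k) (int_of \o g.1.1.2)) r + g.2%:R * (pi / 2))}.
    by apply: within_add; [exact: gpoly_cont|exact: within_cst].
  have WU j i0 i' p c v t : p \in block k j (i0 : 'I_d) -> (j < J)%N -> t \in `[0, T] ->
      W (upd c p v) t 0 i' = W (upd c p None) t 0 i' +
      (i' == i0)%:R * (coef v * (amp k * trapezoid j (t * (J%:R / T)))).
    move=> pb jJ tT; rewrite /W [LHS]mxE (rpath_upd T0 delta01 C0 nC i' c v pb jJ tT).
    by rewrite addrA /scale -natrX [in RHS]mxE.
  have BJ : (g.1.2.2 <= J)%N by rewrite -ltnS.
  have [||Z [Z0 HZ avgZ]] := @cosint_tail R T d J (ndig k) (amp k) W
    (fun j i => block k j i) T0 J0 Wc _ _ WU _ xi i hc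
    g.1.2.1 g.1.2.2 M (lambda k m) AB BJ (fun j p => blockM j i p)
    (lambda_ge0 _ _) small.
  - by move=> j i0; exact: block_uniq.
  - by move=> j i0; rewrite size_map size_iota.
  exists Z; split => // c Z1 _ _.
  exact: HZ.
exists [set x | (0 <= x < 1) /\ 1 <= Z (cutoff M (dig x))]; split.
- exact: (measurable_dig M (fun c => 1 <= Z c)).
- apply: (le_trans (lebesgue_dig_le _ Z0)); rewrite lee_fin (le_trans avgZ)//.
  have := @tail_sum_le R d q (n k) k m (nk k) k2big; rewrite -/eps.
  by rewrite !card_prod !card_ffun !card_ord.
move=> x x01 nE z y A B al zG zi yG AB BJ al4; rewrite /mesh -/J -/tau.
have Z1 : Z (cutoff M (dig x)) < 1.
  by rewrite ltNge; apply/negP => Z1; apply: nE.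
have [u zu] := ints_ofP zG; have [u' yu] := ints_ofP yG.
subst z y.
have AJ : (A < J.+1)%N by rewrite ltnS (leq_trans (ltnW AB)).
have H := HZ _ Z1 ((u, u'), (Ordinal AJ, Ordinal (BJ : (B < J.+1)%N)), Ordinal al4) zi AB.
set z := int_of \o u in zG zi H *; set y := int_of \o u' in yG H *.
have leT (a : nat) : (a <= J)%N -> a%:R * tau <= T.
  by move=> aJ; rewrite /tau mulrCA ler_piMr ?(ltW T0)// ler_pdivrMr ?ltr0n// mul1r ler_nat.
have tau0 : 0 < tau by rewrite divr_gt0// ltr0n.
have ge0 (a : nat) : 0 <= a%:R * tau by rewrite mulr_ge0// ltW.
have thc c : {within `[A%:R * tau, B%:R * tau], continuous (fun r =>
   gpoly (gridpt (n k) y) r + al%:R * (pi / 2) + dot (gridpt (n k) z) (W c r))}.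
  apply: (@within_sub _ _ _ 0 T) => //; first exact: leT.
  apply: within_add; last by apply: dot_cont; exact: holder_path_cont.
  by apply: within_add; [exact: gpoly_cont|exact: within_cst].
have ABtau : A%:R * tau <= B%:R * tau by rewrite ler_pM2r// ler_nat ltnW.
have := @cosint_lip R _ _ _ _ (2 ^+ n k)^-1 ABtau (thc (dig x)) (thc (cutoff M (dig x))).
rewrite -mulrBl -natrB ?(ltnW AB)//.
have bd r : r \in `[A%:R * tau, B%:R * tau] ->
    `|gpoly (gridpt (n k) y) r + al%:R * (pi / 2) + dot (gridpt (n k) z) (W (dig x) r) -
      (gpoly (gridpt (n k) y) r + al%:R * (pi / 2) + dot (gridpt (n k) z) (W (cutoff M (dig x)) r))|
    <= (2 ^+ n k)^-1.
  move=> _; rewrite opprD addrACA subrr add0r -dotBr.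
  have zk i : `|gridpt (n k) z 0 i| <= 2 ^+ k.+1 by exact: gridpt_norm.
  rewrite (le_trans (dot_le _ zk))//.
  have We : `|W (dig x) r - W (cutoff M (dig x)) r| <= e.
    apply: (@le_trans _ _ `|W (dig x) - W (cutoff M (dig x))|).
      exact: holder_norm_sup (W (dig x) - W (cutoff M (dig x))) r.
    rewrite /W opprD addrACA subrr add0r HM0// => p pM.
    by rewrite /cutoff (leq_trans pM)// leq_maxl.
  apply: (@le_trans _ _ (d.+1%:R * (2 ^+ k.+1 * e))).
    by rewrite ler_pM ?mulr_ge0 ?exprn_ge0// ?ler_nat// ler_wpM2l ?exprn_ge0.
  rewrite mulrA /e invfM mulrCA divff ?mulr1// mulf_neq0// ?expf_neq0//.
move=> /(_ bd); rewrite ler_distl => /andP[_]; move/le_trans; apply.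
by rewrite lerD2r.
Qed.

End good_events.

(** * Borel-Cantelli *)

Section almost_surely_good.
Context {R : realType}.
Variables (T delta : R) (d : nat).
Hypotheses (T0 : 0 < T) (delta01 : 0 <= delta <= 1).
Variables (n : nat -> nat) (C : R).
Hypothesis C0 : 0 < C.
Hypothesis nC : forall k, k.+1%:R ^+ 4 * (2 `^ delta) ^+ n k <= C * 2 ^+ k.
Hypothesis nk : forall k, (n k <= k ^ 2)%N.
Variable f : holder_path T delta d.

(** The union over all m is taken before the limit superior in k. This makes the threshold K uniform
    in m, hence in the size of the polynomial coefficients. *)
Lemma ae_good q : exists N : set (measurableTypeR R), [/\ measurable N,
  lebesgue_measure N = 0%E &
  forall x : R, 0 <= x < 1 -> ~ N x -> exists K, forall k m, (K <= k)%N ->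
    good T n (f + rpath d T0 delta01 n (dig x) : holder_path T delta d) q k m].
Proof.
have [k0 Hk0] := good_event T0 delta01 C0 nC nk f q.
have /choice[E HE] : forall km : nat * nat, exists E : set (measurableTypeR R),
    [/\ measurable E, (lebesgue_measure E <= (2^-1 ^+ (km.1 + km.2).+1)%:E)%E &
    (k0 <= km.1)%N -> forall x : R, 0 <= x < 1 -> ~ E x -> good T n
     (f + rpath d T0 delta01 n (dig x) : holder_path T delta d) q km.1 km.2].
  move=> [k m] /=; have [kk|kk] := leqP k0 k.
    by have [E [mE lE gE]] := Hk0 k m kk; exists E.
  by exists set0; split => //; rewrite measure0 lee_fin exprn_ge0// invr_ge0.
have Em k m : measurable (E (k, m)) by case: (HE (k, m)).
pose F k := \bigcup_m E (k, m).
have Fm k : measurable (F k) by exact: bigcup_measurable.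
have lF k : (lebesgue_measure (F k) <= (2 / (2 ^ k.+1)%:R)%:E)%E.
  apply: (le_trans (generalized_Boole_inequality _ (Em k) (Fm k))).
  have e0 : (0 : R) <= 2 / (2 ^ k.+1)%:R by rewrite divr_ge0.
  apply: le_trans (epsilon_trick0 xpredT e0).
  apply: lee_nneseries => // m _; have [_ le _] := HE (k, m).
  apply: (le_trans le); rewrite lee_fin /= le_eqVlt; apply/orP; left; apply/eqP.
  rewrite !natrX -addnS exprD exprVn exprVn; congr (_ * _).
  by rewrite exprS invfM mulrA divff ?mul1r.
exists (lim_sup_set F); split.
- by apply: bigcap_measurable => // k _; apply: bigcup_measurable => j _.
- apply: lim_sup_set_cvg0 => //.
  apply: (@le_lt_trans _ _ 2%:E); last exact: ltry.
  apply: (le_trans _ (epsilon_trick0 xpredT (ler0n R 2))).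
  by apply: lee_nneseries => // k _; exact: lF.
move=> x x01 /existsNP[K /not_implyP[_ nE]]; exists (maxn K k0) => k m.
rewrite geq_max => /andP[Kk kk]; have [_ _ g] := HE (k, m).
apply: g => // Ex; apply: nE; exists k => //; by exists m.
Qed.

End almost_surely_good.

(** * From the grid to all parameters *)

Section deterministic.
Context {R : realType}.

Lemma floor_abs_le (x : R) (G : nat) : `|x| <= G%:R -> (`|Num.floor x| <= G)%N.
Proof.
rewrite ler_norml => /andP[x1 x2].
have h1 : - (G%:Z) <= Num.floor x by rewrite floor_ge_int_tmp rmorphN.
have h2 : Num.floor x <= G%:Z.
  by rewrite -(ler_int R) (le_trans (floor_le_tmp _)).
lia.
Qed.

Lemma floor_abs_ge (x : R) (G : nat) : G%:R <= `|x| -> (G <= `|Num.floor x|)%N.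
Proof.
rewrite ler_normr => /orP[x1|x1].
  have h : G%:Z <= Num.floor x by rewrite floor_ge_int_tmp.
  lia.
have h : Num.floor x <= - G%:Z.
  rewrite -(ler_int R) (le_trans (floor_le_tmp _))// rmorphN/=; lra.
lia.
Qed.

Lemma floor_grid (x : R) (D : nat) : 
  `|x - (Num.floor (2 ^+ D * x))%:~R / 2 ^+ D| <= (2 ^+ D)^-1.
Proof.
have D0 : 0 < 2 ^+ D :> R by rewrite exprn_gt0.
have /andP[l u] := floor_itv (2 ^+ D * x).
set z : R := (Num.floor _)%:~R.
have -> : x - z / 2 ^+ D = (2 ^+ D * x - z) / 2 ^+ D by field; rewrite gt_eqF.
rewrite normrM normfV (ger0_norm (ltW D0)) ler_piMl ?invr_ge0 ?(ltW D0)//.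
by move: u; rewrite rmorphD/= => u; rewrite ger0_norm; lra.
Qed.

Lemma gpoly_le (q : nat) (eta : 'rV[R]_q) (e T r : R) :
  (forall i, `|eta 0 i| <= e) -> 0 <= r <= T ->
  `|gpoly eta r| <= e * \sum_(i < q) T ^+ i.+1.
Proof.
move=> etae /andP[r0 rT]; rewrite (le_trans (ler_norm_sum _ _ _))// mulr_sumr.
apply: ler_sum => i _; rewrite normrM ler_pM//.
by rewrite ger0_norm ?exprn_ge0// lerXn2r ?nnegrE// (le_trans r0).
Qed.

Lemma gpolyB (q : nat) (eta eta' : 'rV[R]_q) r :
  gpoly (eta - eta') r = gpoly eta r - gpoly eta' r.
Proof. by rewrite /gpoly -sumrB; apply: eq_bigr => i _; rewrite !mxE mulrBl. Qed.

Variables (T : R) (d : nat) (n : nat -> nat) (w : R -> 'rV[R]_d) (Bw : R).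
Hypothesis T0 : 0 < T.
Hypothesis wc : {within `[0, T], continuous w}.
Hypothesis wB : forall t, t \in `[0, T] -> `|w t| <= Bw.

(** Frequency, coefficients and endpoints are all rounded to the grid. The errors are of order 2^-(n
    k) in the phase and [mesh] in time, and both fit under a bound proportional to the square root
    of t - s. *)
Lemma cosint_good q k m (xi : 'rV[R]_d) (eta : 'rV[R]_q) (s t : R) (al : nat) :
  good T n w q k m -> (forall i, `|xi 0 i| <= 2 ^+ k.+1) ->
  (exists i, 2 ^+ k <= `|xi 0 i|) -> (forall i, `|eta 0 i| <= 2 ^+ m) ->
  0 <= s -> s < t -> t <= T -> t - s <= 1 -> (al < 4)%N ->
  cosint (fun r => gpoly eta r + al%:R * (pi / 2) + dot xi (w r)) s t <=
  Num.sqrt (t - s) * (Num.sqrt m.+1%:R * (4 * k.+1%:R ^+ 2 * Num.sqrt (mesh T n k) +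
    (1 + d%:R * Bw + \sum_(i < q) T ^+ i.+1) / 2 ^+ n k)).
Proof.
move=> gd xi1 [i0 xi2] eta1 s0 st tT ts1 al4.
set th := fun r => _; set tau := mesh T n k; set Dl := t - s.
pose N : R := 2 ^+ n k; have N0 : 0 < N by rewrite exprn_gt0.
have NE : (2 ^ n k)%:R = N by rewrite natrX.
have tau0 : 0 < tau by rewrite divr_gt0// NE.
have tauN : N * tau = T by rewrite /tau /mesh NE mulrC divfK// gt_eqF.
have T1 : 0 <= T by exact: ltW.
set G := \sum_(i < q) _.
have G0 : 0 <= G by apply: sumr_ge0 => i _; rewrite exprn_ge0.
have B0 : 0 <= Bw by rewrite (le_trans _ (wB (t := 0) _))// in_itv/= lexx.
have Dl0 : 0 < Dl by rewrite subr_gt0.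
set sD := Num.sqrt Dl; have sD0 : 0 <= sD by exact: sqrtr_ge0.
have sDD : sD * sD = Dl by rewrite -expr2 sqr_sqrtr// ltW.
have sD1 : sD <= 1 by rewrite -sqrtr1 ler_wsqrtr.
set st' := Num.sqrt tau; have st0 : 0 <= st' by exact: sqrtr_ge0.
have stt : st' * st' = tau by rewrite -expr2 sqr_sqrtr// ltW.
set sm := Num.sqrt m.+1%:R.
have sm1 : 1 <= sm by rewrite -{1}sqrtr1 ler_sqrt// ler1n.
set kk : R := k.+1%:R ^+ 2; have kk1 : 1 <= kk by rewrite exprn_ege1// ler1n.
set e1 := _ / 2 ^+ n k.
have e10 : 0 <= e1 by rewrite divr_ge0 ?exprn_ge0// !addr_ge0// mulr_ge0.
have thc a b : 0 <= a -> b <= T -> {within `[a, b], continuous th}.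
  move=> a0 bT; apply: (within_sub a0 bT); rewrite /th.
  apply: within_add; last exact: dot_cont.
  by apply: within_add; [exact: gpoly_cont|exact: within_cst].
have itv a r b : 0 <= a -> b <= T -> r \in `[a, b] -> r \in `[0, T].
  move=> a0 bT; rewrite !in_itv/= => /andP[ar rb].
  by rewrite (le_trans a0 ar) (le_trans rb bT).
(* A short interval may contain no full cell. Its length is then at most sD times twice the root of
   the mesh, so the trivial bound suffices. *)
have small_bound : Dl <= 2 * tau -> cosint th s t <=
    sD * (sm * (4 * kk * st' + e1)).
  move=> Dt; rewrite (le_trans (ler_norm _))// (le_trans (cosint_le _ _)) ?(ltW st)//.
    exact: thc.
  rewrite -/Dl -sDD ler_wpM2l//.
  have sDt : sD <= 2 * st'.
    rewrite -(@ler_pXn2r _ 2) ?nnegrE ?mulr_ge0// exprMn !expr2 sDD stt; lra.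
  rewrite (le_trans sDt)//.
  apply: (@le_trans _ _ (4 * kk * st' + e1)).
    by rewrite (@le_trans _ _ (4 * kk * st'))// ?lerDl// ler_wpM2r//; lra.
  by rewrite ler_peMl// addr_ge0// mulr_ge0// mulr_ge0//; lra.
(* The interval is rounded inwards; the two pieces cut off have total length at most 2 tau. *)
pose A := `|Num.ceil (s / tau)|%N; pose B := Num.truncn (t / tau).
have st_ge0 : 0 <= s / tau by rewrite divr_ge0// ltW.
have tt_ge0 : 0 <= t / tau by rewrite divr_ge0 ?(ltW tau0)// (le_trans s0)// ltW.
have AE : A%:R = (Num.ceil (s / tau))%:~R :> R.
  by rewrite /A natr_absz ger0_norm// ceil_ge0; lra.
have A1 : s <= A%:R * tau by rewrite AE -ler_pdivrMr// ceil_ge.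
have A2 : A%:R * tau < s + tau.
  have := ceilB1_lt (s / tau); rewrite rmorphB/= -AE => h.
  by rewrite -ltrBlDr -[X in _ - X < _]mul1r -mulrBl -ltr_pdivlMr.
have /andP[B1 B2] := truncn_itv tt_ge0; rewrite -/B in B1 B2.
have {}B1 : B%:R * tau <= t by rewrite -ler_pdivlMr.
have {}B2 : t < B%:R * tau + tau by rewrite -[X in _ + X]mul1r -mulrDl natr1 -ltr_pdivrMr.
have [AB|BA] := ltnP A B; last first.
  apply: small_bound; have : B%:R * tau <= A%:R * tau by rewrite ler_pM2r// ler_nat.
  rewrite /Dl; lra.
have BJ : (B <= 2 ^ n k)%N.
  by rewrite -(ler_nat R) NE -(ler_pM2r tau0) tauN (le_trans B1).
(* After scaling, the bounds on the coordinates are integers, so taking floors preserves both the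
   upper and the lower ones. *)
pose z i := Num.floor (2 ^+ n k * xi 0 i).
pose y i := Num.floor (2 ^+ n k * eta 0 i).
have nN (x : R) : `|2 ^+ n k * x| = 2 ^+ n k * `|x| by rewrite normrM ger0_norm// ltW.
have zG i : (`|z i| <= 2 ^ (k.+1 + n k))%N.
  by apply: floor_abs_le; rewrite nN natrX exprD mulrC ler_wpM2r// ltW.
have zi : exists i, (2 ^ (k + n k) <= `|z i|)%N.
  exists i0; apply: floor_abs_ge.
  by rewrite nN natrX exprD [leRHS]mulrC ler_wpM2r// ltW.
have yG i : (`|y i| <= 2 ^ (m + n k))%N.
  by apply: floor_abs_le; rewrite nN natrX exprD mulrC ler_wpM2r// ltW.
have := gd z y A B al zG zi yG AB BJ al4; rewrite -/tau.
set th' := fun r => _; set L : R := (B - A)%:R => Hgood.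
have Ltau : L * tau <= Dl.
  by rewrite /L natrB ?(ltnW AB)// mulrBl /Dl; lra.
have L0 : 0 <= L by [].
have At0 : 0 <= A%:R * tau by rewrite mulr_ge0// ltW.
have ABt : A%:R * tau <= B%:R * tau by rewrite ler_pM2r// ler_nat ltnW.
have BtT : B%:R * tau <= T by exact: le_trans tT.
have thc' : {within `[A%:R * tau, B%:R * tau], continuous th'}.
  apply: (within_sub At0 BtT); rewrite /th'.
  apply: within_add; last exact: dot_cont.
  by apply: within_add; [exact: gpoly_cont|exact: within_cst].
have phase_err r : r \in `[A%:R * tau, B%:R * tau] ->
    `|th r - th' r| <= (d%:R * Bw + G) / N.
  move=> rAB; have rT := itv _ _ _ At0 BtT rAB.
  have -> : th r - th' r = gpoly (eta - gridpt (n k) y) r + dot (xi - gridpt (n k) z) (w r).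
    by rewrite /th /th' gpolyB dotBl; ring.
  rewrite (le_trans (ler_normD _ _))// mulrDl addrC lerD//.
    apply: (le_trans (dot_le (M := N^-1) _ _)) => [i|].
      by rewrite !mxE floor_grid.
    by rewrite -mulrA ler_wpM2l// mulrC ler_wpM2r ?invr_ge0 ?(ltW N0)// wB.
  rewrite mulrC; apply: gpoly_le => [i|]; first by rewrite !mxE floor_grid.
  by move: rT; rewrite in_itv.
have H1 : cosint th (A%:R * tau) (B%:R * tau) <=
    2 * (lambda k m * tau * Num.sqrt L) + e1 * Dl.
  have := cosint_lip ABt (thc _ _ At0 BtT) thc' phase_err.
  rewrite -mulrBl -natrB ?(ltnW AB)// -/L ler_distl => /andP[_ h].
  rewrite (le_trans h)//.
  rewrite (le_trans (lerD Hgood (lexx _)))// -addrA lerD2l -mulrDl.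
  rewrite (_ : _ + _ = e1); last by rewrite /e1 -/N; ring.
  by rewrite ler_wpM2l.
have X0 : 0 <= sm * (kk * st').
  by rewrite (mulr_ge0 (le_trans ler01 sm1))// (mulr_ge0 (le_trans ler01 kk1)).
(* The square root of the length appears here: tau sqrt L = sqrt tau sqrt (L tau), and L tau is at
   most t - s. *)
have H2 : lambda k m * tau * Num.sqrt L <= sD * (sm * (kk * st')).
  have -> : lambda k m * tau * Num.sqrt L = sm * (kk * st') * (st' * Num.sqrt L).
    by rewrite /lambda -/sm -/kk -stt; ring.
  rewrite mulrC ler_wpM2r//.
  by rewrite /st' -sqrtrM ?(ltW tau0)// ler_wsqrtr// mulrC.
have H3 : cosint th s t <= cosint th (A%:R * tau) (B%:R * tau) + 2 * tau.
  rewrite (cosint_split A1 _ (thc _ _ s0 tT)); last exact: le_trans B1.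
  rewrite (cosint_split ABt B1 (thc _ _ At0 tT)).
  have a1 := cosint_le A1 (thc _ _ s0 (le_trans ABt BtT)).
  have a2 := cosint_le B1 (thc _ _ (le_trans At0 ABt) tT).
  move: a1 a2; rewrite !ler_norml => /andP[_ a1] /andP[_ a2].
  lra.
rewrite (le_trans H3)// (le_trans (lerD H1 (lexx _)))//.
have tD : tau <= Dl.
  rewrite (le_trans _ Ltau)// ler_peMl ?(ltW tau0)// /L ler1n subn_gt0//.
have stD : st' <= sD by rewrite ler_wsqrtr.
have h1 : 2 * tau <= sD * (sm * (2 * kk * st')).
  have Y : st' <= sm * (kk * st').
    by rewrite mulrA ler_peMl// -[leLHS]mulr1 ler_pM.
  have := ler_pM st0 st0 stD Y; rewrite stt.
  rewrite [in X in _ -> X](_ : sD * _ = 2 * (sD * (sm * (kk * st')))); first lra.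
  by ring.
have h2 : e1 * Dl <= sD * (sm * e1).
  rewrite -sDD mulrC -mulrA ler_wpM2l// ler_wpM2r//.
  exact: le_trans sm1.
rewrite [leRHS](_ : _ = 2 * (sD * (sm * (kk * st'))) + sD * (sm * e1) + sD * (sm * (2 * kk * st'))); last by ring.
lra.
Qed.

End deterministic.

(** * Decay at all large frequencies *)

Section strong_bound.
Context {R : realType}.

Lemma cmodE (a b : R) : cmod (a +i* b)%C = Num.sqrt (a ^+ 2 + b ^+ 2).
Proof. by []. Qed.

Lemma cmod_ge0 (z : R[i]) : 0 <= cmod z.
Proof. by case: z => a b; rewrite cmodE sqrtr_ge0. Qed.

Lemma cmod_le (a b : R) : cmod (a +i* b)%C <= `|a| + `|b|.
Proof.
rewrite cmodE -[leRHS](ger0_norm (addr_ge0 (normr_ge0 a) (normr_ge0 b))) -sqrtr_sqr.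
rewrite ler_wsqrtr// -(real_normK (num_real a)) -(real_normK (num_real b)).
by have := normr_ge0 a; have := normr_ge0 b; nra.
Qed.

Lemma cmod_re (a b : R) : `|a| <= cmod (a +i* b)%C.
Proof. by rewrite cmodE -sqrtr_sqr ler_wsqrtr// lerDl sqr_ge0. Qed.

Lemma cmod_im (a b : R) : `|b| <= cmod (a +i* b)%C.
Proof. by rewrite cmodE -sqrtr_sqr ler_wsqrtr// lerDr sqr_ge0. Qed.

Lemma cmod_cintC (h : R -> R[i]) s t : cmod (cint h s t) = cmod (cint h t s).
Proof.
have [->//|st] := eqVneq s t.
have E g : oint g s t = - oint g t s :> R.
  by rewrite /oint; case: (ltgtP s t) st => //= _ _; rewrite ?opprK.
by rewrite /cint !E !cmodE !sqrrN.
Qed.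

Lemma strong_quotientC d q rho (w : R -> 'rV[R]_d) xi (eta : 'rV[R]_q) s t :
  strong_quotient rho w xi eta s t = strong_quotient rho w xi eta t s.
Proof. by rewrite /strong_quotient cmod_cintC distrC. Qed.

Lemma cint_le (th : R -> R) s t : s <= t -> cint (fun r => expi (th r)) s t =
  (cosint th s t +i* \int[lebesgue_measure]_(r in `[s, t]) sin (th r))%C.
Proof. by move=> st; rewrite /cint /oint st. Qed.

Lemma cosD_quarter (x : R) (al : nat) : cos (x + al%:R * (pi / 2)) =
  match al with 0%N => cos x | 1%N => - sin x | 2%N => - cos x | 3%N => sin x
  | _ => cos (x + al%:R * (pi / 2)) end.
Proof.
case: al => [|[|[|[|//]]]].
- by rewrite mul0r addr0.
- by rewrite mul1r cosDpihalf.
- by rewrite (_ : _ + _ = x + pi) ?cosDpi//; field.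
- by rewrite (_ : _ + _ = x + pi / 2 + pi) ?cosDpi ?cosDpihalf ?opprK//; field.
Qed.

(** The four quarter turns bound both parts of the integral from above and from below, so V bounds
    each absolute value. *)
Lemma cmod_cint_le (th : R -> R) s t V : s <= t ->
  {within `[s, t], continuous th} ->
  (forall al : nat, (al < 4)%N -> cosint (fun r => th r + al%:R * (pi / 2)) s t <= V) ->
  cmod (cint (fun r => expi (th r)) s t) <= 2 * V.
Proof.
move=> st thc H; rewrite cint_le// (le_trans (cmod_le _ _))// mulrDl mul1r.
have N g : {within `[s, t], continuous g} ->
    \int[lebesgue_measure]_(r in `[s, t]) (- g r) =
    - \int[lebesgue_measure]_(r in `[s, t]) g r :> R.
  move=> gc; rewrite -mulN1r -Rintegral_withinZ//.
  by apply: eq_Rintegral_itv => r _; rewrite mulN1r.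
have := H 0%N isT; have := H 1%N isT; have := H 2%N isT; have := H 3%N isT.
rewrite /cosint !(eq_Rintegral_itv (fun r _ => cosD_quarter (th r) _)).
rewrite (N _ (within_cos thc)) (N _ (within_sin thc)).
by move=> ? ? ? ?; rewrite lerD// ler_norml; lra.
Qed.

Lemma dyadic_between (X : R) : 1 <= X -> exists k : nat, 2 ^+ k <= X < 2 ^+ k.+1.
Proof.
move=> X1; have X0 : 0 <= X by lra.
have /andP[l u] := truncn_itv X0; set N := Num.truncn X in l u.
have N0 : (0 < N)%N by rewrite truncn_gt0.
exists (trunc_log 2 N); apply/andP; split.
  by rewrite (le_trans _ l)// -natrX ler_nat trunc_logP.
by rewrite (lt_le_trans u)// -natrX ler_nat trunc_log_ltn.
Qed.

(** Converts the dyadic size m of the coefficients into the logarithm log (2 + |eta|) of the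
    definition. *)
Lemma dyadic_above (y : R) : 0 <= y ->
  exists m : nat, y <= 2 ^+ m /\ m.+1%:R * ln 2 <= 3 * ln (2 + y).
Proof.
move=> y0; have l2 : 0 < ln 2 :> R by rewrite ln_gt0//; lra.
have L : ln 2 <= ln (2 + y) by rewrite ler_ln ?posrE; lra.
have [y1|y1] := lerP y 1.
  by exists 0%N; rewrite expr0 y1; split => //; lra.
have [m /andP[m1 m2]] := dyadic_between (ltW y1).
exists m.+1; split; first exact: ltW.
have : m%:R * ln 2 <= ln (2 + y).
  by rewrite mulr_natl -lnXn// ler_ln ?posrE ?exprn_gt0//; lra.
rewrite -[m.+2%:R]natr1 -[m.+1%:R]natr1; lra.
Qed.

Lemma enorm_ge_coord p (x : 'rV[R]_p) i : `|x 0 i| <= enorm x.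
Proof.
rewrite /enorm -sqrtr_sqr ler_wsqrtr// /dot (bigD1 i)//= expr2 lerDl.
by apply: sumr_ge0 => j _; rewrite -expr2 sqr_ge0.
Qed.

Lemma enorm_le_norm p (x : 'rV[R]_p) : enorm x <= p%:R * `|x|.
Proof.
have p0 : 0 <= p%:R * `|x| by rewrite mulr_ge0.
rewrite /enorm -[leRHS](ger0_norm p0) -sqrtr_sqr ler_wsqrtr// /dot.
apply: (@le_trans _ _ (\sum_(i < p) `|x| ^+ 2)).
  apply: ler_sum => i _; rewrite -expr2 -(real_normK (num_real (x 0 i))).
  by rewrite lerXn2r ?nnegrE// coord_norm_le.
rewrite sumr_const card_ord exprMn -[leLHS]mulr_natl ler_wpM2r ?sqr_ge0//.
by rewrite -natrX ler_nat; case: p {x p0} => // p; rewrite expnS expn1 leq_pmulr.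
Qed.

Lemma enorm_ge0 p (x : 'rV[R]_p) : 0 <= enorm x.
Proof. exact: sqrtr_ge0. Qed.

Lemma norm_attained p (x : 'rV[R]_p) : 0 < `|x| -> exists i, `|x| = `|x 0 i|.
Proof.
move=> x0; have /mx_norm_neq0[[a i] /= E] : mx_norm x != 0 by rewrite gt_eqF.
by exists i; rewrite -(ord1 a).
Qed.

Variables (T : R) (d : nat) (n : nat -> nat) (w : R -> 'rV[R]_d) (Bw : R).
Hypothesis T0 : 0 < T.
Hypothesis wc : {within `[0, T], continuous w}.
Hypothesis wB : forall t, t \in `[0, T] -> `|w t| <= Bw.

Let th q (xi : 'rV[R]_d) (eta : 'rV[R]_q) r := dot xi (w r) + gpoly eta r.

Let thc q (xi : 'rV[R]_d) (eta : 'rV[R]_q) s t : 0 <= s -> t <= T ->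
  {within `[s, t], continuous (th xi eta)}.
Proof.
move=> s0 tT; apply: (within_sub s0 tT); apply: within_add; last exact: gpoly_cont.
exact: dot_cont.
Qed.

(** The decay at level k is (k + 1)^2 2^-(n k / 2), to be compared with 2^(rho k); the hypothesis on
    [n] is the square of this comparison, whence 4^rho and the fourth power. The level is chosen by
    the sup norm of xi, and passing to the Euclidean norm costs a power of d. *)
Lemma good_decay q rho k0 K : 0 <= rho ->
  (forall k, (k0 <= k)%N -> (4 `^ rho) ^+ k * k.+1%:R ^+ 4 <= 2 * 2 ^+ n k) ->
  (forall k m, (K <= k)%N -> good T n w q k m) ->
  exists2 C, 0 <= C & forall (xi : 'rV[R]_d) (eta : 'rV[R]_q) s t, 2 <= enorm xi ->
    0 <= s -> s < t -> t <= T -> t - s <= 1 / 2 ->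
    cmod (cint (fun r => expi (dot xi (w r) + gpoly eta r)) s t) * enorm xi `^ rho <=
    C * (Num.sqrt (t - s) * Num.sqrt (ln (2 + enorm eta))).
Proof.
move=> rho0 Hn Hg; pose k1 := maxn K k0.
have l2 : 0 < ln 2 :> R by rewrite ln_gt0//; lra.
pose sl := Num.sqrt (ln 2 : R); have sl0 : 0 < sl by rewrite sqrtr_gt0.
pose G : R := \sum_(i < q) T ^+ i.+1.
have T1 : 0 <= T by exact: ltW.
have G0 : 0 <= G by apply: sumr_ge0 => i _; rewrite exprn_ge0.
have B0 : 0 <= Bw by rewrite (le_trans _ (wB (t := 0) _))// in_itv/= lexx.
pose D : R := 1 + d%:R * Bw + G.
have D0 : 0 <= D by rewrite !addr_ge0// mulr_ge0.
pose C1 : R := 2 * (d%:R * 2 ^+ k1) `^ rho / sl.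
pose C2 : R := 2 * (8 * Num.sqrt T + 2 * D) * ((d%:R * 2) `^ rho * (Num.sqrt 3 / sl)).
have C10 : 0 <= C1 by rewrite divr_ge0 ?mulr_ge0 ?powR_ge0// ltW.
have C20 : 0 <= C2.
  by rewrite !mulr_ge0 ?addr_ge0 ?mulr_ge0 ?powR_ge0 ?sqrtr_ge0// invr_ge0 ltW.
exists (C1 + C2) => [|xi eta s t xi2 s0 st tT ts]; first exact: addr_ge0.
set sD := Num.sqrt (t - s); set L := ln (2 + enorm eta); set sL := Num.sqrt L.
have sD0 : 0 <= sD by exact: sqrtr_ge0.
have sL0 : 0 <= sL by exact: sqrtr_ge0.
have lL : ln 2 <= L by rewrite ler_ln ?posrE//; have := enorm_ge0 eta; lra.
have slL : sl <= sL by rewrite ler_wsqrtr.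
have sDD : sD * sD = t - s by rewrite -expr2 sqr_sqrtr// subr_ge0 ltW.
have sD1 : sD <= 1 by rewrite -sqrtr1 ler_wsqrtr//; lra.
have xn := enorm_le_norm xi.
have thst := @thc q xi eta s t s0 tT.
have thal al : {within `[s, t], continuous (fun r => th xi eta r + al%:R * (pi / 2))}.
  by apply: within_add => //; exact: within_cst.
have rest : 0 <= sD * sL by exact: mulr_ge0.
rewrite mulrDl.
(* Below the threshold of the almost sure statement the weight is bounded, and t - s <= sqrt (t - s)
   suffices. *)
have [Xk|Xk] := ltrP `|xi| (2 ^+ k1).
  have b1 : cmod (cint (fun r => expi (th xi eta r)) s t) <= 2 * sD.
    apply: cmod_cint_le => //; first exact: ltW.
    move=> al _; rewrite (le_trans (ler_norm _))// (le_trans (cosint_le (ltW st) (thal al)))//.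
    by rewrite -sDD ler_piMr.
  have b2 : enorm xi `^ rho <= (d%:R * 2 ^+ k1) `^ rho.
    rewrite ge0_ler_powR ?nnegrE ?enorm_ge0 ?mulr_ge0 ?exprn_ge0//.
    by rewrite (le_trans xn)// ler_wpM2l// ltW.
  apply: (@le_trans _ _ (C1 * (sD * sL))); last by rewrite lerDl mulr_ge0.
  apply: (le_trans (ler_pM (cmod_ge0 _) (powR_ge0 _ _) b1 b2)).
  rewrite [leRHS](_ : _ = 2 * sD * (d%:R * 2 ^+ k1) `^ rho * (sL / sl)); last first.
    by rewrite /C1; ring.
  by rewrite ler_peMr ?mulr_ge0 ?powR_ge0// ler_pdivlMr// mul1r.
have X1 : 1 <= `|xi| by rewrite (le_trans _ Xk)// exprn_ege1//; lra.
have [k /andP[k2 k3]] := dyadic_between X1.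
have kk1 : (k1 <= k)%N.
  rewrite -ltnS -(@ltr_eXn2l R 2) ?ltr1n//; exact: le_lt_trans k3.
have kK : (K <= k)%N by rewrite (leq_trans _ kk1)// leq_maxl.
have kk0 : (k0 <= k)%N by rewrite (leq_trans _ kk1)// leq_maxr.
have [i0 xi0] := norm_attained (lt_le_trans ltr01 X1).
have [m [m1 m2]] := dyadic_above (enorm_ge0 eta).
pose sm : R := Num.sqrt m.+1%:R.
have sm0 : 0 <= sm by exact: sqrtr_ge0.
pose N : R := 2 ^+ n k; have N0 : 0 < N by rewrite exprn_gt0.
have N1 : 1 <= N by rewrite exprn_ege1//; lra.
pose sN := Num.sqrt N; have sN0 : 0 < sN by rewrite sqrtr_gt0.
have sNN : sN * sN = N by rewrite -expr2 sqr_sqrtr// ltW.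
have sN1 : 1 <= sN by rewrite -sqrtr1 ler_wsqrtr.
pose V : R := sD * (sm * (4 * k.+1%:R ^+ 2 * Num.sqrt (mesh T n k) + D / N)).
have b1 : cmod (cint (fun r => expi (th xi eta r)) s t) <= 2 * V.
  apply: cmod_cint_le => //; first exact: ltW.
  move=> al al4.
  have := cosint_good T0 wc wB (Hg k m kK) _ _ _ s0 st tT _ al4.
  move=> /(_ xi eta); rewrite -/G -/D -/N -/sD -/sm -/V => H.
  apply: le_trans (H _ _ _ _).
  - rewrite le_eqVlt; apply/orP; left; apply/eqP; apply: eq_cosint => r _.
    by rewrite /th; ring.
  - by move=> i; rewrite (le_trans (coord_norm_le _ _))// ltW.
  - by exists i0; rewrite -xi0.
  - by move=> i; rewrite (le_trans (enorm_ge_coord _ _)).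
  - lra.
pose u : R := (2 `^ rho) ^+ k.
have u0 : 0 <= u by rewrite exprn_ge0// powR_ge0.
have uk : u * k.+1%:R ^+ 2 <= 2 * sN.
  have := Hn k kk0; rewrite -/N => H.
  rewrite -(@ler_pXn2r _ 2) ?nnegrE ?mulr_ge0 ?exprn_ge0 ?(ltW sN0)//.
  rewrite [leRHS]exprMn [sN ^+ 2]expr2 sNN exprMn -(exprM k.+1%:R).
  have -> : u ^+ 2 = (4 `^ rho) ^+ k.
    rewrite /u exprAC (_ : (2 `^ rho) ^+ 2 = 4 `^ rho)//.
    by rewrite powRXn//; congr (_ `^ _); rewrite expr2; lra.
  by rewrite (le_trans H)// ler_wpM2r ?(ltW N0)//; lra.
have b2 : enorm xi `^ rho <= (d%:R * 2) `^ rho * u.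
  rewrite /u powRXn// -powRM ?mulr_ge0 ?exprn_ge0//.
  rewrite ge0_ler_powR ?nnegrE ?enorm_ge0 ?mulr_ge0 ?exprn_ge0//.
  by rewrite (le_trans xn)// -mulrA -exprS ler_wpM2l// ltW.
have kk : 1 <= k.+1%:R ^+ 2 :> R by rewrite exprn_ege1// ler1n.
have uN : u / N <= 2.
  rewrite ler_pdivrMr//; apply: (@le_trans _ _ (u * k.+1%:R ^+ 2)); first by rewrite ler_peMr.
  by rewrite (le_trans uk)// ler_wpM2l// -sNN ler_peMl// ltW.
have sqm : Num.sqrt (mesh T n k) = Num.sqrt T / sN.
  rewrite /mesh natrX -/N sqrtrM// sqrtrV//.
  by rewrite ltW.
have main : (4 * k.+1%:R ^+ 2 * Num.sqrt (mesh T n k) + D / N) * u <= 8 * Num.sqrt T + 2 * D.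
  rewrite mulrDl lerD//; last first.
    by rewrite -mulrA mulrC ler_wpM2r// mulrC.
  rewrite sqm [leLHS](_ : _ = 4 * Num.sqrt T * ((u * k.+1%:R ^+ 2) / sN)); last by ring.
  rewrite [leRHS](_ : _ = 4 * Num.sqrt T * 2); last by ring.
  by rewrite ler_wpM2l ?mulr_ge0 ?sqrtr_ge0// ler_pdivrMr.
have smL : sm <= Num.sqrt 3 / sl * sL.
  rewrite /sm mulrAC ler_pdivlMr// /sl -sqrtrM// -sqrtrM// ler_wsqrtr//.
have V0 : 0 <= 2 * V by exact: le_trans (cmod_ge0 _) b1.
apply: (@le_trans _ _ (C2 * (sD * sL))); last by rewrite lerDr mulr_ge0.
apply: (le_trans (ler_pM (cmod_ge0 _) (powR_ge0 _ _) b1 b2)).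
rewrite [leLHS](_ : _ = 2 * (sD * (d%:R * 2) `^ rho) * (sm *
  ((4 * k.+1%:R ^+ 2 * Num.sqrt (mesh T n k) + D / N) * u))); last by rewrite /V; ring.
rewrite [leRHS](_ : _ = 2 * (sD * (d%:R * 2) `^ rho) * ((Num.sqrt 3 / sl * sL) *
  (8 * Num.sqrt T + 2 * D))); last by rewrite /C2; ring.
rewrite ler_wpM2l ?mulr_ge0 ?powR_ge0// ler_pM//.
by rewrite mulr_ge0// addr_ge0 ?divr_ge0 ?(ltW N0)// !mulr_ge0 ?exprn_ge0 ?sqrtr_ge0.
Qed.

(** On the range considered both ln |xi| and |ln |t - s|| are at least ln 2, so introducing their
    square roots into the quotient costs the factor 1 / ln 2. *)
Lemma good_strong q rho k0 K : 0 <= rho ->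
  (forall k, (k0 <= k)%N -> (4 `^ rho) ^+ k * k.+1%:R ^+ 4 <= 2 * 2 ^+ n k) ->
  (forall k m, (K <= k)%N -> good T n w q k m) ->
  exists C : R, forall (xi : 'rV[R]_d) (eta : 'rV[R]_q) s t, 2 <= enorm xi ->
    s \in `[0, T] -> t \in `[0, T] -> s != t -> `|t - s| <= 1 / 2 ->
    strong_quotient rho w xi eta s t <= C.
Proof.
move=> rho0 Hn Hg; have [C C0 HC] := good_decay rho0 Hn Hg.
have l2 : 0 < ln 2 :> R by rewrite ln_gt0//; lra.
exists (C / ln 2) => xi eta s t xi2.
wlog st : s t / s < t.
  move=> W sT tT; case: (ltgtP s t) => // st _ ts; first by apply: W => //; rewrite lt_eqF.
  rewrite strong_quotientC.
  by apply: W => //; rewrite ?lt_eqF// distrC.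
rewrite !in_itv/= => /andP[s0 _] /andP[_ tT] _; rewrite gtr0_norm ?subr_gt0// => ts.
have := HC xi eta s t xi2 s0 st tT ts.
rewrite /strong_quotient /Fweight (gtr0_norm (x := t - s)) ?subr_gt0//.
set c := cmod _; set a := _ `^ rho; set sD := Num.sqrt (t - s) => H.
set sL := Num.sqrt (ln (2 + _)) in H *; set sx := Num.sqrt (ln (enorm xi)).
have D0 : 0 < t - s by rewrite subr_gt0.
have sL0 : 0 < sL.
  by rewrite sqrtr_gt0 ln_gt0//; have := enorm_ge0 eta; lra.
have sD0 : 0 < sD by rewrite sqrtr_gt0.
pose sl := Num.sqrt (ln 2 : R); have sl0 : 0 < sl by rewrite sqrtr_gt0.
have sx0 : sl <= sx by rewrite ler_wsqrtr// ler_ln ?posrE//; lra.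
have psi : sD * sl <= psi0 (t - s).
  rewrite /sD /sl -sqrtrM ?(ltW D0)// ler_wsqrtr// ler_wpM2l ?(ltW D0)//.
  rewrite -[ln 2]opprK -lnV ?posrE// ler_normr; apply/orP; right.
  by rewrite lerN2 ler_ln ?posrE ?invr_gt0//; lra.
have sx1 : 0 < sx by exact: lt_le_trans sx0.
have psi1 : 0 < psi0 (t - s) by rewrite (lt_le_trans _ psi)// mulr_gt0.
rewrite ler_pdivrMr ?mulr_gt0// mulrA ler_pdivrMr// (le_trans H)//.
have sll : sl * sl = ln 2 by rewrite -expr2 sqr_sqrtr// ltW.
rewrite -sll [leRHS](_ : _ = C * (sL * ((psi0 (t - s) / sl) * (sx / sl)))); last first.
  by field; rewrite gt_eqF.
rewrite ler_wpM2l// mulrC ler_wpM2l ?(ltW sL0)// -[leLHS]mulr1 ler_pM ?(ltW sD0)//.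
  by rewrite ler_pdivlMr.
by rewrite ler_pdivlMr// mul1r.
Qed.

End strong_bound.

(** * Prevalence from a random element *)

Section image_measure.
Context {R : realType}.

Lemma pushforward_restr d1 d2 (T1 : measurableType d1) (T2 : measurableType d2)
    (m : {measure set T1 -> \bar R}) (D : set T1) (f : T1 -> T2) :
  measurable D -> measurable_fun setT f ->
  exists nu : {measure set T2 -> \bar R}, forall A, nu A = m (f @^-1` A `&` D).
Proof.
move=> mD mf.
by exists (measure_function_pushforward__canonical__measure_function_Measure (mrestr m mD) mf).
Qed.

Definition bits (b : cantor_space) : signs := fun p => Some (b p).

Lemma cantor_cylinder (b : cantor_space) (M : nat) :
  nbhs b [set b' | forall p, (p < M)%N -> b' p = b p].
Proof.
elim: M => [|M IH]; first by apply: filterS filterT.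
have h : nbhs b [set b' : cantor_space | b' M = b M].
  have /(_ [set b M]) := @proj_continuous _ (fun _ : nat => bool) M b.
  by apply; exact: discrete_set1.
apply: filterS2 IH h => b' h1 h2 p; rewrite ltnS leq_eqVlt => /predU1P[->//|].
exact: h1.
Qed.

End image_measure.

Section random_element.
Context {R : realType} {E : completeNormedModType R}.
Variable W : signs -> E.
Hypothesis W_unif : forall e : R, 0 < e -> exists M, forall c c',
  (forall p, (p < M)%N -> c p = c' p) -> `|W c - W c'| <= e.

Local Notation TR := (measurableTypeR R).

(** Total on the line, so that its law is an ordinary image measure, taken under Lebesgue measure
    restricted to [0, 1). *)
Definition sample (x : R) : E := W (dig (if 0 <= x < 1 then x else 0)).

(** The digits of a number are never [None], so every sample lies in this image of the Cantor space;
    it is the compact set that the transverse measure charges. *)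
Lemma compact_range : compact [set W (bits b) | b in [set: cantor_space]].
Proof.
apply: continuous_compact; last exact: cantor_space_compact.
apply: continuous_subspaceT => b; apply/cvgrPdist_le => e e0.
have [M HM] := W_unif e0; apply: filterS (cantor_cylinder b M) => b' bb'.
by apply: HM => p pM; rewrite /bits bb'.
Qed.

(** Since U is open and W is uniformly continuous in the digits, membership is guaranteed by
    finitely many digits; the preimage is a countable union of digit events. *)
Lemma measurable_sample_open (v : E) (U : set E) : open U ->
  measurable [set x : TR | (0 <= x < 1) /\ U (v + W (dig x))].
Proof.
move=> oU; pose P M (c : signs) := forall c' : signs,
  (forall p, (p < M)%N -> c' p = c p) -> U (v + W c').
rewrite (_ : mkset _ = \bigcup_M [set x : TR | (0 <= x < 1) /\ P M (cutoff M (dig x))]).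
  by apply: bigcup_measurable => M _; exact: measurable_dig.
apply/seteqP; split => [x [x01 Ux]|x [M _ [x01 PM]]]; last first.
  by split => //; apply: PM => p pM; rewrite /cutoff pM.
have /nbhs_ballP[e /= e0 eU] : nbhs (v + W (dig x)) U by exact: open_nbhs_nbhs.
have e20 : 0 < e / 2 by rewrite divr_gt0.
have [M HM] := W_unif e20; exists M => //; split => // c' cc'.
apply: eU; rewrite -ball_normE /= opprD addrACA subrr add0r.
rewrite (le_lt_trans (HM _ _ _))//; last by rewrite ltr_pdivrMr// ltr_pMr// ltr1n.
by move=> p pM; rewrite cc'// /cutoff pM.
Qed.

Lemma measurable_sample (v : E) :
  @measurable_fun _ _ TR (g_sigma_algebraType (@open E)) setT (fun x => v + sample x).
Proof.
apply: (@measurability _ _ _ (g_sigma_algebraType (@open E)) _ _ (@open E)) => //.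
move=> _ [U oU <-]; rewrite setTI.
pose I : set TR := [set` `[(0 : R), 1[]; have mI : measurable I by exact: measurable_itv.
have -> : ((fun x => v + sample x) : TR -> E) @^-1` U =
    [set x : TR | ((0 : R) <= x < 1) /\ U (v + W (dig x))] `|`
    (~` I `&` [set x : TR | U (v + W (dig (0 : R)))]).
  apply/seteqP; split => x; rewrite /sample /I /= in_itv/=.
    by case: ifPn => x01 Ux; [left|right].
  by move=> [[x01]|[/negP/negbTE x01]]; rewrite x01.
apply: measurableU; first exact: (measurable_sample_open v oU).
apply: measurableI; first exact: measurableC.
have [h|h] := pselect (U (v + W (dig (0 : R)))).
  have -> : [set x : TR | U (v + W (dig (0 : R)))] = setT by apply/seteqP; split.
  exact: measurableT.
have -> : [set x : TR | U (v + W (dig (0 : R)))] = set0 by apply/seteqP; split.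
exact: measurable0.
Qed.

(** The law of the sample is the transverse measure: it charges v + A exactly as often as the sample
    shifted by -v falls in A. *)
Lemma sample_prevalent (A : set E) : borel_set A ->
  (forall v : E, exists N : set TR, [/\ measurable N, lebesgue_measure N = 0%E &
     forall x : R, 0 <= x < 1 -> ~ N x -> ~ A (v + sample x)]) ->
  borel_shy A.
Proof.
move=> bA HA; split => //.
pose I : set TR := [set` `[(0 : R), 1[]; have mI : measurable I by exact: measurable_itv.
have W0 : (fun x => 0 + sample x) = sample by apply/funext => x; rewrite add0r.
have ms := measurable_sample 0; rewrite W0 in ms.
have [mu Hmu] := pushforward_restr lebesgue_measure mI ms.
exists mu; split.
  exists [set W (bits b) | b in [set: cantor_space]]; split; first exact: compact_range.
  rewrite Hmu (_ : _ `&` _ = I); last first.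
    apply/seteqP; split => [x []//|x Ix]; split => //.
    by exists (fun p => odd (Num.truncn (2 ^+ p.+1 * (if 0 <= x < 1 then x else 0)))).
  have lI : lebesgue_measure I = 1%E.
    by apply: (etrans (lebesgue_measure_itv _)) => /=; rewrite lte_fin ltr01 sube0.
  have : (0 < 1 :> \bar R)%E && (1 < +oo :> \bar R)%E by rewrite lte01 ltry.
  by rewrite -lI.
move=> v; rewrite Hmu.
have [N [mN N0 HN]] := HA (- v).
rewrite (_ : _ @^-1` _ = (fun x => - v + sample x) @^-1` A); last first.
  apply/seteqP; split => x /=.
    by move=> [a Aa <-]; rewrite addrA addNr add0r.
  by move=> Aa; exists (- v + sample x) => //; rewrite addrA subrr add0r.
apply/eqP; rewrite eq_le measure_ge0 andbT -N0; apply: le_measure.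
- rewrite inE; apply: measurableI => //.
  by rewrite -[X in measurable X]setTI; apply: (measurable_sample (- v)).
- by rewrite inE.
- move=> x [/= Ax]; rewrite /I/= in_itv/= => x01.
  by apply: contrapT => Nx; exact: (HN x x01 Nx).
Qed.

End random_element.

(** * Closed sets of paths with a fixed decay bound *)

Section decay_sets.
Context {R : realType}.

Lemma lipschitz_continuous (V : normedModType R) (h : V -> R) (L : R) : 0 <= L ->
  (forall x y, `|h x - h y| <= L * `|x - y|) -> continuous h.
Proof.
move=> L0 hL x; apply/cvgrPdist_le => e e0.
have L1 : 0 < L + 1 by lra.
have : \forall y \near x, `|x - y| <= e / (L + 1).
  by apply/nbhs_normP; exists (e / (L + 1)); rewrite /= ?divr_gt0// => z /ltW.
apply: filterS => y; rewrite ler_pdivlMr// => xy; rewrite (le_trans (hL x y))//.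
by rewrite (le_trans _ xy)// mulrC ler_wpM2l//; lra.
Qed.

Lemma continuous_modulus (V : topologicalType) (f g : V -> R) (K : R) :
  continuous f -> continuous g ->
  continuous (fun v => Num.sqrt (f v * f v + g v * g v) * K).
Proof.
move=> fc gc v; apply: cvgMr_tmp.
apply: (@continuous_comp _ _ _ (fun v => f v * f v + g v * g v) Num.sqrt).
  by apply: cvgD; apply: cvgM; [exact: fc|exact: fc|exact: gc|exact: gc].
exact: sqrt_continuous.
Qed.

Variables (T delta : R) (d q : nat).
Implicit Types (phi : holder_path T delta d) (xi : 'rV[R]_d) (eta : 'rV[R]_q).

Lemma phase_cont phi xi eta (c s t : R) : 0 <= s -> t <= T ->
  {within `[s, t], continuous (fun r => dot xi (phi r) + gpoly eta r + c)}.
Proof.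
move=> s0 tT; apply: within_add; last exact: within_cst.
apply: within_add; last exact: gpoly_cont.
by apply: (within_sub s0 tT); apply: dot_cont; exact: holder_path_cont.
Qed.

Lemma cosint_path_continuous xi eta (c s t : R) : 0 <= s -> s <= t -> t <= T ->
  continuous (fun phi => cosint (fun r => dot xi (phi r) + gpoly eta r + c) s t).
Proof.
move=> s0 st tT.
apply: (@lipschitz_continuous _ _ (d%:R * `|xi| * (t - s))).
  by rewrite mulr_ge0 ?subr_ge0// mulr_ge0.
move=> phi phi'; rewrite mulrAC.
apply: cosint_lip => //; [exact: phase_cont..|move=> r _].
rewrite (_ : _ - _ = dot xi (phi r - phi' r)); last by rewrite dotBr; ring.
rewrite (le_trans (dot_le _ (fun i => coord_norm_le xi i)))// -mulrA.
by rewrite !ler_wpM2l//; exact: (holder_norm_sup (phi - phi') r).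
Qed.

Lemma quotient_continuous rho xi eta (s t : R) : 0 <= s -> s <= t -> t <= T ->
  continuous (fun phi => strong_quotient rho phi xi eta s t).
Proof.
move=> s0 st tT.
pose F c phi := cosint (fun r => dot xi (phi r) + gpoly eta r + c) s t.
pose K := Fweight rho xi / (Num.sqrt (ln (2 + enorm eta)) * psi0 `|t - s|).
have Fc c : continuous (F c) by exact: cosint_path_continuous.
rewrite (_ : (fun phi => _) = fun phi => Num.sqrt (F 0 phi * F 0 phi +
    F (- (pi / 2)) phi * F (- (pi / 2)) phi) * K); first exact: continuous_modulus.
apply/funext => phi; rewrite /strong_quotient cint_le// cmodE /= -mulrA -!expr2.
congr (Num.sqrt (_ ^+ 2 + _ ^+ 2) * _).
  by apply: eq_cosint => r _; rewrite addr0.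
by apply: eq_Rintegral_itv => r _; rewrite cosBpihalf.
Qed.

(** With M fixed this is an intersection of closed conditions over uncountably many parameters,
    hence closed. Countable unions over M and intersections over exponents and degrees then stay
    Borel. *)
Definition decay_set rho (M : R) : set (holder_path T delta d) :=
  [set phi | forall xi eta s t, 2 <= enorm xi -> 0 <= s -> s < t -> t <= T ->
     t - s <= 1 / 2 -> strong_quotient rho phi xi eta s t <= M].

Lemma closed_decay_set rho M : closed (decay_set rho M).
Proof.
rewrite (_ : decay_set rho M = \bigcap_(p in [set p : ('rV[R]_d * 'rV[R]_q) * (R * R) |
    [/\ 2 <= enorm p.1.1, 0 <= p.2.1, p.2.1 < p.2.2, p.2.2 <= T & p.2.2 - p.2.1 <= 1 / 2]])
    (fun phi => strong_quotient rho phi p.1.1 p.1.2 p.2.1 p.2.2) @^-1` [set x | x <= M]).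
  apply: closed_bigI => -[[xi eta] [s t]] /= [_ s0 st tT _].
  apply: preimage_closed; last exact: closed_le.
  by move=> phi _; apply: quotient_continuous => //; exact: ltW.
apply/seteqP; split => [phi H [[xi eta] [s t]] /= [*]|phi H xi eta s t *]; first exact: H.
by apply: (H ((xi, eta), (s, t))).
Qed.

Lemma decay_set_strong phi rho rho' M : rho <= rho' -> decay_set rho' M phi ->
  (ereal_sup [set z%:E | z in strong_quotients q T rho phi] < +oo)%E.
Proof.
move=> rr H; apply: (@le_lt_trans _ _ M%:E); last exact: ltry.
apply: ge_ereal_sup => _ [z [xi [eta [s [t [xi2 [sT tT] st ts ->]]]]] <-].
rewrite lee_fin.
have xi1 : 1 <= enorm xi by lra.
have mono : strong_quotient rho phi xi eta s t <= strong_quotient rho' phi xi eta s t.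
  rewrite /strong_quotient ler_wpM2r ?invr_ge0 ?mulr_ge0 ?sqrtr_ge0// ler_wpM2l ?cmod_ge0//.
  by rewrite /Fweight ler_wpM2r ?invr_ge0 ?sqrtr_ge0// ler_powR.
rewrite (le_trans mono)// {mono}.
move: sT tT; rewrite !in_itv/= => /andP[s0 sT] /andP[t0 tT].
case: (ltgtP s t) st => // st _.
  by apply: H => //; move: ts; rewrite gtr0_norm ?subr_gt0.
rewrite strong_quotientC; apply: H => //.
by move: ts; rewrite distrC gtr0_norm ?subr_gt0.
Qed.

End decay_sets.

(** * Strong irregularity of almost every path *)

Section part_two.
Context {R : realType}.

Lemma strongly_irregular_prevalent (d : nat) (T delta : R) : 0 < T -> 0 <= delta < 1 ->
  almost_every (holder_path T delta d) (fun phi =>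
    forall rho : R, (rho%:E < ((2 * delta)%:E)^-1)%E -> strongly_irregular T rho phi).
Proof.
move=> T0 /andP[d0 d1].
have delta01 : 0 <= delta <= 1 by rewrite d0 ltW.
have [n [C [C0 nk nC nb]]] := level_seq delta01.
pose E := holder_path T delta d.
pose W (c : signs) : E := rpath d T0 delta01 n c.
have Wu := rpath_unif d T0 delta01 C0 nC.
(* A sequence of admissible exponents tending to 1 / (2 delta), and to infinity when delta = 0, by
   the same formula. *)
pose rho_ (j : nat) : R := j%:R / (2 * delta * j%:R + 1).
have den j : 0 < 2 * delta * j%:R + 1 by rewrite ltr_wpDl// !mulr_ge0.
pose good_set : set E := \bigcap_j \bigcap_q \bigcup_M @decay_set R T delta d q (rho_ j) M%:R.
have borelG : borel_set (~` good_set).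
  apply: (@measurableC _ (g_sigma_algebraType (@open E))).
  apply: bigcapT_measurable => j; apply: bigcapT_measurable => q.
  apply: bigcupT_measurable => M.
  rewrite -[X in measurable X]setCK; apply: measurableC; apply: sub_sigma_algebra.
  by apply: closed_openC; exact: closed_decay_set.
exists (~` good_set); last first.
  apply: subsetC => phi Gphi rho rhod q.
  have rd : 2 * rho * delta < 1.
    move: rhod; rewrite inver; case: eqP => [|/eqP dn0] h.
      by move=> _; rewrite mulrAC h mul0r.
    move: h; rewrite lte_fin -[ltRHS]mul1r ltr_pdivlMr; last first.
      by rewrite lt_def dn0 mulr_ge0.
    by rewrite (_ : 2 * rho * delta = rho * (2 * delta))//; ring.
  have e0 : 0 < 1 - 2 * rho * delta by lra.
  (* The inequality rho <= rho_ j amounts to rho <= j (1 - 2 rho delta). *)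
  pose j := (Num.truncn (`|rho| / (1 - 2 * rho * delta))).+1.
  have rj : rho <= rho_ j.
    rewrite /rho_ ler_pdivlMr//.
    have : `|rho| / (1 - 2 * rho * delta) <= j%:R by exact/ltW/truncnS_gt.
    rewrite ler_pdivrMr// => h; have := ler_norm rho; lra.
  have [M _ HM] := Gphi j I q I.
  exact: decay_set_strong HM.
apply: (@sample_prevalent R E W Wu) => // v.
have /choice[N HN] := fun q => ae_good T0 delta01 C0 nC nk v q.
exists (\bigcup_q N q); split.
- by apply: bigcup_measurable => q _; case: (HN q).
- apply/eqP; rewrite eq_le measure_ge0 andbT.
  apply: (le_trans (generalized_Boole_inequality _ _ _)).
  + by move=> q; case: (HN q).
  + by apply: bigcup_measurable => q _; case: (HN q).
  + by rewrite eseries0// => q _ _; case: (HN q).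
move=> x x01 nN; apply; move=> j _ q _.
have [_ _ /(_ x x01)] := HN q.
case=> [Nx|K HK]; first by apply: nN; exists q.
have r0 : 0 <= rho_ j by rewrite divr_ge0// ltW.
have rd : 2 * rho_ j * delta < 1.
  rewrite /rho_ mulrA mulrAC ltr_pdivrMr// mul1r; lra.
have [k0 Hk0] := nb _ r0 rd.
have -> : v + sample W x = v + W (dig x) by rewrite /sample x01.
pose w : E := v + W (dig x).
have [D HD] := good_strong T0 (@holder_path_cont R T delta d w) (fun t _ => holder_norm_sup w t) r0 Hk0 HK.
exists (Num.truncn D).+1 => // xi eta s t xi2 s0 st tT ts.
rewrite (le_trans (HD xi eta s t xi2 _ _ _ _))//.
- by rewrite in_itv/= s0 (le_trans (ltW st)).
- by rewrite in_itv/= tT (le_trans s0 (ltW st)).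
- by rewrite lt_eqF.
- by rewrite gtr0_norm ?subr_gt0.
- exact/ltW/truncnS_gt.
Qed.

End part_two.

(** * Taylor approximation of smooth paths *)

Section taylor.
Context {R : realType} (T : R) (g : nat -> R -> R).
Hypothesis gder : forall k t, t \in `[0, T] ->
  (s - t)^-1 * (g k s - g k t) @[s --> within `[0, T] t^'] --> g k.+1 t.

Let gder_eps k t (e : R) : t \in `[0, T] -> 0 < e -> \forall s \near t,
  s \in `[0, T] -> `|g k s - g k t - (s - t) * g k.+1 t| <= e * `|s - t|.
Proof.
move=> tT e0; have /cvgrPdist_le/(_ e e0) H0 := @gder k t tT.
have H1 : nbhs t [set s | s != t -> s \in `[0, T] ->
  `|g k.+1 t - (s - t)^-1 * (g k s - g k t)| <= e] := H0.
apply: filterS H1 => s H sT; have [->|st] := eqVneq s t.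
  by rewrite !subrr mul0r subrr !normr0 mulr0.
have st0 : s - t != 0 by rewrite subr_eq0.
have := H st sT; rewrite distrC => {}H.
rewrite (_ : _ - _ - _ = ((s - t)^-1 * (g k s - g k t) - g k.+1 t) * (s - t)).
  by rewrite normrM ler_wpM2r.
by field.
Qed.

Lemma smooth_cont k : {within `[0, T], continuous (g k)}.
Proof.
apply/subspace_continuousP => t tT; apply/cvgrPdist_le => e e0.
set c := g k.+1 t; have d0 : 0 < e / (1 + `|c|) by rewrite divr_gt0// ltr_pwDl.
have h : \forall s \near t, `|t - s| <= e / (1 + `|c|).
  by apply/nbhs_normP; exists (e / (1 + `|c|)) => //= z /ltW.
apply: filterS2 (@gder_eps k t 1 tT ltr01) h => s H st sT.
have {}H := H sT; rewrite mul1r in H.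
rewrite distrC (_ : g k s - g k t = (g k s - g k t - (s - t) * c) + (s - t) * c); last by ring.
rewrite (le_trans (ler_normD _ _))// normrM.
move: st; rewrite ler_pdivlMr ?ltr_pwDl// (distrC t) => st.
apply: le_trans st; rewrite mulrDr mulr1.
by rewrite lerD.
Qed.

Lemma smooth_bound k : exists2 M, 0 <= M & forall t, t \in `[0, T] -> `|g k t| <= M.
Proof.
have : compact (g k @` `[0, T]).
  by apply: continuous_compact; [exact: smooth_cont|exact: segment_compact].
move=> /compact_bounded /pinfty_ex_gt0 [M M0 fM].
by exists M; [exact: ltW|move=> t tT; apply: fM; exists t].
Qed.

Lemma smooth_is_derive k t : t \in `]0, T[ -> is_derive t 1 (g k) (g k.+1 t).
Proof.
move=> tT.
have tT' : t \in `[0, T].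
  by move: tT; rewrite !in_itv/= => /andP[/ltW -> /ltW ->].
have L : (fun h => h^-1 *: (g k (h *: 1 + t) - g k t)) @ 0^' --> g k.+1 t.
  apply/cvgrPdist_le => e e0.
  have H1 := @gder_eps k t e tT' e0.
  have H2 : \forall s \near t, s \in `[0, T].
    have := near_in_itvoo tT; apply: filterS => s.
    by rewrite !in_itv/= => /andP[/ltW -> /ltW ->].
  have /nbhs_normP[r /= r0 Hr] : \forall s \near t,
      `|g k s - g k t - (s - t) * g k.+1 t| <= e * `|s - t|.
    by apply: filterS2 H1 H2 => s; apply.
  apply/nbhs_normP; exists r => //= h; rewrite /ball_ /= sub0r normrN => hr h0.
  have := Hr (h + t); rewrite /ball_ /= opprD addrCA subrr addr0 normrN => /(_ hr).
  rewrite addrK => H; rewrite distrC.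
  rewrite [h *: 1](mulr1 h).
  rewrite (_ : _ - _ = h^-1 * (g k (h + t) - g k t - h * g k.+1 t)).
    by rewrite normrM normfV ler_pdivrMl ?normr_gt0// [leRHS]mulrC.
  by rewrite mulrBr mulKf.
apply: DeriveDef; first exact: (cvgP _ L).
exact: cvg_lim L.
Qed.

(** Encoded as a formal polynomial, so that its coefficients in powers of the variable, rather than
    of its distance to u, can be read off. *)
Definition taylor (j n : nat) (u : R) : {poly R} :=
  \sum_(k < n) (g (j + k) u / k`!%:R) *: ('X - u%:P) ^+ k.

Lemma deriv_taylor j n u : (taylor j n.+1 u)^`() = taylor j.+1 n u.
Proof.
rewrite /taylor big_ord_recl/= derivD expr0 alg_polyC derivC add0r raddf_sum.
apply: eq_bigr => k _ /=; rewrite derivZ deriv_exp derivXsubC mul1r.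
rewrite /bump leq0n add1n /= addSnnS -(scaler_nat k.+1 (_ ^+ k)) scalerA; congr (_ *: _).
by rewrite factS natrM invfM mulrA mulrAC divfK// pnatr_eq0.
Qed.

Lemma taylor_base j n u : (taylor j n.+1 u).[u] = g j u.
Proof.
rewrite /taylor big_ord_recl/= hornerD hornerZ expr0 hornerC addn0 divr1 mulr1.
rewrite horner_sum big1 ?addr0// => k _.
by rewrite hornerZ horner_exp hornerXsubC subrr expr0n mulr0.
Qed.

(** The derivative of a Taylor remainder is the remainder of the next derivative with one term less,
    so the mean value theorem carries the induction. The constant is a bound on the derivative of
    order j + n and is uniform in u. *)
Lemma taylor_le n j : exists2 M, 0 <= M & forall u x, u \in `[0, T] -> x \in `[0, T] ->
  `|g j x - (taylor j n u).[x]| <= M * `|x - u| ^+ n.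
Proof.
elim: n j => [|n IH] j.
  have [M M0 HM] := smooth_bound j; exists M => // u x uT xT.
  by rewrite /taylor big_ord0 horner0 subr0 mulr1 HM.
have [M M0 HM] := IH j.+1; exists M => // u x uT xT.
pose h y := g j y - (taylor j n.+1 u).[y].
have hc a b : 0 <= a -> b <= T -> {within `[a, b], continuous h}.
  move=> a0 bT; apply: within_add; first exact: (within_sub a0 bT (@smooth_cont j)).
  apply: (@within_comp _ -%R); first exact: opp_continuous.
  exact/continuous_subspaceT/continuous_horner.
have hd y : y \in `]0, T[ -> is_derive y 1 h (g j.+1 y - (taylor j.+1 n u).[y]).
  move=> yT; rewrite -deriv_taylor.
  have ? := smooth_is_derive j yT.
  exact: is_deriveB.
have key a b : 0 <= a -> b <= T -> a < b -> (a = u /\ b = x) \/ (a = x /\ b = u) ->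
    `|h b - h a| <= M * `|x - u| ^+ n.+1.
  move=> a0 bT ab abux.
  have xu : `|x - u| = b - a.
    by case: abux => -[<- <-]; [|rewrite distrC]; rewrite gtr0_norm// subr_gt0.
  have hd' y : y \in `]a, b[ -> is_derive y 1 h (g j.+1 y - (taylor j.+1 n u).[y]).
    rewrite in_itv/= => /andP[ay yb]; apply: hd.
    by rewrite in_itv/= (le_lt_trans a0 ay) (lt_le_trans yb bT).
  have [c cab E] := MVT ab hd' (hc a b a0 bT).
  rewrite E.
  rewrite exprSr mulrA {2}xu normrM (gtr0_norm (x := b - a)) ?subr_gt0//.
  rewrite ler_wpM2r ?subr_ge0 ?(ltW ab)//.
  move: cab; rewrite !in_itv/= => /andP[ac cb].
  rewrite (le_trans (HM u c uT _))//.
    by rewrite in_itv/= (le_trans a0 (ltW ac)) (le_trans (ltW cb) bT).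
  rewrite ler_wpM2l// lerXn2r ?nnegrE// xu.
  by case: abux => -[ax bx]; rewrite ler_norml; move: ac cb; rewrite ?ax ?bx; lra.
have hu : h u = 0 by rewrite /h taylor_base subrr.
rewrite -/(h x) -[h x]subr0 -hu.
move: (uT) (xT); rewrite !in_itv/= => /andP[u0 uT'] /andP[x0 xT'].
case: (ltgtP u x) => [ux|xu|->].
- by apply: key => //; left.
- by rewrite distrC; apply: key => //; right.
- by rewrite subrr normr0 mulr_ge0// exprn_ge0.
Qed.

End taylor.

Section polynomial_approximation.
Context {R : realType}.

Lemma coef_XsubC_exp_le (u B : R) m k : `|u| <= B ->
  `|(('X - u%:P) ^+ m)`_k| <= (1 + B) ^+ m.
Proof.
move=> uB; have B0 : 0 <= B by exact: le_trans uB.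
elim: m k => [|m IH] k; first by rewrite !expr0 coef1; case: eqP; rewrite ?normr1 ?normr0.
rewrite exprS mulrBl coefB coefXM coefCM (le_trans (ler_normB _ _))//.
rewrite exprS mulrDl mul1r lerD//; last by rewrite normrM ler_pM.
by case: eqP => _; rewrite ?normr0 ?exprn_ge0 ?addr_ge0//.
Qed.

Variables (T : R) (d : nat) (psi : R -> 'rV[R]_d).
Hypothesis T0 : 0 < T.
Hypothesis psiS : smooth_path T psi.

Lemma smooth_coords : exists g : 'I_d -> nat -> R -> R,
  (forall i t, t \in `[0, T] -> psi t 0 i = g i 0%N t) /\
  forall i k t, t \in `[0, T] ->
    (s - t)^-1 * (g i k s - g i k t) @[s --> within `[0, T] t^'] --> g i k.+1 t.
Proof.
have [D [D0 DS]] := psiS; exists (fun i k s => D k s 0 i); split.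
  by move=> i t tT; rewrite D0.
move=> i k t tT; apply/cvgrPdist_le => e e0.
have /cvgrPdist_le/(_ e e0) := DS k t tT; apply: filterS => s.
by apply: le_trans; apply: le_trans (coord_norm_le _ i); rewrite !mxE.
Qed.

Lemma smooth_path_cont : {within `[0, T], continuous psi}.
Proof.
have [g [g0 gS]] := smooth_coords.
apply/subspace_continuousP => t tT; apply/cvgrPdist_le => e e0.
have H i : nbhs t [set s | s \in `[0, T] -> `|g i 0%N t - g i 0%N s| <= e].
  have /subspace_continuousP/(_ t tT)/cvgrPdist_le := smooth_cont (gS i) (k := 0%N).
  by move=> /(_ e e0).
suff : nbhs t [set s | s \in `[0, T] -> `|psi t - psi s| <= e] by [].
have H' := @filter_forall R _ _ (nbhs (t : R)) (nbhs_filter (t : R)) H.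
apply: (@filterS R (nbhs (t : R)) (nbhs_filter (t : R)) _ _ _ H') => s Hs sT.
by apply: row_norm_le => [|i]; [exact: ltW|rewrite !mxE !g0//; exact: Hs].
Qed.

(** Since [gpoly] has no constant term, that term is kept apart as c and only rotates the integral.
    The bound on [eta] is uniform in the base point and linear in |xi|, so it enters strong
    irregularity through a logarithm. *)
Lemma smooth_poly_approx n : exists C M : R, [/\ 0 <= C, 0 <= M &
  forall (u : R) (xi : 'rV[R]_d), u \in `[0, T] -> exists (c : R) (eta : 'rV[R]_n),
    enorm eta <= C * enorm xi /\ forall r, r \in `[0, T] ->
      `|dot xi (psi r) - (c + gpoly eta r)| <= M * enorm xi * `|r - u| ^+ n.+1].
Proof.
have [g [g0 gS]] := smooth_coords.
have /choice[b Hb] : forall ik : 'I_d * nat, exists B : R, 0 <= B /\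
    forall t, t \in `[0, T] -> `|g ik.1 ik.2 t| <= B.
  by move=> [i k]; have [B B0 HB] := smooth_bound (gS i) k; exists B.
have /choice[M HM] : forall i, exists M : R, 0 <= M /\ forall u x, u \in `[0, T] ->
    x \in `[0, T] -> `|g i 0%N x - (taylor (g i) 0 n.+1 u).[x]| <= M * `|x - u| ^+ n.+1.
  by move=> i; have [M M0 HM] := taylor_le (gS i) n.+1 0; exists M.
pose K := \sum_(i < d) \sum_(k < n.+1) b (i, k : nat) * (1 + T) ^+ k.
have T1 : 0 <= T by exact: ltW.
have K0 : 0 <= K.
  apply: sumr_ge0 => i _; apply: sumr_ge0 => k _.
  by rewrite mulr_ge0 ?exprn_ge0 ?addr_ge0//; case: (Hb (i, k : nat)).
exists (n%:R * (d%:R * K)), (\sum_i M i); split.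
- by rewrite !mulr_ge0.
- by apply: sumr_ge0 => i _; case: (HM i).
move=> u xi uT.
pose p i := taylor (g i) 0 n.+1 u.
have pc i k : `|(p i)`_k| <= K.
  rewrite /p /taylor coef_sum (le_trans (ler_norm_sum _ _ _))//.
  rewrite /K (bigD1 i)//= ler_wpDr//.
    apply: sumr_ge0 => i' _; apply: sumr_ge0 => k' _.
    by rewrite mulr_ge0 ?exprn_ge0 ?addr_ge0//; case: (Hb (i', k' : nat)).
  apply: ler_sum => l _; rewrite coefZ normrM ler_pM//; last first.
    apply: coef_XsubC_exp_le; move: uT; rewrite in_itv/= => /andP[? ?].
    by rewrite ger0_norm.
  rewrite add0n normrM normfV (@ger0_norm _ _%:R)// ler_pdivrMr ?ltr0n ?fact_gt0//.
  have [b0 /(_ u uT) /= Hbu] := Hb (i, l : nat).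
  by rewrite (le_trans Hbu)// ler_peMr// ler1n fact_gt0.
have sp i : (size (p i) <= n.+1)%N.
  apply: (leq_trans (size_sum _ _ _)); apply/bigmax_leqP => l _.
  by rewrite (leq_trans (size_scale_leq _ _))// size_exp_XsubC.
exists (\sum_i xi 0 i * (p i)`_0), (\row_(k < n) \sum_i xi 0 i * (p i)`_k.+1); split.
  rewrite (le_trans (enorm_le_norm _))// -mulrA ler_wpM2l//.
  have x0 := enorm_ge0 xi.
  apply: row_norm_le => [|k]; first by rewrite mulr_ge0// mulr_ge0.
  rewrite mxE (le_trans (ler_norm_sum _ _ _))//.
  rewrite -mulrA mulr_natl -[X in _ *+ X]card_ord -sumr_const.
  by apply: ler_sum => i _; rewrite normrM mulrC ler_pM// enorm_ge_coord.
move=> r rT.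
have -> : \sum_i xi 0 i * (p i)`_0 + gpoly (\row_(k < n) \sum_i xi 0 i * (p i)`_k.+1) r =
    \sum_i xi 0 i * (p i).[r].
  have hp i : xi 0 i * (p i).[r] = xi 0 i * (p i)`_0 +
      \sum_(k < n) xi 0 i * (p i)`_k.+1 * r ^+ k.+1.
    rewrite (horner_coef_wide _ (sp i)) big_ord_recl expr0 mulr1 mulrDr mulr_sumr.
    by congr (_ + _); apply: eq_bigr => k _; rewrite mulrA.
  rewrite [RHS](eq_bigr _ (fun i _ => hp i)) big_split/=; congr (_ + _).
  rewrite exchange_big/=; apply: eq_bigr => k _.
  by rewrite mxE mulr_suml.
rewrite /dot -sumrB (le_trans (ler_norm_sum _ _ _))// -mulrA mulr_suml.
apply: ler_sum => i _; rewrite -mulrBr normrM g0//.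
have [M0 HMi] := HM i; rewrite mulrCA ler_pM// ?enorm_ge_coord//.
exact: HMi.
Qed.

End polynomial_approximation.

(** * Perturbation by a smooth path *)

Section part_one.
Context {R : realType}.

Lemma ln_le_powR (y a : R) : 0 < a -> 0 < y -> ln y <= y `^ a / a.
Proof.
move=> a0 y0; rewrite ler_pdivlMr// /powR gt_eqF//.
by have := expR_ge1Dx (a * ln y); lra.
Qed.

Lemma sqrt_ln_le (kappa C : R) : 0 < kappa -> 0 <= C -> exists2 C1, 0 <= C1 &
  forall x y : R, 2 <= x -> 0 <= y -> y <= C * x ->
    Num.sqrt (ln (2 + y)) * Num.sqrt (ln x) <= C1 * x `^ kappa.
Proof.
move=> k0 C0; pose K : R := (1 + C) `^ kappa / kappa.
have K0 : 0 <= K by rewrite divr_ge0 ?powR_ge0// ltW.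
exists (Num.sqrt K * Num.sqrt kappa^-1) => [|x y x2 y0 yx].
  by rewrite mulr_ge0 ?sqrtr_ge0.
have x0 : 0 < x by lra.
have a1 : ln (2 + y) <= K * x `^ kappa.
  apply: (@le_trans _ _ (ln ((1 + C) * x))).
    by rewrite ler_ln ?posrE ?mulr_gt0//; nra.
  apply: (le_trans (ln_le_powR k0 _)); first by rewrite mulr_gt0//; lra.
  by rewrite powRM//; [rewrite /K mulrAC|lra|lra].
have a2 : ln x <= kappa^-1 * x `^ kappa by rewrite mulrC; exact: ln_le_powR.
have p0 := powR_ge0 x kappa.
apply: (@le_trans _ _ (Num.sqrt (K * x `^ kappa) * Num.sqrt (kappa^-1 * x `^ kappa))).
  by rewrite ler_pM ?sqrtr_ge0// ler_wsqrtr.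
have e1 : Num.sqrt (K * x `^ kappa) = Num.sqrt K * Num.sqrt (x `^ kappa) by rewrite sqrtrM.
have e2 : Num.sqrt (kappa^-1 * x `^ kappa) = Num.sqrt kappa^-1 * Num.sqrt (x `^ kappa).
  by rewrite sqrtrM// invr_ge0 ltW.
by rewrite e1 e2 mulrACA -expr2 sqr_sqrtr.
Qed.

Lemma psi0_le (th l : R) : 0 < th -> 0 < l -> l <= 1 ->
  psi0 l <= Num.sqrt th^-1 * l `^ ((1 - th) / 2).
Proof.
move=> th0 l0 l1; rewrite /psi0.
have nl : `|ln l| <= th^-1 * l `^ (- th).
  rewrite ler0_norm ?ln_le0// -lnV ?posrE//.
  rewrite (le_trans (ln_le_powR th0 _)) ?invr_gt0// mulrC.
  by rewrite -[l^-1]powR_inv1 ?(ltW l0)// -powRrM mulN1r.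
apply: (@le_trans _ _ (Num.sqrt (th^-1 * l `^ (1 - th)))).
  rewrite ler_wsqrtr// (le_trans (ler_wpM2l (ltW l0) nl))// mulrCA ler_wpM2l ?invr_ge0 ?(ltW th0)//.
  rewrite -{1}[l]powRr1 ?(ltW l0)// -powRD//.
  by rewrite (gt_eqF l0) implybT.
rewrite sqrtrM ?invr_ge0 ?(ltW th0)// ler_wpM2l ?sqrtr_ge0//.
by rewrite -powR12_sqrt ?powR_ge0// -powRrM.
Qed.

(** Write v = v^(1 - th) v^th and use one bound on each factor. *)
Lemma interpolate (v A D beta mu th x : R) : 0 <= v -> 0 <= A -> 0 < D -> 0 < x ->
  0 <= th <= 1 -> v <= A * D `^ beta * x `^ (- mu) -> v <= 2 * D ->
  v <= (A `^ (1 - th) * 2 `^ th) * x `^ (- (mu * (1 - th))) * D `^ (beta * (1 - th) + th).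
Proof.
move=> v0 A0 D0 x0 /andP[th0 th1] vA vD.
have [->|vn0] := eqVneq v 0; first by rewrite !mulr_ge0 ?powR_ge0.
rewrite -[v]powRr1// -[X in v `^ X](subrK th 1) powRD ?vn0 ?implybT//.
have a1 : v `^ (1 - th) <= A `^ (1 - th) * D `^ (beta * (1 - th)) * x `^ (- (mu * (1 - th))).
  rewrite -mulNr !powRrM -!powRM ?mulr_ge0 ?powR_ge0//.
  by rewrite ge0_ler_powR ?nnegrE ?subr_ge0 ?mulr_ge0 ?powR_ge0.
have a2 : v `^ th <= 2 `^ th * D `^ th.
  rewrite -powRM ?(ltW D0)// ge0_ler_powR ?nnegrE ?mulr_ge0 ?(ltW D0)//.
apply: (le_trans (ler_pM (powR_ge0 _ _) (powR_ge0 _ _) a1 a2)).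
have -> : D `^ (beta * (1 - th) + th) = D `^ (beta * (1 - th)) * D `^ th.
  by rewrite powRD// (gt_eqF D0) implybT.
by rewrite le_eqVlt; apply/orP; left; apply/eqP; ring.
Qed.

Lemma cosint_pieces (th : R -> R) (s l B : R) (N : nat) : 0 <= l ->
  {within `[s, s + N%:R * l], continuous th} ->
  (forall i, (i < N)%N -> cosint th (s + i%:R * l) (s + i.+1%:R * l) <= B) ->
  cosint th s (s + N%:R * l) <= N%:R * B.
Proof.
move=> l0; elim: N => [|N IH] thc HB.
  by rewrite !mul0r addr0 /cosint set_itv1 Rintegral_set1.
have h1 : s <= s + N%:R * l by rewrite lerDl mulr_ge0.
have h2 : s + N%:R * l <= s + N.+1%:R * l by rewrite lerD2l ler_wpM2r// ler_nat.
rewrite (cosint_split h1 h2 thc) -[in leRHS]natr1 mulrDl mul1r lerD ?HB//.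
apply: IH => [|i iN]; last by rewrite HB// ltnW.
exact: within_sub thc.
Qed.

Lemma cosint_shift_le (th : R -> R) (c a b : R) : a <= b ->
  {within `[a, b], continuous th} ->
  cosint (fun r => th r + c) a b <= 2 * cmod (cint (fun r => expi (th r)) a b).
Proof.
move=> ab thc; rewrite cosint_shift// cint_le//.
set A := cosint th a b; set B := \int[_]_(_ in _) _.
have h1 := cmod_re A B; have h2 := cmod_im A B.
rewrite (le_trans (ler_norm _))// (le_trans (ler_normB _ _))// mulrDl mul1r lerD//.
  by rewrite (le_trans _ h1)// normrM ler_piMl// ler_norml cos_geN1 cos_le1.
by rewrite (le_trans _ h2)// normrM ler_piMl// ler_norml sin_geN1 sin_le1.
Qed.

Variables (T : R) (d : nat).
Hypothesis T0 : 0 < T.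

Lemma strongly_irregular_bound (rho : R) (phi : R -> 'rV[R]_d) (n : nat) :
  strongly_irregular T rho phi -> exists2 Q, 0 <= Q &
  forall (xi : 'rV[R]_d) (eta : 'rV[R]_n) s t, 2 <= enorm xi ->
    0 <= s -> s < t -> t <= T -> t - s <= 1 / 2 ->
    cmod (cint (fun r => expi (dot xi (phi r) + gpoly eta r)) s t) <=
    Q * (Num.sqrt (ln (2 + enorm eta)) * Num.sqrt (ln (enorm xi))) * psi0 (t - s) *
      enorm xi `^ (- rho).
Proof.
move=> /(_ n); set S := ereal_sup _ => Sfin.
exists `|fine S| => // xi eta s t xi2 s0 st tT ts.
have zS : (strong_quotient rho phi xi eta s t)%:E \in [set z%:E | z in strong_quotients n T rho phi].
  rewrite inE; exists (strong_quotient rho phi xi eta s t) => //.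
  exists xi, eta, s, t; split => //.
  - rewrite !in_itv/= s0 tT (le_trans (ltW st) tT)/=; split => //.
    by rewrite (le_trans s0 (ltW st)).
  - by rewrite lt_eqF.
  - by rewrite gtr0_norm ?subr_gt0.
move: zS; rewrite inE => /ereal_sup_ubound; rewrite -/S => zS.
have {zS Sfin} : strong_quotient rho phi xi eta s t <= `|fine S|.
  by move: zS Sfin; case: (S) => [r|//|//]; rewrite lee_fin => h _; rewrite (le_trans h)// ler_norm.
rewrite /strong_quotient (gtr0_norm (x := t - s)) ?subr_gt0//.
set sl := Num.sqrt (ln (2 + _)); set ps := psi0 _; set c := cmod _ => H.
have sl0 : 0 < sl by rewrite sqrtr_gt0 ln_gt0//; have := enorm_ge0 eta; lra.
have ps0 : 0 < ps.
  have ln0 : ln (t - s) < 0 by rewrite ln_lt0// subr_gt0 st/=; lra.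
  rewrite /ps /psi0 sqrtr_gt0; apply: mulr_gt0; first by rewrite subr_gt0.
  by rewrite normr_gt0 lt_eqF.
have x0 : 0 < enorm xi by lra.
have sx0 : 0 < Num.sqrt (ln (enorm xi)) by rewrite sqrtr_gt0 ln_gt0//; lra.
move: H; rewrite ler_pdivrMr ?mulr_gt0// /Fweight mulrA ler_pdivrMr// => H.
rewrite powRN ler_pdivlMr ?powR_gt0// (le_trans H)//.
by rewrite le_eqVlt; apply/orP; left; apply/eqP; ring.
Qed.

Variables (phi psi : R -> 'rV[R]_d) (rho rho' : R).
Hypothesis phic : {within `[0, T], continuous phi}.
Hypothesis psiS : smooth_path T psi.
Hypothesis rho_irr : strongly_irregular T rho phi.
Hypotheses (rho'0 : 0 < rho') (rhorho' : rho' < rho).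

Let psic := smooth_path_cont psiS.

(** These values are tuned to one another: rho - 2 kappa is the mean of rho and rho', and
    multiplying it by 1 - th gives exactly rho'. The exponent [beta] is the one that [psi0_le]
    leaves after the logarithm is absorbed. *)
Let kappa := (rho - rho') / 4.
Let th := (rho - rho') / (rho + rho').
Let beta := (1 - th) / 2.

Let kappa0 : 0 < kappa. Proof. by rewrite divr_gt0// subr_gt0. Qed.
Let th0 : 0 < th. Proof. by rewrite divr_gt0 ?subr_gt0// addr_gt0// (lt_trans rho'0). Qed.
Let th1 : th < 1.
Proof. by rewrite /th ltr_pdivrMr; have := rho'0; have := rhorho'; lra. Qed.
Let beta0 : 0 < beta. Proof. by rewrite divr_gt0// subr_gt0. Qed.
Let beta1 : beta <= 1. Proof. by have := th0; rewrite /beta; lra. Qed.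

Let sum_cont (xi : 'rV[R]_d) a b : 0 <= a -> b <= T ->
  {within `[a, b], continuous (fun r => dot xi (phi r + psi r))}.
Proof.
move=> a0 bT; apply: dot_cont => x; apply: cvgD.
  exact: (within_sub a0 bT phic).
exact: (within_sub a0 bT psic).
Qed.

Lemma high_frequency_bound : exists2 A, 0 <= A & forall (xi : 'rV[R]_d) s t,
  2 <= enorm xi -> 0 <= s -> s < t -> t <= T ->
  cmod (cint (fun r => expi (dot xi (phi r + psi r))) s t) <=
    A * (t - s) `^ beta * enorm xi `^ (- (rho - 2 * kappa)).
Proof.
(* The Taylor remainder on a piece of length at most |xi|^-kappa has size |xi|^(1 - kappa (n + 1));
   this degree makes it at most |xi|^-rho. *)
pose n := (Num.truncn ((rho + 1) / kappa)).+1.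
have nk : rho + 1 <= kappa * n.+1%:R.
  rewrite mulrC -ler_pdivrMr//; apply/ltW/(lt_le_trans (truncnS_gt _)).
  by rewrite ler_nat.
have [Q Q0 HQ] := strongly_irregular_bound n rho_irr.
have [C [M [C0 M0 HM]]] := smooth_poly_approx T0 psiS n.
have [C1 C10 HC1] := sqrt_ln_le kappa0 C0.
pose C2 : R := Num.sqrt th^-1.
have C20 : 0 <= C2 by exact: sqrtr_ge0.
pose A1 := 2 * Q * C1 * C2 * (2 * T + 2); pose A2 := M * T `^ (1 - beta).
have A10 : 0 <= A1 by rewrite !mulr_ge0// addr_ge0// mulr_ge0// ltW.
have A20 : 0 <= A2 by rewrite mulr_ge0 ?powR_ge0.
exists (2 * (A1 + A2)) => [|xi s t xi2 s0 st tT]; first by rewrite mulr_ge0// addr_ge0.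
set x := enorm xi in xi2 *; have x0 : 0 < x by lra.
set D := t - s; have D0 : 0 < D by rewrite subr_gt0.
have DT : D <= T by rewrite /D; lra.
set xk := x `^ kappa.
have xk1 : 1 <= xk by rewrite -(powRr0 x) ler_powR ?(ltW kappa0)//; lra.
(* The factor 2 T + 1 makes the pieces shorter than both 1/2, as strong irregularity requires, and
   |xi|^-kappa. *)
pose N := (Num.truncn (xk * (2 * T + 1))).+1.
have y0 : 0 <= xk * (2 * T + 1) by rewrite mulr_ge0//; lra.
have N1 : xk * (2 * T + 1) <= N%:R by exact/ltW/truncnS_gt.
have N2 : N%:R <= xk * (2 * T + 2).
  have /andP[h _] := truncn_itv y0.
  by rewrite /N -natr1; nra.
have N0 : 0 < N%:R :> R by [].
set l := D / N%:R; have l0 : 0 < l by rewrite divr_gt0.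
have lN : s + N%:R * l = t by rewrite /l mulrC divfK ?gt_eqF// /D addrC subrK.
have l12 : l <= 1 / 2.
  rewrite ler_pdivrMr//; have : T * (2 * xk) <= N%:R by nra.
  nra.
have lxk : l <= x `^ (- kappa).
  rewrite powRN -/xk ler_pdivrMr// -ler_pdivrMl ?invr_gt0 ?powR_gt0// invrK.
  by nra.
have lD : l <= D by rewrite ler_pdivrMr// ler_peMr ?(ltW D0)// ler1n.
(* One power of |xi|^kappa here pays for the logarithms; the number of pieces brings the second
   one. *)
pose Bd := 2 * (Q * (C1 * xk) * (C2 * l `^ beta) * x `^ (- rho)) + M * x * l ^+ n.+1 * l.
rewrite -[leRHS]mulrA -[leRHS]mulrA.
apply: cmod_cint_le; [exact: ltW|exact: sum_cont|].
move=> al al4.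
have thc a b : 0 <= a -> b <= T ->
    {within `[a, b], continuous (fun r => dot xi (phi r + psi r) + al%:R * (pi / 2))}.
  by move=> a0 bT; apply: within_add; [exact: sum_cont|exact: within_cst].
have piece i : (i < N)%N -> cosint (fun r => dot xi (phi r + psi r) + al%:R * (pi / 2))
    (s + i%:R * l) (s + i.+1%:R * l) <= Bd.
  move=> iN; set u := s + i%:R * l; set v := s + i.+1%:R * l.
  have uv : v - u = l by rewrite /u /v -natr1; ring.
  have ltuv : u < v by rewrite -subr_gt0 uv.
  have u0 : 0 <= u by rewrite addr_ge0// mulr_ge0// ltW.
  have vT : v <= T.
    by rewrite (le_trans _ tT)// -lN lerD2l ler_wpM2r ?(ltW l0)// ler_nat.
  have uT : u \in `[0, T] by rewrite in_itv/= u0 (le_trans (ltW ltuv) vT).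
  have [c [eta [etax Happ]]] := HM u xi uT.
  pose th' r := dot xi (phi r) + gpoly eta r.
  have th'c : {within `[u, v], continuous th'}.
    apply: within_add; last exact: gpoly_cont.
    by apply: dot_cont; exact: (within_sub u0 vT phic).
  have th'c' : {within `[u, v], continuous (fun r => th' r + (c + al%:R * (pi / 2)))}.
    by apply: within_add => //; exact: within_cst.
  have err r : r \in `[u, v] ->
     `|dot xi (phi r + psi r) + al%:R * (pi / 2) - (th' r + (c + al%:R * (pi / 2)))| <=
       M * x * l ^+ n.+1.
    rewrite in_itv/= => /andP[ur rv].
    have rT : r \in `[0, T] by rewrite in_itv/= (le_trans u0 ur) (le_trans rv vT).
    rewrite (_ : _ - _ = dot xi (psi r) - (c + gpoly eta r)); last by rewrite dotDr /th'; ring.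
    rewrite (le_trans (Happ r rT))// ler_wpM2l ?mulr_ge0 ?(ltW x0)//.
    by rewrite lerXn2r ?nnegrE ?(ltW l0)// ger0_norm ?subr_ge0// -uv lerD2r.
  have := cosint_lip (ltW ltuv) (thc _ _ u0 vT) th'c' err.
  rewrite uv ler_distl => /andP[_ h]; rewrite (le_trans h)// lerD2r.
  apply: (le_trans (cosint_shift_le _ (ltW ltuv) th'c)); rewrite ler_wpM2l//.
  have := HQ xi eta u v xi2 u0 ltuv vT; rewrite uv => /(_ l12) hq.
  rewrite (le_trans hq)// ler_wpM2r ?powR_ge0// ler_pM ?sqrtr_ge0//.
  - by rewrite !mulr_ge0 ?sqrtr_ge0.
  - by rewrite ler_wpM2l// HC1// enorm_ge0.
  - by apply: psi0_le => //; lra.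
have := @cosint_pieces _ s l Bd N (ltW l0) _ piece; rewrite lN => /(_ (thc _ _ s0 tT)).
move/le_trans; apply.
rewrite [leRHS]mulrDl /Bd mulrDr lerD//.
- have lb : l `^ beta <= D `^ beta.
    by rewrite ge0_ler_powR ?nnegrE ?(ltW beta0) ?(ltW l0) ?(ltW D0).
  have xx : x `^ (- (rho - 2 * kappa)) = xk * xk * x `^ (- rho).
    rewrite /xk -!powRD ?(gt_eqF x0) ?implybT//; congr (_ `^ _); ring.
  rewrite xx [leLHS](_ : _ = (2 * Q * C1 * C2) * (xk * x `^ (- rho)) * (N%:R * l `^ beta)); last by ring.
  rewrite [leRHS](_ : _ = (2 * Q * C1 * C2) * (xk * x `^ (- rho)) *
    (xk * (2 * T + 2) * D `^ beta)); last by rewrite /A1; ring.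
  by rewrite ler_wpM2l ?mulr_ge0 ?powR_ge0// ler_pM ?powR_ge0.
- have ln1 : l ^+ n.+1 <= x `^ (- (rho + 1)).
    apply: (@le_trans _ _ ((x `^ (- kappa)) ^+ n.+1)).
      by rewrite lerXn2r ?nnegrE ?powR_ge0 ?(ltW l0).
    have nk' : - kappa * n.+1%:R <= - (rho + 1) by rewrite mulNr lerN2.
    by rewrite -powR_mulrn ?powR_ge0// -powRrM ler_powR//; lra.
  have xx : x * x `^ (- (rho + 1)) <= x `^ (- (rho - 2 * kappa)).
    rewrite -{1}[x]powRr1 ?(ltW x0)// -powRD ?(gt_eqF x0) ?implybT//.
    rewrite ler_powR//; have := kappa0; lra.
  have DD : D <= T `^ (1 - beta) * D `^ beta.
    rewrite -{1}[D]powRr1 ?(ltW D0)// -{1}(subrK beta 1) powRD ?(gt_eqF D0) ?implybT//.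
    by rewrite ler_wpM2r ?powR_ge0// ge0_ler_powR ?nnegrE ?(ltW D0) ?(ltW T0) ?subr_ge0.
  rewrite [leLHS](_ : _ = M * ((x * l ^+ n.+1) * (N%:R * l))); last by ring.
  have -> : N%:R * l = D by rewrite /l mulrC divfK// gt_eqF.
  rewrite [leRHS](_ : _ = M * (x `^ (- (rho - 2 * kappa)) * (T `^ (1 - beta) * D `^ beta))); last by rewrite /A2; ring.
  have xl0 : 0 <= x * l ^+ n.+1 by rewrite mulr_ge0 ?exprn_ge0 ?(ltW x0) ?(ltW l0).
  have xl : x * l ^+ n.+1 <= x `^ (- (rho - 2 * kappa)).
    by apply: le_trans xx; rewrite ler_wpM2l ?(ltW x0).
  by rewrite ler_wpM2l// ler_pM// ltW.
Qed.

Lemma perturbed_irregular : rho_irregular T rho' (fun t => phi t + psi t).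
Proof.
have [A A0 HA] := high_frequency_bound.
(* This is beta (1 - th) + th: interpolating with the trivial bound more than makes up for the loss
   of th / 2 in beta. *)
pose gamma := 1 / 2 + th ^+ 2 / 2.
have th20 : 0 < th ^+ 2 by rewrite exprn_gt0.
have th21 : th ^+ 2 <= 1 by rewrite exprn_ile1 ?(ltW th0) ?(ltW th1).
have g1 : 0 <= 1 - gamma by rewrite /gamma; lra.
have g0 : 0 < gamma by rewrite /gamma; lra.
exists gamma; first by rewrite /gamma; apply/andP; split; lra.
pose K1 := A `^ (1 - th) * 2 `^ th; pose K2 := 2 * T `^ (1 - gamma) * 2 `^ rho'.
have K10 : 0 <= K1 by rewrite mulr_ge0 ?powR_ge0.
have K20 : 0 <= K2 by rewrite !mulr_ge0 ?powR_ge0.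
exists (K1 + K2) => xi s t xi0 sT tT.
wlog st : s t sT tT / s <= t.
  by move=> W; case/orP: (le_total s t) => h; [|rewrite cmod_cintC distrC]; exact: W.
rewrite ger0_norm ?subr_ge0//.
move: sT tT; rewrite !in_itv/= => /andP[s0 _] /andP[_ tT].
have triv : cmod (cint (fun r => expi (dot xi (phi r + psi r))) s t) <= 2 * (t - s).
  apply: cmod_cint_le => //; first exact: sum_cont.
  move=> al _; rewrite (le_trans (ler_norm _))// cosint_le//.
  by apply: within_add; [exact: sum_cont|exact: within_cst].
have x0 : 0 < enorm xi.
  rewrite lt_def enorm_ge0 andbT; apply: contra_neq xi0 => x0.
  apply/rowP => i; apply/eqP; rewrite mxE -normr_le0 -x0; exact: enorm_ge_coord.
move: st; rewrite le_eqVlt => /predU1P[st|st].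
  apply: (le_trans triv); rewrite -st subrr mulr0.
  by rewrite !mulr_ge0 ?powR_ge0 ?addr_ge0.
have D0 : 0 < t - s by rewrite subr_gt0.
rewrite !mulrDl.
(* Strong irregularity says nothing for |xi| < 2; there the trivial bound is enough, because |xi|^(-
   rho') is at least 2^(- rho'). *)
have [x2|x2] := lerP 2 (enorm xi).
  apply: (@le_trans _ _ (K1 * enorm xi `^ (- rho') * (t - s) `^ gamma)); last first.
    by rewrite lerDl !mulr_ge0 ?powR_ge0.
  have th01 : 0 <= th <= 1 by rewrite !ltW.
  have := interpolate (cmod_ge0 _) A0 D0 x0 th01 (HA xi s t x2 s0 st tT) triv.
  have rs : 0 < rho + rho' by rewrite addr_gt0// (lt_trans rho'0).
  rewrite (_ : beta * (1 - th) + th = gamma); last by rewrite /beta /gamma; field.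
  rewrite (_ : (rho - 2 * kappa) * (1 - th) = rho')//.
  by rewrite /kappa /th; field; rewrite gt_eqF.
apply: (@le_trans _ _ (K2 * enorm xi `^ (- rho') * (t - s) `^ gamma)); last first.
  by rewrite lerDr !mulr_ge0 ?powR_ge0.
rewrite (le_trans triv)//.
have h1 : 1 <= 2 `^ rho' * enorm xi `^ (- rho').
  rewrite powRN ler_pdivlMr ?powR_gt0// mul1r ge0_ler_powR ?nnegrE ?(ltW rho'0) ?(ltW x0)//.
  exact: ltW.
have h2 : t - s <= T `^ (1 - gamma) * (t - s) `^ gamma.
  rewrite -{1}[t - s]powRr1 ?(ltW D0)// -{1}(subrK gamma 1) powRD ?(gt_eqF D0) ?implybT//.
  rewrite ler_wpM2r ?powR_ge0// ge0_ler_powR ?nnegrE ?(ltW D0) ?(ltW T0)//; lra.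
rewrite [leRHS](_ : _ = 2 * ((T `^ (1 - gamma) * (t - s) `^ gamma) *
  (2 `^ rho' * enorm xi `^ (- rho')))); last by rewrite /K2; ring.
by rewrite ler_wpM2l// -[leLHS]mulr1 ler_pM ?(ltW D0).
Qed.

End part_one.

Theorem theorem38 (R : realType) (d : nat) (T : R) (hT : 0 < T) :
  (forall (phi : holder_path T 0 d) (rho : R),
     0 < rho -> strongly_irregular T rho phi ->
     forall psi : R -> 'rV[R]_d, smooth_path T psi ->
     forall rho' : R, 0 < rho' < rho ->
       rho_irregular T rho' (fun t => phi t + psi t))
  /\
  (forall delta : R, 0 <= delta < 1 ->
     almost_every (holder_path T delta d) (fun phi =>
       forall rho : R, (rho%:E < ((2 * delta)%:E)^-1)%E ->
         strongly_irregular T rho phi)).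
Proof.
split=> [phi rho _ irr psi psiS rho' /andP[rho'0 rhorho']|delta delta01].
  exact: perturbed_irregular (@holder_path_cont R T 0 d phi) psiS irr rho'0 rhorho'.
exact: strongly_irregular_prevalent.
Qed.
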